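(* Let $(X,\mathcal{P})$ be a disjointly tree-graded space, with the topology of $X$ induced by a path-diameter metric $d$, such that $\mathbf{Pc}(X)$ is uniformly $1$-$UV_0$, and let $x_0\in X$. Let $Fin(\mathcal{P})$ be the set of finite subsets of $\mathcal{P}$ directed by inclusion, and for $\mathcal{F}\in Fin(\mathcal{P})$ let $x_{\mathcal{F}}=\Gamma_{\mathcal{F}}(x_0)$. Then the canonical homomorphism \[\Phi:\pi_1(X,x_0)\to\varprojlim_{\mathcal{F}\in Fin(\mathcal{P})}\pi_1(X_{\mathcal{F}},x_{\mathcal{F}}),\qquad \Phi(g)=\big((\Gamma_{\mathcal{F}})_{\#}(g)\big)_{\mathcal{F}},\] is injective.
   Context: All spaces are Hausdorff; maps are continuous. A simple closed curve is a space homeomorphic to the unit circle $S^1$; $\mathbb{D}$ is the closed unit disk. A loop $\alpha:S^1\to X$ is inessential (in $X$) if it extends to a map $\mathbb{D}\to X$. For a based map $f$, $f_{\#}$ is the induced homomorphism on fundamental groups. A disjointly tree-graded space is a pair $(X,\mathcal{P})$ where $X$ is a path-connected, locally path-connected, metrizable space and $\mathcal{P}$ is a collection of non-empty closed subsets of $X$ (called pieces) such that (1) $\bigcup\mathcal{P}$ is closed in $X$; (2) the elements of $\mathcal{P}$ are the path-components of $\bigcup\mathcal{P}$; (3) every simple closed curve in $X$ is contained in one piece. Write $\mathbf{Pc}(X)=\bigcup\mathcal{P}$. A path-diameter metric on $X$ is a metric $d$ with $d(a,b)=\inf\{\operatorname{diam}(\operatorname{im}(\alpha))\mid \alpha\text{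 is a path in }X\text{ from }a\text{ to }b\}$ for all $a,b$. Subsets of $X$ carry the subspace metric. A metric space $A$ is uniformly $1$-$UV_0$ if for every $\epsilon>0$ there exists $\delta\in(0,\epsilon)$ such that for every inessential loop $\alpha:S^1\to A$ with $\operatorname{diam}(\operatorname{im}(\alpha))<\delta$ there exists a map $g:\mathbb{D}\to A$ with $\operatorname{diam}(\operatorname{im}(g))<\epsilon$ and $g|_{S^1}=\alpha$. For $\mathcal{Q}\subseteq\mathcal{P}$, $X_{\mathcal{Q}}$ is the set obtained from $X$ by identifying each piece $P\in\mathcal{P}\setminus\mathcal{Q}$ to a single point, and $\Gamma_{\mathcal{Q}}:X\to X_{\mathcal{Q}}$ is the identification function. $X_{\mathcal{Q}}$ is given the topology of the quotient metric $\rho(y,z)=\inf\sum_{i=1}^n d(a_i,b_i)$, the infimum over all finite chains $a_1,b_1,\dots,a_n,b_n$ in $X$ with $\Gamma_{\mathcal{Q}}(a_1)=y$, $\Gamma_{\mathcal{Q}}(b_n)=z$ and $\Gamma_{\mathcal{Q}}(b_i)=\Gamma_{\mathcal{Q}}(a_{i+1})$ for $1\le i\le n-1$ (this pseudometric is a metric, and $\Gamma_{\mathcal{Q}}$ is continuous). For finite $\mathcal{F}\subseteq\mathcal{F}'$ there is a unique map $\Gamma_{\mathcal{F}',\mathcal{F}}:X_{\mathcal{F}'}\to X_{\mathcal{F}}$ with $\Gamma_{\mathcal{F}',\mathcal{F}}\circ\Gamma_{\mathcal{F}'}=\Gamma_{\mathcal{F}}$ (it collapses each piece in $\mathcal{F}'\setminus\mathcal{F}$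 to a point). The inverse limit is taken over the groups $\pi_1(X_{\mathcal{F}},x_{\mathcal{F}})$ with bonding homomorphisms $(\Gamma_{\mathcal{F}',\mathcal{F}})_{\#}$. *)

(* Defs.v *)
From HB Require Import structures.
From mathcomp Require Import all_boot all_order all_algebra.
From mathcomp Require Import generic_quotient lra.
From mathcomp Require Import all_classical all_reals ereal topology normedtype.
From mathcomp Require Import homotopy.
From Stdlib Require Relation_Operators.

Set Implicit Arguments.
Unset Strict Implicit.
Unset Printing Implicit Defensive.

Import Order.TTheory GRing.Theory Num.Theory.
Import numFieldNormedType.Exports.

Local Open Scope classical_set_scope.
Local Open Scope ring_scope.
Local Open Scope quotient_scope.

Section unit_interval.
Context (R : realType).

Definition unit_interval : Type := set_type (`[0, 1]%classic : set R).
HB.instance Definition _ := Topological.copy unit_interval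
  (set_type (`[0, 1]%classic : set R)).

Definition ival (t : unit_interval) : R := set_val t.

Lemma ivalP (t : unit_interval) : 0 <= ival t <= 1.
Proof. by have := set_valP t; rewrite /= in_itv. Qed.

Lemma ival_inj : injective ival.
Proof. by move=> s t st; apply: val_inj. Qed.

Lemma continuous_ival : continuous ival.
Proof. exact: initial_continuous. Qed.

Definition clamp_real (t : R) : R := Num.min 1 (Num.max 0 t).

Lemma clamp_realP (t : R) : clamp_real t \in `[0, 1]%classic.
Proof.
rewrite inE /clamp_real /= in_itv /= le_min ler01 le_max lexx /=.
by rewrite ge_min lexx.
Qed.

Definition clamp (t : R) : unit_interval := SigSub (clamp_realP t).

Lemma ival_clampE (t : R) : ival (clamp t) = clamp_real t.
Proof. by []. Qed.

Lemma ival_clamp (t : R) : 0 <= t <= 1 -> ival (clamp t) = t.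
Proof.
by move=> /andP[t0 t1]; rewrite ival_clampE /clamp_real (max_idPr t0) (min_idPr t1).
Qed.

Lemma clampK (t : unit_interval) : clamp (ival t) = t.
Proof. by apply: ival_inj; rewrite ival_clamp// ivalP. Qed.

Lemma continuous_clamp : continuous clamp.
Proof.
apply: (@continuous_comp_initial _ _ _ set_val).
have -> : set_val \o clamp = clamp_real by apply/funext => t; rewrite set_valE.
move=> t; apply: (@continuous_min R R (cst 1) (fun u => Num.max 0 u)).
  exact: cvg_cst.
by apply: (@continuous_max R R (cst 0) id); [exact: cvg_cst | exact: cvg_id].
Qed.

Lemma unit_interval_zero_neq_one : clamp 0 != clamp 1.
Proof.
apply/eqP => /(congr1 ival); rewrite !ival_clamp ?lexx ?ler01//.
by apply/eqP; rewrite eq_sym oner_eq0.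
Qed.

HB.instance Definition _ :=
  isBiPointed.Build unit_interval unit_interval_zero_neq_one.

Lemma ival_zero : ival zero = 0.
Proof. by rewrite ival_clamp// lexx ler01. Qed.

Lemma ival_one : ival one = 1.
Proof. by rewrite ival_clamp// lexx ler01. Qed.

Lemma clamp0 : clamp 0 = zero. Proof. by []. Qed.
Lemma clamp1 : clamp 1 = one. Proof. by []. Qed.

End unit_interval.

Lemma continuous_prod_pair (Y A B : topologicalType) (f : Y -> A) (g : Y -> B) :
  continuous f -> continuous g -> continuous (fun a => (f a, g a)).
Proof. by move=> cf cg a; apply: cvg_pair; [exact: cf | exact: cg]. Qed.

Lemma continuous_comp_fun (A B C : topologicalType) (f : A -> B) (g : B -> C) :
  continuous g -> continuous f -> continuous (fun a => g (f a)).
Proof. by move=> cg cf a; apply: continuous_comp; [exact: cf | exact: cg]. Qed.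

Lemma continuous_prod_fst (A B : topologicalType) : continuous (fst : A * B -> A).
Proof. by move=> a; exact: cvg_fst. Qed.

Lemma continuous_prod_snd (A B : topologicalType) : continuous (snd : A * B -> B).
Proof. by move=> a; exact: cvg_snd. Qed.

Section path_homotopy.
Context (R : realType) (X : topologicalType).
Local Notation I := (unit_interval R).
Implicit Types x y z w : X.

(* Homotopy relative to the end points; the first coordinate of H is the time
   of the deformation, the second one is the parameter of the paths. *)
Definition path_homotopic x y (p q : {path I from x to y}) : Prop :=
  exists H : I * I -> X, [/\ continuous H,
    forall t, H (zero, t) = p t, forall t, H (one, t) = q t,
    forall s, H (s, zero) = x & forall s, H (s, one) = y].

Definition concat_fun x y z (p : {path I from x to y}) (q : {path I from y to z})
    (t : I) : X :=
  if ival t <= 2^-1 then p (clamp (2 * ival t)) else q (clamp (2 * ival t - 1)).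

Definition reverse_fun x y (p : {path I from x to y}) (t : I) : X :=
  p (clamp (1 - ival t)).

Lemma continuous_if_le (Y : topologicalType) (k : Y -> R) (c : R) (u v : Y -> X) :
  continuous k -> continuous u -> continuous v ->
  (forall a, k a = c -> u a = v a) ->
  continuous (fun a => if k a <= c then u a else v a).
Proof.
move=> ck cu cv uv a U nU.
change (\forall b \near a, U (if k b <= c then u b else v b)).
move: nU; case: (ltgtP (k a) c) => [kc|kc|kc].
- move=> /cu uU; near=> b.
  have -> : k b <= c by apply: ltW; near: b; exact: (ck a _ (lt_nbhsl kc)).
  by near: b; exact: uU.
- move=> /cv vU; near=> b.
  have /lt_geF -> : c < k b by near: b; exact: (ck a _ (lt_nbhsr kc)).
  by near: b; exact: vU.
- move=> nU; have := nU; rewrite {1}(uv _ kc) => /cv vU; move/cu: nU => uU.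
  near=> b; have Ub : U (u b) by near: b; exact: uU.
  have Vb : U (v b) by near: b; exact: vU.
  by case: ifPn.
Unshelve. all: by end_near. Qed.

Lemma continuous_path_clamp (Y : topologicalType) x y (p : {path I from x to y})
    (f : Y -> R) : continuous f -> continuous (fun u => p (clamp (f u))).
Proof.
move=> cf u; apply: (@continuous_comp _ _ _ (fun u => clamp (f u)) p).
  by apply: (@continuous_comp _ _ _ f (@clamp R)); [exact: cf | exact: continuous_clamp].
exact: cts_fun.
Qed.

Lemma continuous_affine (Y : topologicalType) (f : Y -> R) (a b : R) :
  continuous f -> continuous (fun u => a * f u + b).
Proof.
by move=> cf u; apply: cvgD; [apply: cvgM; [exact: cvg_cst | exact: cf] | exact: cvg_cst].
Qed.

Lemma continuous_scale (Y : topologicalType) (f : Y -> R) (a : R) :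
  continuous f -> continuous (fun u => a * f u).
Proof. by move=> cf u; apply: cvgM; [exact: cvg_cst | exact: cf]. Qed.

Let continuous_idR : continuous (fun t : R => t).
Proof. by move=> t; exact: cvg_id. Qed.

Lemma continuous_1sub (Y : topologicalType) (f : Y -> R) :
  continuous f -> continuous (fun u => 1 - f u).
Proof. by move=> cf u; apply: cvgB; [exact: cvg_cst | exact: cf]. Qed.

Lemma path_clamp_le0 x y (p : {path I from x to y}) t : t <= 0 -> p (clamp t) = x.
Proof.
move=> t0; apply: etrans (@path_zero _ _ _ _ p); congr (p _); apply: ival_inj.
by rewrite !ival_clampE /clamp_real (max_idPl t0) maxxx.
Qed.

Lemma path_clamp_ge1 x y (p : {path I from x to y}) t : 1 <= t -> p (clamp t) = y.
Proof.
move=> t1; apply: etrans (@path_one _ _ _ _ p); congr (p _); apply: ival_inj.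
by rewrite !ival_clampE /clamp_real !(max_idPr _) ?ler01 ?(le_trans ler01)// minxx (min_idPl t1).
Qed.

Section concat.
Context x y z (p : {path I from x to y}) (q : {path I from y to z}).

Lemma continuous_concat : continuous (concat_fun p q).
Proof.
apply: continuous_if_le.
- exact: continuous_ival.
- exact/continuous_path_clamp/continuous_scale/continuous_ival.
- exact/continuous_path_clamp/continuous_affine/continuous_ival.
- move=> t ->; rewrite path_clamp_ge1 ?path_clamp_le0//; lra.
Qed.

Lemma concat_zero : concat_fun p q zero = x.
Proof. by rewrite /concat_fun ival_zero ifT ?path_clamp_le0//; lra. Qed.

Lemma concat_one : concat_fun p q one = z.
Proof.
by rewrite /concat_fun ival_one ifF ?path_clamp_ge1//; [lra | apply/negbTE; lra].
Qed.

Definition concat : {path I from x to z} :=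
  mk_path continuous_concat concat_zero concat_one.

End concat.

Section reverse.
Context x y (p : {path I from x to y}).

Lemma continuous_reverse : continuous (reverse_fun p).
Proof.
exact/continuous_path_clamp/continuous_1sub/continuous_ival.
Qed.

Lemma reverse_zero : reverse_fun p zero = y.
Proof. by rewrite /reverse_fun ival_zero path_clamp_ge1//; lra. Qed.

Lemma reverse_one : reverse_fun p one = x.
Proof. by rewrite /reverse_fun ival_one path_clamp_le0//; lra. Qed.

Definition reverse : {path I from y to x} :=
  mk_path continuous_reverse reverse_zero reverse_one.

End reverse.

Lemma concatE x y z (p : {path I from x to y}) (q : {path I from y to z}) t :
  concat p q t =
  if ival t <= 2^-1 then p (clamp (2 * ival t)) else q (clamp (2 * ival t - 1)).
Proof. by []. Qed.

Lemma path_homotopic_refl x y (p : {path I from x to y}) : path_homotopic p p.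
Proof.
exists (fun st => p st.2); split => //; last 2 first.
- by move=> s; exact: path_zero.
- by move=> s; exact: path_one.
exact: (continuous_comp_fun (@cts_fun _ _ p) (@continuous_prod_snd _ _)).
Qed.

Lemma path_homotopic_sym x y (p q : {path I from x to y}) :
  path_homotopic p q -> path_homotopic q p.
Proof.
move=> [H [cH Hp Hq H0 H1]]; exists (fun st => H (clamp (1 - ival st.1), st.2)).
split => //.
- apply: (@continuous_comp_fun _ _ _ (fun st : I * I => (clamp (1 - ival st.1), st.2)) H cH).
  apply: continuous_prod_pair; last exact: continuous_prod_snd.
  apply: (continuous_comp_fun (@continuous_clamp R)); apply: continuous_1sub.
  exact: (continuous_comp_fun (@continuous_ival R) (@continuous_prod_fst _ _)).
- by move=> t; rewrite ival_zero subr0 clamp1 Hq.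
- by move=> t; rewrite ival_one subrr clamp0 Hp.
Qed.

Lemma path_homotopic_trans x y (p q r : {path I from x to y}) :
  path_homotopic p q -> path_homotopic q r -> path_homotopic p r.
Proof.
move=> [H [cH Hp Hq H0 H1]] [K [cK Kq Kr K0 K1]].
exists (fun st => if ival st.1 <= 2^-1 then H (clamp (2 * ival st.1), st.2)
                  else K (clamp (2 * ival st.1 - 1), st.2)).
have c1 : continuous (fun st : I * I => ival st.1).
  exact: (continuous_comp_fun (@continuous_ival R) (@continuous_prod_fst _ _)).
have cc (f : R -> R) : continuous f ->
    continuous (fun st : I * I => (clamp (f (ival st.1)), st.2)).
  move=> cf; apply: continuous_prod_pair; last exact: continuous_prod_snd.
  exact: (continuous_comp_fun (@continuous_clamp R) (continuous_comp_fun cf c1)).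
split => /=.
- apply: continuous_if_le => //.
  + exact: (continuous_comp_fun cH (cc _ (@continuous_scale _ _ 2 continuous_idR))).
  + exact: (continuous_comp_fun cK (cc _ (@continuous_affine _ _ 2 (-1) continuous_idR))).
  + move=> st ->; rewrite divff ?pnatr_eq0// subrr clamp0 clamp1.
    by rewrite Hq Kq.
- by move=> t; rewrite ival_zero ifT ?mulr0 ?clamp0 ?Hp//; lra.
- move=> t; rewrite ival_one ifF; last by apply/negbTE; lra.
  by rewrite mulr1 addrK clamp1 Kr.
- by move=> s; case: ifPn; rewrite ?H0 ?K0.
- by move=> s; case: ifPn; rewrite ?H1 ?K1.
Qed.

Lemma path_homotopic_concat x y z (p p' : {path I from x to y})
    (q q' : {path I from y to z}) :
  path_homotopic p p' -> path_homotopic q q' ->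
  path_homotopic (concat p q) (concat p' q').
Proof.
move=> [H [cH Hp Hp' H0 H1]] [K [cK Kq Kq' K0 K1]].
exists (fun st => if ival st.2 <= 2^-1 then H (st.1, clamp (2 * ival st.2))
                  else K (st.1, clamp (2 * ival st.2 - 1))).
have c2 : continuous (fun st : I * I => ival st.2).
  exact: (continuous_comp_fun (@continuous_ival R) (@continuous_prod_snd _ _)).
have cc (f : R -> R) : continuous f ->
    continuous (fun st : I * I => (st.1, clamp (f (ival st.2)))).
  move=> cf; apply: continuous_prod_pair; first exact: continuous_prod_fst.
  exact: (continuous_comp_fun (@continuous_clamp R) (continuous_comp_fun cf c2)).
split => /=.
- apply: continuous_if_le => //.
  + exact: (continuous_comp_fun cH (cc _ (@continuous_scale _ _ 2 continuous_idR))).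
  + exact: (continuous_comp_fun cK (cc _ (@continuous_affine _ _ 2 (-1) continuous_idR))).
  + move=> st ->; rewrite divff ?pnatr_eq0// subrr clamp0 clamp1.
    by rewrite H1 K0.
- by move=> t; rewrite Hp Kq.
- by move=> t; rewrite Hp' Kq'.
- by move=> s; rewrite ival_zero ifT ?mulr0 ?clamp0 ?H0//; lra.
- move=> s; rewrite ival_one ifF; last by apply/negbTE; lra.
  by rewrite mulr1 addrK clamp1 K1.
Qed.

Lemma path_homotopic_reverse x y (p q : {path I from x to y}) :
  path_homotopic p q -> path_homotopic (reverse p) (reverse q).
Proof.
move=> [H [cH Hp Hq H0 H1]]; exists (fun st => H (st.1, clamp (1 - ival st.2))).
split => //.
- apply: (@continuous_comp_fun _ _ _ (fun st : I * I => (st.1, clamp (1 - ival st.2))) H cH).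
  apply: continuous_prod_pair; first exact: continuous_prod_fst.
  apply: (continuous_comp_fun (@continuous_clamp R)); apply: continuous_1sub.
  exact: (continuous_comp_fun (@continuous_ival R) (@continuous_prod_snd _ _)).
- by move=> t; rewrite Hp.
- by move=> t; rewrite Hq.
- by move=> s; rewrite ival_zero subr0 clamp1 H1.
- by move=> s; rewrite ival_one subrr clamp0 H0.
Qed.

Lemma path_homotopic_reparam x y z w (p : {path I from x to y})
    (a b : {path I from z to w}) (f g : R -> R) :
  continuous f -> continuous g -> f 0 = g 0 -> f 1 = g 1 ->
  (forall t, a t = p (clamp (f (ival t)))) ->
  (forall t, b t = p (clamp (g (ival t)))) -> path_homotopic a b.
Proof.
move=> cf cg fg0 fg1 af bg.
exists (fun st => p (clamp ((1 - ival st.1) * f (ival st.2) + ival st.1 * g (ival st.2)))).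
have c1 : continuous (fun st : I * I => ival st.1).
  exact: (continuous_comp_fun (@continuous_ival R) (@continuous_prod_fst _ _)).
have c2 : continuous (fun st : I * I => ival st.2).
  exact: (continuous_comp_fun (@continuous_ival R) (@continuous_prod_snd _ _)).
split => /=.
- apply: continuous_path_clamp => st; apply: cvgD; apply: cvgM.
  + by apply: cvgB; [exact: cvg_cst | exact: c1].
  + exact: (continuous_comp_fun cf c2).
  + exact: c1.
  + exact: (continuous_comp_fun cg c2).
- by move=> t; rewrite ival_zero subr0 mul1r mul0r addr0 af.
- by move=> t; rewrite ival_one subrr mul1r mul0r add0r bg.
- move=> s; rewrite ival_zero fg0 -mulrDl subrK mul1r.
  by rewrite -[g 0]/(g 0) -ival_zero -bg path_zero.
- move=> s; rewrite ival_one fg1 -mulrDl subrK mul1r.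
  by rewrite -ival_one -bg path_one.
Qed.

Let continuous_max2 (f g : R -> R) : continuous f -> continuous g ->
  continuous (fun t => Num.max (f t) (g t)).
Proof. by move=> cf cg t; apply: (@continuous_max R R f g); [exact: cf|exact: cg]. Qed.

Let continuous_min2 (f g : R -> R) : continuous f -> continuous g ->
  continuous (fun t => Num.min (f t) (g t)).
Proof. by move=> cf cg t; apply: (@continuous_min R R f g); [exact: cf|exact: cg]. Qed.

Let continuous_lin (a b : R) : continuous (fun t : R => a * t + b).
Proof. by apply: continuous_affine => t; exact: cvg_id. Qed.

Lemma path_homotopic_concat1p x y (p : {path I from x to y}) :
  path_homotopic (concat (cst x : {path I from x to x}) p) p.
Proof.
apply: (@path_homotopic_reparam _ _ _ _ p _ _
  (fun t => Num.max 0 (2 * t + -1)) id) => //.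
- by apply: continuous_max2 => //; move=> t; exact: cvg_cst.
- by rewrite /Num.max /=; case: ifPn => //; lra.
- by rewrite /Num.max /=; case: ifPn => //; lra.
- move=> t; rewrite concatE; case: ifPn => th /=.
    by rewrite (max_idPl _) ?(path_clamp_le0 p)//; lra.
  by rewrite (max_idPr _)//; lra.
- by move=> t; rewrite clampK.
Qed.

Lemma path_homotopic_concatp1 x y (p : {path I from x to y}) :
  path_homotopic (concat p (cst y : {path I from y to y})) p.
Proof.
apply: (@path_homotopic_reparam _ _ _ _ p _ _
  (fun t => Num.min 1 (2 * t + 0)) id) => //.
- by apply: continuous_min2 => //; move=> t; exact: cvg_cst.
- by rewrite /Num.min /=; case: ifPn => //; lra.
- by rewrite /Num.min /=; case: ifPn => //; lra.
- move=> t; rewrite concatE; case: ifPn => th /=.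
    by rewrite (min_idPr _) ?addr0//; lra.
  by rewrite (min_idPl _) ?(path_clamp_ge1 p)//; lra.
- by move=> t; rewrite clampK.
Qed.

Lemma path_homotopic_concatpV x y (p : {path I from x to y}) :
  path_homotopic (concat p (reverse p)) (cst x).
Proof.
apply: (@path_homotopic_reparam _ _ _ _ p _ _
  (fun t => Num.min (2 * t + 0) (-2 * t + 2)) (fun=> 0)) => //.
- exact: continuous_min2.
- by move=> t; exact: cvg_cst.
- by rewrite /Num.min /=; case: ifPn => //; lra.
- by rewrite /Num.min /=; case: ifPn => //; lra.
- move=> t; have /andP[t0 t1] := ivalP t.
  rewrite concatE; case: ifPn => th /=.
    by rewrite (min_idPl _) ?addr0//; lra.
  rewrite /mk_path /reverse_fun ival_clamp; last lra.
  by rewrite (min_idPr _); [congr (p (clamp _)); lra | lra].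
- by move=> t; rewrite /= clamp0 path_zero.
Qed.

Lemma path_homotopic_concatVp x y (p : {path I from x to y}) :
  path_homotopic (concat (reverse p) p) (cst y).
Proof.
apply: (@path_homotopic_reparam _ _ _ _ p _ _
  (fun t => Num.max (-2 * t + 1) (2 * t + -1)) (fun=> 1)) => //.
- exact: continuous_max2.
- by move=> t; exact: cvg_cst.
- by rewrite /Num.max /=; case: ifPn => //; lra.
- by rewrite /Num.max /=; case: ifPn => //; lra.
- move=> t; have /andP[t0 t1] := ivalP t.
  rewrite concatE; case: ifPn => th /=.
    rewrite /mk_path /reverse_fun ival_clamp; last lra.
    by rewrite (max_idPl _); [congr (p (clamp _)); lra | lra].
  by rewrite (max_idPr _)//; lra.
- by move=> t; rewrite /= clamp1 path_one.
Qed.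

Lemma path_homotopic_concatA x y z w (p : {path I from x to y})
    (q : {path I from y to z}) (r : {path I from z to w}) :
  path_homotopic (concat p (concat q r)) (concat (concat p q) r).
Proof.
apply: (@path_homotopic_reparam _ _ _ _ (concat (concat p q) r) _ _
  (fun t => Num.max (2^-1 * t + 0) (Num.max (1 * t + - 4^-1) (2 * t + -1))) id) => //.
- by apply: continuous_max2 => //; exact: continuous_max2.
- rewrite /Num.max /=; case: ifPn; case: ifPn; lra.
- rewrite /Num.max /=; case: ifPn; case: ifPn; lra.
- move=> t; have /andP[t0 t1] := ivalP t.
  rewrite concatE; case: ifPn => th.
    rewrite (max_idPl _); last by rewrite ge_max; apply/andP; split; lra.
    rewrite concatE ival_clamp; last lra.
    rewrite ifT; last lra.
    rewrite concatE ival_clamp; last lra.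
    by rewrite ifT; [congr (p (clamp _)); lra | lra].
  rewrite concatE ival_clamp; last lra.
  case: ifPn => th'.
    have -> : Num.max (1 * ival t - 4^-1) (2 * ival t - 1) = 1 * ival t - 4^-1.
      by apply/max_idPl; lra.
    rewrite (max_idPr _); last lra.
    rewrite concatE ival_clamp; last lra.
    rewrite ifT; last lra.
    rewrite concatE ival_clamp; last lra.
    by rewrite ifF; [congr (q (clamp _)); lra | apply/negbTE; lra].
  have -> : Num.max (1 * ival t - 4^-1) (2 * ival t - 1) = 2 * ival t - 1.
    by apply/max_idPr; lra.
  rewrite (max_idPr _); last lra.
  rewrite concatE ival_clamp; last lra.
  by rewrite ifF; [congr (r (clamp _)); lra | apply/negbTE; lra].
- by move=> t; rewrite clampK.
Qed.

End path_homotopy.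

Section fundamental_group.
Context (R : realType) (X : topologicalType) (x : X).
Local Notation I := (unit_interval R).
Local Notation loop := {path I from x to x}.

Definition loop_homotopicb (p q : loop) : bool := `[< path_homotopic p q >].

Lemma loop_homotopicb_refl : reflexive loop_homotopicb.
Proof. by move=> p; apply/asboolP; exact: path_homotopic_refl. Qed.

Lemma loop_homotopicb_sym : symmetric loop_homotopicb.
Proof.
by move=> p q; apply/idP/idP => /asboolP h; apply/asboolP; exact: path_homotopic_sym.
Qed.

Lemma loop_homotopicb_trans : transitive loop_homotopicb.
Proof.
by move=> q p r /asboolP pq /asboolP qr; apply/asboolP; exact: path_homotopic_trans pq qr.
Qed.

Definition loop_equiv :=
  EquivRel loop_homotopicb loop_homotopicb_refl loop_homotopicb_sym loop_homotopicb_trans.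

Definition pi1 : Type := {eq_quot loop_equiv}.
HB.instance Definition _ := Choice.on pi1.
HB.instance Definition _ := Quotient.on pi1.

Definition pi1_class (p : loop) : pi1 := \pi_pi1 p.

Lemma pi1_classP (p q : loop) : pi1_class p = pi1_class q <-> path_homotopic p q.
Proof.
split=> [h|h]; first by apply/asboolP; apply/(@eqmodP _ loop_equiv).
by apply/(@eqmodP _ loop_equiv); apply/asboolP.
Qed.

Lemma pi1_class_repr (g : pi1) : pi1_class (repr g) = g.
Proof. exact: reprK. Qed.

Lemma pi1_ind (A : pi1 -> Prop) : (forall p, A (pi1_class p)) -> forall g, A g.
Proof. by move=> h g; rewrite -(pi1_class_repr g). Qed.

Lemma repr_pi1_class (p : loop) : path_homotopic (repr (pi1_class p)) p.
Proof. by apply/pi1_classP; rewrite pi1_class_repr. Qed.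

Definition pi1_one : pi1 := pi1_class (cst x).
Definition pi1_mul (g h : pi1) : pi1 := pi1_class (concat (repr g) (repr h)).
Definition pi1_inv (g : pi1) : pi1 := pi1_class (reverse (repr g)).

Lemma pi1_mulE p q : pi1_mul (pi1_class p) (pi1_class q) = pi1_class (concat p q).
Proof. by apply/pi1_classP/path_homotopic_concat; exact: repr_pi1_class. Qed.

Lemma pi1_invE p : pi1_inv (pi1_class p) = pi1_class (reverse p).
Proof. by apply/pi1_classP/path_homotopic_reverse; exact: repr_pi1_class. Qed.

Lemma pi1_mulA : associative pi1_mul.
Proof.
elim/pi1_ind => p; elim/pi1_ind => q; elim/pi1_ind => r.
by rewrite !pi1_mulE; apply/pi1_classP/path_homotopic_concatA.
Qed.

Lemma pi1_mul1g : left_id pi1_one pi1_mul.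
Proof. by elim/pi1_ind => p; rewrite pi1_mulE; apply/pi1_classP/path_homotopic_concat1p. Qed.

Lemma pi1_mulg1 : right_id pi1_one pi1_mul.
Proof. by elim/pi1_ind => p; rewrite pi1_mulE; apply/pi1_classP/path_homotopic_concatp1. Qed.

Lemma pi1_mulVg : left_inverse pi1_one pi1_inv pi1_mul.
Proof.
by elim/pi1_ind => p; rewrite pi1_invE pi1_mulE; apply/pi1_classP/path_homotopic_concatVp.
Qed.

Lemma pi1_mulgV : right_inverse pi1_one pi1_inv pi1_mul.
Proof.
by elim/pi1_ind => p; rewrite pi1_invE pi1_mulE; apply/pi1_classP/path_homotopic_concatpV.
Qed.

HB.instance Definition _ :=
  isGroup.Build pi1 pi1_mulA pi1_mul1g pi1_mulg1 pi1_mulVg pi1_mulgV.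

Lemma pi1_classM p q : (pi1_class p * pi1_class q)%g = pi1_class (concat p q).
Proof. exact: pi1_mulE. Qed.

Lemma pi1_class1 : (1%g : pi1) = pi1_class (cst x).
Proof. by []. Qed.

End fundamental_group.

Section induced_homomorphism.
Context (R : realType) (X Y : topologicalType) (x : X) (y : Y).
Context (f : continuousType X Y) (fx : f x = y).
Local Notation I := (unit_interval R).

Section map_loop.
Variable p : {path I from x to x}.

Lemma map_loop_zero : (f \o p) zero = y.
Proof. by rewrite /= path_zero. Qed.

Lemma map_loop_one : (f \o p) one = y.
Proof. by rewrite /= path_one. Qed.

Definition map_loop : {path I from y to y} :=
  mk_path (@cts_fun _ _ (f \o p)) map_loop_zero map_loop_one.
End map_loop.

Lemma path_homotopic_map_loop (p q : {path I from x to x}) :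
  path_homotopic p q -> path_homotopic (map_loop p) (map_loop q).
Proof.
move=> [H [cH Hp Hq H0 H1]]; exists (f \o H); split.
- exact: (continuous_comp_fun (@cts_fun _ _ f) cH).
- by move=> t /=; rewrite Hp.
- by move=> t /=; rewrite Hq.
- by move=> s /=; rewrite H0.
- by move=> s /=; rewrite H1.
Qed.

Definition pi1_map (g : pi1 R x) : pi1 R y := pi1_class (map_loop (repr g)).

Lemma pi1_mapE p : pi1_map (pi1_class p) = pi1_class (map_loop p).
Proof. by apply/pi1_classP/path_homotopic_map_loop; exact: repr_pi1_class. Qed.

Lemma pi1_map_monoid_morphism : monoid.monoid_morphism pi1_map.
Proof.
split.
  rewrite pi1_class1 pi1_mapE; congr pi1_class; apply/path_eqP => t /=; exact: fx.
elim/pi1_ind => p; elim/pi1_ind => q; rewrite pi1_classM !pi1_mapE.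
rewrite pi1_classM; congr pi1_class; apply/path_eqP => t.
by rewrite !concatE /= /mk_path /= /concat_fun; case: ifPn.
Qed.

HB.instance Definition _ :=
  isUMagmaMorphism.Build (pi1 R x) (pi1 R y) pi1_map pi1_map_monoid_morphism.

End induced_homomorphism.

Lemma pi1_map_comp (R : realType) (X Y Z : topologicalType) (x : X) (y : Y) (z : Z)
    (f : continuousType X Y) (g : continuousType Y Z) (h : continuousType X Z)
    (fx : f x = y) (gy : g y = z) (hx : h x = z) :
  g \o f =1 h -> forall a : pi1 R x, pi1_map gy (pi1_map fx a) = pi1_map hx a.
Proof.
move=> gf; elim/pi1_ind => p; rewrite !pi1_mapE; congr pi1_class.
by apply/path_eqP => t; exact: gf.
Qed.

(* Only the order relation and the bonding maps of an inverse system enter the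
   definition of its limit, so directedness and functoriality are not assumed. *)
Section inverse_limit.
Context (J : Type) (le : J -> J -> Prop) (G : J -> groupType).
Context (bond : forall i j, le i j -> UMagmaMorphism.type (G j) (G i)).

Record inverse_limit := InverseLimit {
  thread :> forall i, G i;
  threadP : forall i j (ij : le i j), bond ij (thread j) = thread i }.

HB.instance Definition _ := gen_eqMixin inverse_limit.
HB.instance Definition _ := gen_choiceMixin inverse_limit.

Lemma inverse_limit_eq (u v : inverse_limit) : (forall i, u i = v i) -> u = v.
Proof.
case: u v => [u uP] [v vP] /= uv; have {}uv : u = v by exact: functional_extensionality_dep.
by subst v; congr InverseLimit; exact: Prop_irrelevance.
Qed.

Lemma inverse_limit_one_subproof i j (ij : le i j) : bond ij 1%g = 1%g.
Proof. exact: gmulf1. Qed.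

Lemma inverse_limit_mul_subproof (u v : inverse_limit) i j (ij : le i j) :
  bond ij (u j * v j)%g = (u i * v i)%g.
Proof. by rewrite gmulfM !threadP. Qed.

Lemma inverse_limit_inv_subproof (u : inverse_limit) i j (ij : le i j) :
  bond ij (u j)^-1%g = (u i)^-1%g.
Proof. by rewrite gmulfV threadP. Qed.

Definition inverse_limit_one := @InverseLimit (fun=> 1%g) inverse_limit_one_subproof.
Definition inverse_limit_mul (u v : inverse_limit) :=
  InverseLimit (inverse_limit_mul_subproof u v).
Definition inverse_limit_inv (u : inverse_limit) :=
  InverseLimit (inverse_limit_inv_subproof u).

Lemma inverse_limit_mulA : associative inverse_limit_mul.
Proof. by move=> u v w; apply: inverse_limit_eq => i; exact: mulgA. Qed.
Lemma inverse_limit_mul1g : left_id inverse_limit_one inverse_limit_mul.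
Proof. by move=> u; apply: inverse_limit_eq => i; exact: mul1g. Qed.
Lemma inverse_limit_mulg1 : right_id inverse_limit_one inverse_limit_mul.
Proof. by move=> u; apply: inverse_limit_eq => i; exact: mulg1. Qed.
Lemma inverse_limit_mulVg :
  left_inverse inverse_limit_one inverse_limit_inv inverse_limit_mul.
Proof. by move=> u; apply: inverse_limit_eq => i; exact: mulVg. Qed.
Lemma inverse_limit_mulgV :
  right_inverse inverse_limit_one inverse_limit_inv inverse_limit_mul.
Proof. by move=> u; apply: inverse_limit_eq => i; exact: mulgV. Qed.

HB.instance Definition _ := isGroup.Build inverse_limit inverse_limit_mulA
  inverse_limit_mul1g inverse_limit_mulg1 inverse_limit_mulVg inverse_limit_mulgV.

End inverse_limit.

Section subspace_metric.
Context (R : realType) (M : metricType R) (A : set M).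

Let subspace_dist (x y : A) : R := mdist (set_val x) (set_val y).

Let subspace_dist_ge0 x y : 0 <= subspace_dist x y.
Proof. exact: mdist_ge0. Qed.

Let subspace_dist_positivity x y : subspace_dist x y = 0 -> x = y.
Proof. by move/mdist_positivity => xy; exact: val_inj. Qed.

Let subspace_ballE x e : ball x e = [set y | subspace_dist x y < e].
Proof.
by apply/seteqP; split => y; rewrite -initial_ballE /= ballEmdist.
Qed.

HB.instance Definition _ := PseudoMetric_isMetric.Build R A
  subspace_dist_ge0 subspace_dist_positivity subspace_ballE.

End subspace_metric.

Section metric_notions.
Context (R : realType) (M : metricType R).
Local Notation I := (unit_interval R).

(* diam set0 = -oo; the sets below are images of non-empty spaces. *)
Definition diam (A : set M) : \bar R :=
  ereal_sup [set (mdist a.1 a.2)%:E | a in A `*` A].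

Definition path_diameter_metric : Prop := forall a b : M,
  (mdist a b)%:E = ereal_inf [set diam (range p) | p in [set: {path I from a to b}]].

Definition unit_circle : set (R * R) := [set z | z.1 ^+ 2 + z.2 ^+ 2 = 1].
Definition closed_unit_disk : set (R * R) := [set z | z.1 ^+ 2 + z.2 ^+ 2 <= 1].

Lemma unit_circle_sub_disk : unit_circle `<=` closed_unit_disk.
Proof. by move=> z; rewrite /unit_circle /closed_unit_disk /= => ->. Qed.

Definition extends_loop (g : closed_unit_disk -> M) (alpha : unit_circle -> M) : Prop :=
  forall z, g (subfun unit_circle_sub_disk z) = alpha z.

Definition inessential (alpha : unit_circle -> M) : Prop :=
  exists2 g : closed_unit_disk -> M, continuous g & extends_loop g alpha.

Definition uniformly_1_UV0 : Prop := forall e : R, 0 < e ->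
  exists2 d : R, 0 < d < e &
    forall alpha : unit_circle -> M, continuous alpha -> inessential alpha ->
      (diam (range alpha) < d%:E)%E ->
      exists g : closed_unit_disk -> M,
        [/\ continuous g, (diam (range g) < e%:E)%E & extends_loop g alpha].

End metric_notions.

Section tree_graded.
Context (R : realType) (X : topologicalType).
Local Notation I := (unit_interval R).

Definition path_component (A : set X) (x : X) : set X :=
  [set y | exists p : {path I from x to y}, range p `<=` A].

Definition path_components (A : set X) : set (set X) :=
  [set path_component A x | x in A].

Definition path_connected (A : set X) : Prop :=
  A !=set0 /\ forall x y, A x -> A y -> path_component A x y.

Definition locally_path_connected : Prop := forall (x : X) (U : set X), nbhs x U ->
  exists V, [/\ open V, V x, V `<=` U & path_connected V].

Definition homeomorphic (S T : topologicalType) : Prop :=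
  exists (f : S -> T) (g : T -> S),
    [/\ continuous f, continuous g, cancel f g & cancel g f].

Definition simple_closed_curve (C : set X) : Prop :=
  homeomorphic (@unit_circle R) C.

End tree_graded.

Section disjointly_tree_graded.
Context (R : realType) (X : metricType R).

Definition Pc (P : set (set X)) : set X := \bigcup_(A in P) A.

Record disjointly_tree_graded (P : set (set X)) : Prop := {
  dtg_path_connected : path_connected R [set: X];
  dtg_locally_path_connected : locally_path_connected R X;
  dtg_piece_nonempty : forall A, P A -> A !=set0;
  dtg_piece_closed : forall A, P A -> closed A;
  dtg_Pc_closed : closed (Pc P);
  dtg_pieces : P = path_components R (Pc P);
  dtg_simple_closed_curve : forall C : set X, simple_closed_curve R C ->
    exists2 A, P A & C `<=` A }.

End disjointly_tree_graded.

Section collapse.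
Context (R : realType) (X : metricType R) (P Q : set (set X)).

Definition same_collapsed_piece (x y : X) : Prop :=
  exists2 A, (P `\` Q) A & A x /\ A y.

(* The equivalence relation generated by being in a common piece of P `\` Q; when
   P is disjoint it is just the disjunction of Gamma_trivIsetP. *)
Definition collapse_relb (x y : X) : bool :=
  `[< Relation_Operators.clos_refl_sym_trans X same_collapsed_piece x y >].

Lemma collapse_relb_refl : reflexive collapse_relb.
Proof. by move=> x; apply/asboolP; exact: Relation_Operators.rst_refl. Qed.

Lemma collapse_relb_sym : symmetric collapse_relb.
Proof.
by move=> x y; apply/idP/idP => /asboolP h; apply/asboolP;
  exact: Relation_Operators.rst_sym.
Qed.

Lemma collapse_relb_trans : transitive collapse_relb.
Proof.
move=> y x z /asboolP xy /asboolP yz; apply/asboolP.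
exact: Relation_Operators.rst_trans xy yz.
Qed.

Definition collapse_equiv :=
  EquivRel collapse_relb collapse_relb_refl collapse_relb_sym collapse_relb_trans.

Definition collapse : Type := {eq_quot collapse_equiv}.
HB.instance Definition _ := Choice.on collapse.
HB.instance Definition _ := Quotient.on collapse.

Definition Gamma (x : X) : collapse := \pi_collapse x.

Lemma GammaP (x y : X) : Gamma x = Gamma y <->
  Relation_Operators.clos_refl_sym_trans X same_collapsed_piece x y.
Proof.
split=> [h|h]; first by apply/asboolP; apply/(@eqmodP _ collapse_equiv).
by apply/(@eqmodP _ collapse_equiv); apply/asboolP.
Qed.

Lemma Gamma_repr (y : collapse) : Gamma (repr y) = y.
Proof. exact: reprK. Qed.

Lemma Gamma_trivIsetP (x y : X) : trivIset P id ->
  Gamma x = Gamma y <-> x = y \/ same_collapsed_piece x y.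
Proof.
move=> tP; rewrite GammaP; split => [|[->|]]; last 2 first.
- exact: Relation_Operators.rst_refl.
- exact: Relation_Operators.rst_step.
elim=> [a b|a|a b _|a b c _ ab _ bc]; [by right|by left| |].
  by case=> [->|[A PA [Aa Ab]]]; [left | right; exists A].
case: ab bc => [-> //|[A PA [Aa Ab]]]; case=> [<-|[B PB [Bb Bc]]].
  by right; exists A.
right; exists A => //; split => //.
have -> // : A = B by apply: tP; [exact: PA.1 | exact: PB.1 | exists b].
Qed.

(* A chain is indexed from 0 to n, hence consists of n.+1 >= 1 pairs (a i, b i). *)
Definition is_chain (y z : collapse) (n : nat) (a b : nat -> X) : Prop :=
  [/\ Gamma (a 0%N) = y, Gamma (b n) = z &
      forall i, (i < n)%N -> Gamma (b i) = Gamma (a i.+1)].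

Definition chain_length (n : nat) (a b : nat -> X) : R :=
  \sum_(i < n.+1) mdist (a i) (b i).

Definition chain_lengths (y z : collapse) : set R :=
  [set r | exists n a b, is_chain y z n a b /\ r = chain_length n a b].

Definition rho (y z : collapse) : R := inf (chain_lengths y z).

Lemma chain_length_ge0 n a b : 0 <= chain_length n a b.
Proof. by apply: sumr_ge0 => i _; exact: mdist_ge0. Qed.

Lemma has_inf_chain_lengths y z : has_inf (chain_lengths y z).
Proof.
split; last by exists 0 => r [n [a [b [_ ->]]]]; exact: chain_length_ge0.
exists (chain_length 0 (fun=> repr y) (fun=> repr z)).
by exists 0%N, (fun=> repr y), (fun=> repr z); split => //; split; rewrite ?Gamma_repr.
Qed.

Lemma rho_le y z n a b : is_chain y z n a b -> rho y z <= chain_length n a b.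
Proof.
move=> yz; apply: ge_inf; first by case: (has_inf_chain_lengths y z).
by exists n, a, b.
Qed.

Lemma rho_lt y z e : rho y z < e ->
  exists n a b, is_chain y z n a b /\ chain_length n a b < e.
Proof.
move=> /(inf_lt (has_inf_chain_lengths y z).1) [r [n [a [b [yz ->]]]] re].
by exists n, a, b.
Qed.

Lemma rho_ge0 y z : 0 <= rho y z.
Proof.
apply: lb_le_inf; first by case: (has_inf_chain_lengths y z).
by move=> r [n [a [b [_ ->]]]]; exact: chain_length_ge0.
Qed.

Lemma rho_Gamma_le x y : rho (Gamma x) (Gamma y) <= mdist x y.
Proof.
have := @rho_le (Gamma x) (Gamma y) 0 (fun=> x) (fun=> y).
by rewrite /chain_length big_ord1; apply; split.
Qed.

Lemma rhoxx y : rho y y = 0.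
Proof.
apply/eqP; rewrite eq_le rho_ge0 andbT.
by have := rho_Gamma_le (repr y) (repr y); rewrite mdistxx Gamma_repr.
Qed.

Lemma rho_sym_le y z : rho y z <= rho z y.
Proof.
apply: lb_le_inf; first by case: (has_inf_chain_lengths z y).
move=> _ [n [a [b [[az by_ ab] ->]]]].
have -> : chain_length n a b = chain_length n (fun i => b (n - i)%N) (fun i => a (n - i)%N).
  rewrite /chain_length (reindex_inj rev_ord_inj) /=; apply: eq_bigr => i _.
  by rewrite metric_sym subSS.
apply: rho_le; split; rewrite ?subn0 ?subnn// => i ni.
have lt_n : (n - i.+1 < n)%N by rewrite ltn_subrL /= (leq_ltn_trans _ ni).
by rewrite (ab _ lt_n) subnSK.
Qed.

Lemma rho_sym y z : rho y z = rho z y.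
Proof. by apply/eqP; rewrite eq_le !rho_sym_le. Qed.

Lemma rho_triangle y z w : rho y w <= rho y z + rho z w.
Proof.
apply/ler_addgt0Pl => e e0.
have [n [a [b [[ya bz ab] lab]]]] : exists n a b, is_chain y z n a b /\
    chain_length n a b < rho y z + e / 2 by apply: rho_lt; lra.
have [m [c [d [[zc dw cd] lcd]]]] : exists n a b, is_chain z w n a b /\
    chain_length n a b < rho z w + e / 2 by apply: rho_lt; lra.
pose a' i := if (i <= n)%N then a i else c (i - n.+1)%N.
pose b' i := if (i <= n)%N then b i else d (i - n.+1)%N.
have h : is_chain y w (n.+1 + m) a' b'.
  split; rewrite /a' /b' //.
    by rewrite leqNgt ltnS leq_addr /= addKn.
  move=> i; case: (ltngtP i n) => [lin _|lni inm|-> _].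
  - by rewrite ab.
  - have jm : (i - n.+1 < m)%N by rewrite ltn_subLR.
    by rewrite (cd _ jm) subSn.
  - by rewrite subnn bz zc.
have -> : rho y w <= _ := le_trans (rho_le h) _ => //.
rewrite /chain_length -addnS big_split_ord /=.
have -> : \sum_(i < n.+1) mdist (a' i) (b' i) = chain_length n a b.
  by apply: eq_bigr => i _; rewrite /a' /b' -ltnS ltn_ord.
have -> : \sum_(i < m.+1) mdist (a' (n.+1 + i)%N) (b' (n.+1 + i)%N) = chain_length m c d.
  by apply: eq_bigr => i _; rewrite /a' /b' leqNgt ltnS leq_addr /= addKn.
lra.
Qed.

(* The topology of X_Q is that of rho.  The instance is only a pseudoMetricType
   because collapse is defined for arbitrary families P and Q, for which rho need
   not separate points. *)
Definition rho_ball (y : collapse) (e : R) : set collapse := [set z | rho y z < e].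
Definition rho_entourage : set_system (collapse * collapse) := entourage_ rho_ball.
Definition rho_nbhs (y : collapse) : set_system collapse := nbhs_ rho_entourage y.

HB.instance Definition _ := hasNbhs.Build collapse rho_nbhs.

Lemma rho_nbhsE : rho_nbhs = nbhs_ rho_entourage.
Proof. by []. Qed.

Lemma rho_ball_center (y : collapse) (e : R) : 0 < e -> rho_ball y e y.
Proof. by move=> e0; rewrite /rho_ball /= rhoxx. Qed.

Lemma rho_ball_sym (y z : collapse) (e : R) : rho_ball y e z -> rho_ball z e y.
Proof. by rewrite /rho_ball /= rho_sym. Qed.

Lemma rho_ball_triangle (y z w : collapse) (e1 e2 : R) :
  rho_ball y e1 z -> rho_ball z e2 w -> rho_ball y (e1 + e2) w.
Proof.
by rewrite /rho_ball /= => ? ?; apply: le_lt_trans (rho_triangle y z w) _; exact: ltrD.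
Qed.

Lemma rho_entourageE : rho_entourage = entourage_ rho_ball.
Proof. by []. Qed.

HB.instance Definition _ := @Nbhs_isPseudoMetric.Build R collapse
  rho_entourage rho_nbhsE rho_ball rho_ball_center rho_ball_sym rho_ball_triangle
  rho_entourageE.

Lemma collapse_ballE (y : collapse) (e : R) : ball y e = [set z | rho y z < e].
Proof. by []. Qed.

Lemma continuous_Gamma : continuous Gamma.
Proof.
move=> x U /nbhs_ballP [e /= e0 eU]; apply/nbhs_ballP; exists e => //= y.
rewrite ballEmdist /= => xy; apply: eU; rewrite collapse_ballE /=.
exact: le_lt_trans (rho_Gamma_le x y) xy.
Qed.

HB.instance Definition _ := isContinuous.Build X collapse Gamma continuous_Gamma.

End collapse.

Section bonding_map.
Context (R : realType) (X : metricType R) (P Q' Q : set (set X)) (QQ' : Q `<=` Q').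

Lemma Gamma_coarsen (x y : X) : Gamma P Q' x = Gamma P Q' y -> Gamma P Q x = Gamma P Q y.
Proof.
rewrite !GammaP; elim=> [a b [A [PA QA] Aab]|a|a b _|a b c _ ab _ bc].
- apply: Relation_Operators.rst_step; exists A => //; split => // QA'.
  exact/QA/QQ'.
- exact: Relation_Operators.rst_refl.
- exact: Relation_Operators.rst_sym.
- exact: Relation_Operators.rst_trans ab bc.
Qed.

(* The dummy let makes Q `<=` Q' an argument, on which continuity depends. *)
Definition Gamma_bond (y : collapse P Q') : collapse P Q :=
  let _ := QQ' in Gamma P Q (repr y).

Lemma Gamma_bondE (x : X) : Gamma_bond (Gamma P Q' x) = Gamma P Q x.
Proof. by apply: Gamma_coarsen; rewrite Gamma_repr. Qed.

Lemma Gamma_bond_unique (f : collapse P Q' -> collapse P Q) :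
  f \o Gamma P Q' =1 Gamma P Q -> f = Gamma_bond.
Proof.
by move=> fE; apply/funext => y; rewrite -(Gamma_repr y) Gamma_bondE -fE.
Qed.

Lemma rho_Gamma_bond_le (y z : collapse P Q') :
  rho (Gamma_bond y) (Gamma_bond z) <= rho y z.
Proof.
apply: lb_le_inf; first by case: (has_inf_chain_lengths y z).
move=> _ [n [a [b [[<- <- ab] ->]]]]; rewrite !Gamma_bondE.
by apply: rho_le; split => // i ni; apply: Gamma_coarsen; exact: ab.
Qed.

Lemma continuous_Gamma_bond : continuous Gamma_bond.
Proof.
move=> y U /nbhs_ballP [e /= e0 eU]; apply/nbhs_ballP; exists e => //= z.
rewrite collapse_ballE /= => yz; apply: eU; rewrite collapse_ballE /=.
exact: le_lt_trans (rho_Gamma_bond_le y z) yz.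
Qed.

HB.instance Definition _ :=
  isContinuous.Build (collapse P Q') (collapse P Q) Gamma_bond continuous_Gamma_bond.

End bonding_map.

Section canonical_homomorphism.
Context (R : realType) (X : metricType R) (P : set (set X)) (x0 : X).

Definition Fin : Type := set_type [set F : set (set X) | finite_set F /\ F `<=` P].

Definition Fin_le (F F' : Fin) : Prop := set_val F `<=` set_val F'.

Definition pi1_collapse (F : Fin) : groupType :=
  pi1 R (Gamma P (set_val F) x0).

Definition pi1_bond (F F' : Fin) (FF' : Fin_le F F') :
    UMagmaMorphism.type (pi1_collapse F') (pi1_collapse F) :=
  pi1_map (@Gamma_bondE R X P _ _ FF' x0).

Definition pi1_limit := inverse_limit pi1_bond.
HB.instance Definition _ := Group.on pi1_limit.

Definition pi1_Gamma (F : Fin) : pi1 R x0 -> pi1_collapse F :=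
  pi1_map (erefl (Gamma P (set_val F) x0)).

Lemma pi1_Gamma_compatible (g : pi1 R x0) (F F' : Fin) (FF' : Fin_le F F') :
  pi1_bond FF' (pi1_Gamma F' g) = pi1_Gamma F g.
Proof. by apply: pi1_map_comp => x /=; exact: Gamma_bondE. Qed.

Definition Phi (g : pi1 R x0) : pi1_limit := InverseLimit (pi1_Gamma_compatible g).

Lemma Phi_monoid_morphism : monoid.monoid_morphism Phi.
Proof.
by split=> [|g h]; apply: inverse_limit_eq => F; [exact: gmulf1 | exact: gmulfM].
Qed.

HB.instance Definition _ :=
  isUMagmaMorphism.Build (pi1 R x0) pi1_limit Phi Phi_monoid_morphism.

End canonical_homomorphism.

Arguments Phi {R X} P x0 g.

(* Main.v *)
Require Import Defs.
From mathcomp Require Import all_boot all_order all_algebra.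
From mathcomp Require Import ring lra.
From mathcomp Require Import all_classical all_reals ereal topology normedtype.
From mathcomp Require Import homotopy trigo.

Set Implicit Arguments.
Unset Strict Implicit.
Unset Printing Implicit Defensive.

Import Order.TTheory GRing.Theory Num.Theory.
Import numFieldNormedType.Exports.

Local Open Scope classical_set_scope.
Local Open Scope ring_scope.

(** Let the loop [a] be null-homotopic in every [X_F].  Call a pair of times good when, in
    every [X_F], the part of [a] between them is homotopic to arbitrarily small paths; its
    values at these times are then equal.  The pair (0, 1) is good, and there is a maximal
    set of pairwise non-crossing good pairs, the chords; it is closed.  The core of a chord
    consists of the times that are not strictly inside a smaller chord, so that the gaps of
    the core are chords too.

    The image of the core of a chord is a point or lies in one piece.  Otherwise a point [x]
    outside Pc(X) separates two of its points.  Up to homotopically small jumps over gaps,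
    the core times on the two sides of these points form a null-homotopic loop in [X_F].  In
    a filling of that loop, the zero set of a signed distance to [x] connects the two sides,
    so there are core times on the two sides, with values near [x], that are joined by a
    homotopically small path.  In the limit over F they form a good pair, hence a chord,
    which the core forbids.

    Every piece A is a 1-Lipschitz retract of X, by a map that is constant on the other
    pieces and thus factors through [X_{A}].  Therefore the retraction in A of the part of
    [a] under a chord is homotopic in A to arbitrarily small loops, and it is null-homotopic
    since small null-homotopic loops of A have small fillings.  Killing the gaps of the core
    in the same way, the loop that runs through the core of a chord and rests on its gaps is
    null-homotopic in A, and has a filling that is small if the loop is.  The filling for
    the chord c is defined on the pairs (u, v) of times, and used where c is the smallest
    chord around (u, v).  These pieces fit together in a continuous map on the triangle
    u <= v that is a(t) at (t, t) and is constant on the two other sides. *)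

(** * Homotopies of paths parametrised by the real line *)

(** The null-homotopies in the various [X_F] are unrelated, so no limit of them can be taken. What
    survives is a relation between times. It asks for arbitrarily small paths instead of constant
    ones because this makes it closed under limits of times, and because the conditions for finitely
    many [F] and sizes follow from a single one, so that compactness gives one pair of times for all
    [F]. Good pairs may cross; in a non-crossing family the chords around two given times are
    nested, and there is a smallest one. Infinitely many fillings have to be pasted, and continuity
    demands that all but finitely many of them be small: this is what the uniformity in
    [uniformly_1_UV0] provides. The path-diameter metric makes nearby points the ends of a small
    path, so that the functions built from separation properties, the signed distance to a cut point
    and the retractions, are Lipschitz; Lipschitz bounds are what passes to the chain metric [rho]
    of [X_F]. *)

Section real_continuity.
Context (R : realType) (Y : topologicalType).
Implicit Types f g : Y -> R.

Lemma contD f g : continuous f -> continuous g -> continuous (fun z => f z + g z).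
Proof. by move=> cf cg z; apply: cvgD; [exact: cf|exact: cg]. Qed.

Lemma contN f : continuous f -> continuous (fun z => - f z).
Proof. by move=> cf z; apply: cvgN; exact: cf. Qed.

Lemma contM f g : continuous f -> continuous g -> continuous (fun z => f z * g z).
Proof. by move=> cf cg z; apply: cvgM; [exact: cf|exact: cg]. Qed.

Lemma cont_cst (Z : topologicalType) (c : Z) : continuous (fun _ : Y => c).
Proof. by move=> z; exact: cvg_cst. Qed.

Lemma contmin f g : continuous f -> continuous g -> continuous (fun z => Num.min (f z) (g z)).
Proof. by move=> cf cg z; apply: (@continuous_min R Y f g); [exact: cf|exact: cg]. Qed.

Lemma contmax f g : continuous f -> continuous g -> continuous (fun z => Num.max (f z) (g z)).
Proof. by move=> cf cg z; apply: (@continuous_max R Y f g); [exact: cf|exact: cg]. Qed.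

Lemma cont_clamp f : continuous f -> continuous (fun z => clamp_real (f z)).
Proof.
by move=> cf; rewrite /clamp_real; apply: contmin; [exact: cont_cst|apply: contmax => //;
  exact: cont_cst].
Qed.

Lemma contabs f : continuous f -> continuous (fun z => `|f z|).
Proof. by move=> cf z; apply: cvg_norm; exact: cf. Qed.

Lemma cont_comp (Z W : topologicalType) (h : Z -> W) (k : Y -> Z) :
  continuous h -> continuous k -> continuous (fun z => h (k z)).
Proof. exact: continuous_comp_fun. Qed.

End real_continuity.

Lemma cont_id (Y : topologicalType) : continuous (fun z : Y => z).
Proof. by move=> z; exact: cvg_id. Qed.

Lemma cont_fst (Y A B : topologicalType) (f : Y -> A * B) :
  continuous f -> continuous (fun z => (f z).1).
Proof. by move=> cf; apply: cont_comp cf; exact: continuous_prod_fst. Qed.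

Lemma cont_snd (Y A B : topologicalType) (f : Y -> A * B) :
  continuous f -> continuous (fun z => (f z).2).
Proof. by move=> cf; apply: cont_comp cf; exact: continuous_prod_snd. Qed.

(** Goes by the outermost operation of the function. Continuity of any other function is looked up
    among the hypotheses, which is why proofs first put facts such as [continuous_cos] into the
    context. *)
Ltac cts := cbv beta; repeat
  match goal with
  | |- forall x, continuous_at x (fun _ => ?c) => exact: cont_cst
  | |- forall x, continuous_at x (fun z => z) => exact: cont_id
  | |- forall x, continuous_at x (@fst _ _) => exact: continuous_prod_fst
  | |- forall x, continuous_at x (@snd _ _) => exact: continuous_prod_snd
  | H : continuous ?f |- forall x, continuous_at x ?f => exact: H
  | |- forall x, continuous_at x (fun z => @Algebra.add _ (@?a z) (@?b z)) =>
      apply: (@contD _ _ a b)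
  | |- forall x, continuous_at x (fun z => @Algebra.opp _ (@?a z)) => apply: (@contN _ _ a)
  | |- forall x, continuous_at x (fun z => @GRing.mul _ (@?a z) (@?b z)) =>
      apply: (@contM _ _ a b)
  | |- forall x, continuous_at x (fun z => @Order.min _ _ (@?a z) (@?b z)) =>
      apply: (@contmin _ _ a b)
  | |- forall x, continuous_at x (fun z => @Order.max _ _ (@?a z) (@?b z)) =>
      apply: (@contmax _ _ a b)
  | |- forall x, continuous_at x (fun z => @clamp_real _ (@?a z)) =>
      apply: (@cont_clamp _ _ a)
  | |- forall x, continuous_at x (fun z => @Num.norm _ _ (@?a z)) =>
      apply: (@contabs _ _ a)
  | |- forall x, continuous_at x (fun z => (@?a z, @?b z)) =>
      apply: (@continuous_prod_pair _ _ _ a b)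
  | |- forall x, continuous_at x (fun z => (@?a z).1) => apply: (@cont_fst _ _ _ a)
  | |- forall x, continuous_at x (fun z => (@?a z).2) => apply: (@cont_snd _ _ _ a)
  | H : continuous ?f |- forall x, continuous_at x (fun z => ?f (@?a z)) =>
      apply: (@cont_comp _ _ _ f a H)
  end.

Section clamp_real.
Context (R : realType).
Implicit Types s t : R.

Lemma clampr_itv t : 0 <= clamp_real t <= 1.
Proof. by have := clamp_realP t; rewrite inE /= in_itv. Qed.

Lemma clampr_ge0 t : 0 <= clamp_real t. Proof. by have /andP[] := clampr_itv t. Qed.

Lemma clampr_id t : 0 <= t <= 1 -> clamp_real t = t.
Proof. by move=> /andP[t0 t1]; rewrite /clamp_real (max_idPr t0) (min_idPr t1). Qed.

Lemma clampr_le0 t : t <= 0 -> clamp_real t = 0.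
Proof. by move=> t0; rewrite /clamp_real (max_idPl t0) (min_idPr _). Qed.

Lemma clampr_ge1 t : 1 <= t -> clamp_real t = 1.
Proof.
by move=> t1; rewrite /clamp_real (max_idPr _) ?(min_idPl t1)// (le_trans _ t1).
Qed.

Lemma clampr0 : clamp_real (0 : R) = 0. Proof. exact: clampr_le0. Qed.
Lemma clampr1 : clamp_real (1 : R) = 1. Proof. exact: clampr_ge1. Qed.
End clamp_real.

Section htp.
Context (R : realType) (Y : topologicalType).
Implicit Types (p q r f : R -> Y) (A : set Y).

(* Homotopy relative to the end points, inside [A], of the restrictions to [0, 1]
   of two functions on the line. *)
Definition htp A p q := exists H : R * R -> Y, [/\ continuous H,
  forall s t, A (H (s, t)),
  forall t, 0 <= t <= 1 -> H (0, t) = p t,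
  forall t, 0 <= t <= 1 -> H (1, t) = q t &
  forall s, 0 <= s <= 1 -> H (s, 0) = p 0 /\ H (s, 1) = p 1].

Lemma htp_ends A p q : htp A p q -> q 0 = p 0 /\ q 1 = p 1.
Proof.
move=> [H [_ _ _ H1 Hs]]; rewrite -!H1 ?lexx ?ler01//.
by apply: Hs; rewrite lexx ler01.
Qed.

Lemma htp_eq A p q p' q' : htp A p q ->
  (forall t, 0 <= t <= 1 -> p t = p' t) -> (forall t, 0 <= t <= 1 -> q t = q' t) ->
  htp A p' q'.
Proof.
move=> [H [cH AH H0 H1 Hs]] pp' qq'; exists H; split => //.
- by move=> t t01; rewrite H0// pp'.
- by move=> t t01; rewrite H1// qq'.
- by move=> s s01; rewrite -!pp' ?lexx ?ler01//; exact: Hs.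
Qed.

Lemma htp_sym A p q : htp A p q -> htp A q p.
Proof.
move=> h; have [q0 q1] := htp_ends h; move: h => [H [cH AH H0 H1 Hs]].
exists (fun z => H (1 - z.1, z.2)); split => /=.
- by cts.
- by move=> s t; exact: AH.
- by move=> t t01; rewrite subr0 H1.
- by move=> t t01; rewrite subrr H0.
- by move=> s s01; rewrite q0 q1; apply: Hs; lra.
Qed.

Lemma htp_trans A p q r : htp A p q -> htp A q r -> htp A p r.
Proof.
move=> h; have [q0 q1] := htp_ends h; move: h => [H [cH AH H0 H1 Hs]].
move=> [K [cK AK K0 K1 Ks]].
exists (fun z => if z.1 <= 2^-1 then H (clamp_real (2 * z.1), clamp_real z.2)
                 else K (clamp_real (2 * z.1 - 1), clamp_real z.2)); split => /=.
- apply: continuous_if_le; [by cts| | |].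
  + by cts.
  + by cts.
  + move=> z ->; rewrite divff// clampr1 subrr clampr0.
    by rewrite H1 ?K0 ?clampr_itv.
- by move=> s t; case: ifP.
- by move=> t t01; rewrite ifT ?mulr0 ?clampr0 ?H0 ?clampr_itv ?clampr_id//; lra.
- move=> t t01; rewrite ifF; last by apply/negbTE; rewrite -ltNge; lra.
  by rewrite mulr1 addrK clampr1 K1 ?clampr_itv// clampr_id.
- move=> s s01; rewrite clampr0 clampr1; case: ifP => _.
    exact: Hs (clampr_itv _).
  by rewrite -q0 -q1; exact: Ks (clampr_itv _).
Qed.

Lemma htp_sub A B p q : A `<=` B -> htp A p q -> htp B p q.
Proof. by move=> AB [H [cH AH H0 H1 Hs]]; exists H; split => // s t; exact: AB. Qed.

(** Straight-line homotopy between the two parameter functions, both of which may leave [0, 1]. *)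
Lemma htp_reparam A f (k l : R -> R) : continuous f -> continuous k -> continuous l ->
  (forall s t, 0 <= s <= 1 -> 0 <= t <= 1 -> A (f ((1 - s) * k t + s * l t))) ->
  k 0 = l 0 -> k 1 = l 1 -> htp A (f \o k) (f \o l).
Proof.
move=> cf ck cl Af kl0 kl1.
exists (fun z => f ((1 - clamp_real z.1) * k (clamp_real z.2)
                    + clamp_real z.1 * l (clamp_real z.2))); split => /=.
- by cts.
- by move=> s t; apply: Af; exact: clampr_itv.
- by move=> t t01; rewrite !clampr0 subr0 mul1r mul0r addr0 clampr_id.
- by move=> t t01; rewrite !clampr1 subrr mul1r mul0r add0r clampr_id.
- move=> s s01; rewrite !clampr0 !clampr1 kl0 kl1.
  by split; congr f; rewrite -mulrDl subrK mul1r.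
Qed.

Lemma htp_refl A p : continuous p -> (forall t, 0 <= t <= 1 -> A (p t)) -> htp A p p.
Proof.
move=> cp Ap; apply: (@htp_reparam A p id id) => //; try exact: cont_id.
by move=> s t s01 t01; rewrite -mulrDl subrK mul1r; exact: Ap.
Qed.

Definition pc p q (t : R) := if t <= 2^-1 then p (2 * t) else q (2 * t - 1).

Lemma continuous_pc p q : continuous p -> continuous q -> p 1 = q 0 -> continuous (pc p q).
Proof.
move=> cp cq pq; apply: continuous_if_le; try by cts.
by move=> t ->; rewrite divff// subrr.
Qed.

Lemma pc0 p q : pc p q 0 = p 0.
Proof. by rewrite /pc ifT ?mulr0//; lra. Qed.

Lemma pc1 p q : pc p q 1 = q 1.
Proof. by rewrite /pc ifF ?mulr1 ?addrK//; apply/negbTE; rewrite -ltNge; lra. Qed.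

Lemma htp_pc A p p' q q' : htp A p p' -> htp A q q' -> p 1 = q 0 ->
  htp A (pc p q) (pc p' q').
Proof.
move=> [H [cH AH H0 H1 Hs]] [K [cK AK K0 K1 Ks]] pq.
exists (fun z => if z.2 <= 2^-1 then H (clamp_real z.1, clamp_real (2 * z.2))
                 else K (clamp_real z.1, clamp_real (2 * z.2 - 1))); split => /=.
- apply: continuous_if_le; [by cts| | |].
  + by cts.
  + by cts.
  + move=> z ->; rewrite divff// clampr1 subrr clampr0.
    have := Hs _ (clampr_itv z.1); have := Ks _ (clampr_itv z.1).
    by move=> [-> _] [_ ->].
- by move=> s t; case: ifP.
- move=> t t01; rewrite /pc clampr0; case: ifPn => th.
    by rewrite clampr_id ?H0//; lra.
  by rewrite -ltNge in th; rewrite clampr_id ?K0//; lra.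
- move=> t t01; rewrite /pc clampr1; case: ifPn => th.
    by rewrite clampr_id ?H1//; lra.
  by rewrite -ltNge in th; rewrite clampr_id ?K1//; lra.
- move=> s s01; rewrite pc0 pc1 mulr0 clampr0 ifT; last lra.
  rewrite ifF; last by apply/negbTE; rewrite -ltNge; lra.
  rewrite mulr1 addrK clampr1.
  by split; [exact: (Hs _ (clampr_itv s)).1|exact: (Ks _ (clampr_itv s)).2].
Qed.

Lemma htp_rev A p q : htp A p q -> htp A (fun t => p (1 - t)) (fun t => q (1 - t)).
Proof.
move=> [H [cH AH H0 H1 Hs]]; exists (fun z => H (z.1, 1 - z.2)); split => /=.
- by cts.
- by move=> s t; exact: AH.
- by move=> t t01; rewrite H0//; lra.
- by move=> t t01; rewrite H1//; lra.
- by move=> s s01; rewrite subr0 subrr; have [-> ->] := Hs _ s01.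
Qed.

(** The part of [f] from [s] to [t], run backwards if [t < s], so that no order of the times has to
    be assumed. *)
Definition sub f (s t tau : R) := f (s + tau * (t - s)).

Lemma continuous_sub f s t : continuous f -> continuous (sub f s t).
Proof. by move=> cf; rewrite /sub; cts. Qed.

Lemma sub0 f s t : sub f s t 0 = f s.
Proof. by rewrite /sub mul0r addr0. Qed.

Lemma sub1 f s t : sub f s t 1 = f t.
Proof. by rewrite /sub mul1r addrC subrK. Qed.

Lemma sub_rev f s t tau : sub f s t (1 - tau) = sub f t s tau.
Proof. by rewrite /sub; congr f; lra. Qed.

Lemma htp_sub_pc A f s t u : continuous f -> (forall x, A (f x)) ->
  htp A (sub f s u) (pc (sub f s t) (sub f t u)).
Proof.
move=> cf Af.
apply: (@htp_eq A (f \o fun x => s + x * (u - s))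
  (f \o (fun x => if x <= 2^-1 then s + 2 * x * (t - s) else t + (2 * x - 1) * (u - t)))) => //.
  apply: htp_reparam => //=.
  - by cts.
  - apply: continuous_if_le; [by cts|by cts|by cts|].
    by move=> x ->; rewrite divff//; lra.
  - by rewrite ifT; lra.
  - by rewrite ifF; [lra|apply/negbTE; rewrite -ltNge; lra].
by move=> x _; rewrite /pc /sub /=; case: ifP.
Qed.

Lemma htp_add A f s t u p q : continuous f -> (forall x, A (f x)) ->
  htp A (sub f s t) p -> htp A (sub f t u) q -> htp A (sub f s u) (pc p q).
Proof.
move=> cf Af hp hq; apply: htp_trans (htp_sub_pc s t u cf Af) _.
by apply: htp_pc => //; rewrite sub0 sub1.
Qed.

End htp.

Lemma htp_map (R : realType) (Y Z : topologicalType) (g : Y -> Z) (A : set Y) (B : set Z)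
    (p q : R -> Y) : continuous g -> (forall y, A y -> B (g y)) ->
  htp A p q -> htp B (g \o p) (g \o q).
Proof.
move=> cg AB [H [cH AH H0 H1 Hs]]; exists (g \o H); split => /=.
- exact: cont_comp.
- by move=> s t; exact/AB/AH.
- by move=> t t01; rewrite H0.
- by move=> t t01; rewrite H1.
- by move=> s s01; have [-> ->] := Hs _ s01.
Qed.

(** * Crossings in the square *)

Lemma compact_unif_cont (R : realType) (Z V : pseudoMetricType R) (K : set Z) (g : Z -> V) (e : R) :
  compact K -> continuous g -> 0 < e ->
  exists2 d : R, 0 < d & forall z w, K z -> ball z d w -> ball (g z) e (g w).
Proof.
move=> /compact_near_coveringP cK cg e0.
have e2 : 0 < e / 2 by lra.
pose P (d : R) (z : Z) := forall w, ball z d w -> ball (g z) e (g w).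
have : \forall d \near (0 : R)^'+, K `<=` P d.
  apply: cK => z _.
  have /nbhs_ballP [r /= r0 rP] := cg z _ (nbhsx_ballx (g z) (e / 2) e2).
  exists (ball z (r / 2), [set d | d < r / 2]) => /=.
    split; first by apply: nbhsx_ballx; lra.
    by apply: nbhs_right_lt; lra.
  move=> [y d] /= [zy dr] w yw.
  have gy : ball (g z) (e / 2) (g y).
    by apply: rP; apply: le_ball zy; lra.
  have gw : ball (g z) (e / 2) (g w).
    apply: rP; rewrite (splitr r); apply: (ball_triangle zy).
    by apply: le_ball yw; exact: ltW.
  by rewrite (splitr e); apply: ball_triangle gw; exact: ball_sym.
move=> nP; have nP2 : \forall d \near (0 : R)^'+, (K `<=` P d) /\ 0 < d.
  by apply: filterI; [exact: nP|exact: nbhs_right_gt].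
near (0 : R)^'+ => d.
have [KP d0] : K `<=` P d /\ 0 < d by near: d.
by exists d => // z w Kz; exact: KP.
Unshelve. all: by end_near. Qed.

Section metric_continuity.
Context (R : realType).

Lemma unif_cont01 (V : pseudoMetricType R) (f : R -> V) (e : R) : continuous f -> 0 < e ->
  exists2 d : R, 0 < d & forall s t, 0 <= s <= 1 -> `|s - t| < d -> ball (f s) e (f t).
Proof.
move=> cf e0.
have [d d0 dP] := compact_unif_cont (@segment_compact R 0 1) cf e0.
by exists d => // s t s01 st; apply: dP => //=; rewrite in_itv.
Qed.

Lemma unif_cont_square (V : pseudoMetricType R) (f : R * R -> V) (e : R) : continuous f -> 0 < e ->
  exists2 d : R, 0 < d & forall z w : R * R, 0 <= z.1 <= 1 -> 0 <= z.2 <= 1 ->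
    `|z.1 - w.1| < d -> `|z.2 - w.2| < d -> ball (f z) e (f w).
Proof.
move=> cf e0.
have [d d0 dP] := compact_unif_cont (compact_setX (@segment_compact R 0 1)
  (@segment_compact R 0 1)) cf e0.
by exists d => // z w z1 z2 zw1 zw2; apply: dP => //=; split; rewrite /= in_itv.
Qed.

Lemma ballR (x y e : R) : ball x e y = (`|x - y| < e).
Proof. by []. Qed.

Lemma contP (V : pseudoMetricType R) (f : R -> V) : continuous f <->
  forall t e, 0 < e -> exists2 d : R, 0 < d & forall s, `|t - s| < d -> ball (f t) e (f s).
Proof.
split=> [cf t e e0|h t].
  have /nbhs_ballP [r /= r0 rP] := cf t _ (nbhsx_ballx (f t) e e0).
  by exists r => // s ts; exact: rP.
apply/cvg_ballP => e e0; have [d d0 dP] := h t e e0.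
by apply/nbhs_ballP; exists d => //= s ts; exact: dP.
Qed.

Lemma cont2P (V : pseudoMetricType R) (f : R * R -> V) : continuous f <->
  forall (z : R * R) e, 0 < e -> exists2 d : R, 0 < d & forall w : R * R,
    `|z.1 - w.1| < d -> `|z.2 - w.2| < d -> ball (f z) e (f w).
Proof.
split=> [cf t e e0|h t].
  have /nbhs_ballP [r /= r0 rP] := cf t _ (nbhsx_ballx (f t) e e0).
  by exists r => // s ts1 ts2; apply: rP; split.
apply/cvg_ballP => e e0; have [d d0 dP] := h t e e0.
by apply: filterS (nbhsx_ballx t d d0) => s [ts1 ts2]; exact: dP.
Qed.

End metric_continuity.

Section planar.
Context (R : realType) (g : R * R -> R) (cg : continuous g).

Definition in_square (z : R * R) := (0 <= z.1 <= 1) && (0 <= z.2 <= 1).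

Definition joined (d : R) (z w : R * R) := exists l : R -> R * R, [/\ continuous l,
  l 0 = z, l 1 = w & forall r, 0 <= r <= 1 -> in_square (l r) /\ `|g (l r)| < d].

Lemma joined_refl d z : in_square z -> `|g z| < d -> joined d z z.
Proof. by move=> sz gz; exists (fun=> z); split => //; exact: cont_cst. Qed.

Lemma joined_trans d z w v : joined d z w -> joined d w v -> joined d z v.
Proof.
move=> [l [cl l0 l1 lP]] [m [cm m0 m1 mP]]; exists (pc l m); split.
- by apply: continuous_pc => //; rewrite l1 m0.
- by rewrite pc0.
- by rewrite pc1.
- move=> r r01; rewrite /pc; case: ifPn => rh; first by apply: lP; lra.
  by apply: mP; rewrite -ltNge in rh; lra.
Qed.

Lemma in_square_conv z w r : in_square z -> in_square w -> 0 <= r <= 1 ->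
  in_square (z.1 + r * (w.1 - z.1), z.2 + r * (w.2 - z.2)).
Proof.
rewrite /in_square /= => /andP[/andP[a1 a2] /andP[a3 a4]] /andP[/andP[b1 b2] /andP[b3 b4]].
by move=> /andP[r0 r1]; apply/andP; split; apply/andP; split; nra.
Qed.

Lemma joined_segment d z w : in_square z -> in_square w ->
  (forall r, 0 <= r <= 1 -> `|g (z.1 + r * (w.1 - z.1), z.2 + r * (w.2 - z.2))| < d) ->
  joined d z w.
Proof.
move=> sz sw h; exists (fun r => (z.1 + r * (w.1 - z.1), z.2 + r * (w.2 - z.2))); split.
- by cts.
- by rewrite !mul0r !addr0; case: (z).
- by rewrite !mul1r; case: (w) => a b /=; congr (_, _); lra.
- by move=> r r01; split; [exact: in_square_conv|exact: h].
Qed.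

(* The sums of [o] over the four sides of every small cell vanish, hence so does the
   sum over the boundary of the square. *)
Lemma discrete_stokes (N : nat) (h v : nat -> nat -> R) :
  (forall i j, (i < N)%N -> (j < N)%N -> h i j + v i.+1 j - h i j.+1 - v i j = 0) ->
  \sum_(j < N) v 0%N j = \sum_(i < N) h i 0%N + \sum_(j < N) v N j - \sum_(i < N) h i N.
Proof.
move=> cell.
have col i : (i < N)%N -> \sum_(j < N) v i j - \sum_(j < N) v i.+1 j = h i 0%N - h i N.
  move=> iN; rewrite -sumrB.
  have -> : \sum_(j < N) (v i j - v i.+1 j) = \sum_(j < N) (h i j - h i j.+1).
    by apply: eq_bigr => j _; have := cell i j iN (ltn_ord j); lra.
  rewrite -(big_mkord xpredT (fun j => h i j - h i j.+1)).
  under eq_bigr => j _ do rewrite -opprB.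
  by rewrite sumrN telescope_sumr// opprB.
have : \sum_(i < N) (\sum_(j < N) v i j - \sum_(j < N) v i.+1 j)
     = \sum_(i < N) (h i 0%N - h i N) by apply: eq_bigr => i _; exact: col.
rewrite -(big_mkord xpredT (fun i => \sum_(j < N) v i j - \sum_(j < N) v i.+1 j)).
under eq_bigr => j _ do rewrite -opprB.
by rewrite sumrN telescope_sumr// sumrB; lra.
Qed.

Definition cutoff (d x : R) := Num.max (- (d / 2)) (Num.min (d / 2) x).

Lemma cutoff_ge d x : d / 2 <= x -> 0 < d -> cutoff d x = d / 2.
Proof. by move=> dx d0; rewrite /cutoff (min_idPl dx) (max_idPr _)//; lra. Qed.

Lemma cutoff_le d x : x <= - (d / 2) -> 0 < d -> cutoff d x = - (d / 2).
Proof.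
by move=> dx d0; rewrite /cutoff (min_idPr _) ?(max_idPl _)//; lra.
Qed.

(** As 3/4 = 1/2 + 1/4, both [x] and [y] lie beyond [d / 2] on the same side of 0, where the
    truncation is constant. *)
Lemma cutoff_far d x y : 0 < d -> `|x - y| < d / 4 -> 3 / 4 * d <= `|x| ->
  cutoff d x = cutoff d y.
Proof.
move=> d0; rewrite ltr_norml => /andP[xy1 xy2].
case: (ger0P x) => x0 hx; [rewrite !cutoff_ge//|rewrite !cutoff_le//]; lra.
Qed.

(** A combinatorial winding argument. Let [W] be the set reached from the left side below [tau]
    within [|g| < d], and [o] the increment of the truncated [g] along grid edges that start in [W].
    One can leave [W] only where the truncation is constant, so [o] sums to zero around every cell.
    On the boundary, the three sides with [g >= d] contribute nothing, nor does the left side above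
    [tau] if it misses [W], but the part below [tau] contributes [- d]. *)
Lemma plane_crossing (tau d : R) : 0 < d -> 0 <= tau <= 1 -> g (0, tau) <= - d ->
  (forall s, 0 <= s <= 1 -> d <= g (s, 0) /\ d <= g (s, 1)) ->
  (forall t, 0 <= t <= 1 -> d <= g (1, t)) ->
  exists s1 s2, [/\ 0 <= s1 <= tau, tau <= s2 <= 1 & joined d (0, s1) (0, s2)].
Proof.
move=> d0 /andP[tau0 tau1] gtau ghor gver; apply: contrapT => noc.
pose W z := exists2 s, 0 <= s <= tau & joined d (0, s) z.
have d4 : 0 < d / 4 by lra.
have [eta eta0 etaP] := unif_cont_square cg d4.
pose c z := cutoff d (g z).
have far z w : in_square z -> in_square w -> `|z.1 - w.1| < eta -> `|z.2 - w.2| < eta ->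
    3 / 4 * d <= `|g z| -> c z = c w.
  move=> /andP[sz1 sz2] sw zw1 zw2 gz; apply: cutoff_far gz => //.
  exact: etaP.
have leaveW z w : in_square z -> in_square w -> `|z.1 - w.1| < eta -> `|z.2 - w.2| < eta ->
    W z -> ~ W w -> c z = c w.
  (* If [|g z| < 3/4 d], the segment to the nearby [w] stays in [|g| < d], and [w] would be in
     [W]. *)
  move=> sz sw zw1 zw2 [s st Wz] nW; apply: far => //; rewrite leNgt; apply/negP => gz.
  apply: nW; exists s => //; apply: joined_trans Wz _; apply: joined_segment => // r r01.
  have /andP[sz1 sz2] := sz.
  have close (a b : R) : `|a - b| < eta -> `|a - (a + r * (b - a))| < eta.
    rewrite !ltr_norml => /andP[ab1 ab2]; apply/andP; split; nra.
  have := etaP z (z.1 + r * (w.1 - z.1), z.2 + r * (w.2 - z.2)) sz1 sz2 (close _ _ zw1)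
    (close _ _ zw2).
  rewrite ballR !ltr_norml => /andP[h1 h2]; move: gz; rewrite ltr_norml => /andP[h3 h4].
  by apply/andP; split; lra.
pose o z w := if `[< W z >] then c w - c z else 0.
have cell z1 z2 z3 z4 : in_square z1 -> in_square z2 -> in_square z3 -> in_square z4 ->
   (forall z w, z \in [:: z1; z2; z3; z4] -> w \in [:: z1; z2; z3; z4] ->
      `|z.1 - w.1| < eta /\ `|z.2 - w.2| < eta) ->
   o z1 z2 + o z2 z3 - o z4 z3 - o z1 z4 = 0.
  move=> s1 s2 s3 s4 close.
  have lv z w : z \in [:: z1; z2; z3; z4] -> w \in [:: z1; z2; z3; z4] -> W z -> ~ W w -> c z = c w.
    move=> zin win; have [zw1 zw2] := close z w zin win.
    move: zin win; rewrite !inE => zin win; apply: leaveW => //.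
      by case/or4P: zin => /eqP ->.
    by case/or4P: win => /eqP ->.
  have i1 : z1 \in [:: z1; z2; z3; z4] by rewrite !inE eqxx.
  have i2 : z2 \in [:: z1; z2; z3; z4] by rewrite !inE eqxx ?orbT.
  have i3 : z3 \in [:: z1; z2; z3; z4] by rewrite !inE eqxx ?orbT.
  have i4 : z4 \in [:: z1; z2; z3; z4] by rewrite !inE eqxx ?orbT.
  rewrite /o; case: asboolP => W1; case: asboolP => W2; case: asboolP => W4; try lra.
  - have [W3|W3] := pselect (W z3); first by have := lv _ _ i3 i4 W3 W4; have :=
      lv _ _ i1 i4 W1 W4; lra.
    by have := lv _ _ i1 i3 W1 W3; have := lv _ _ i1 i4 W1 W4;  lra.
  - have [W3|W3] := pselect (W z3); first by have := lv _ _ i3 i2 W3 W2; have :=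
      lv _ _ i1 i2 W1 W2; lra.
    by have := lv _ _ i1 i3 W1 W3; have := lv _ _ i1 i2 W1 W2;  lra.
  - by have := lv _ _ i1 i2 W1 W2; have := lv _ _ i1 i4 W1 W4; lra.
  - by have := lv _ _ i2 i1 W2 W1; have := lv _ _ i4 i1 W4 W1; lra.
  - have [W3|W3] := pselect (W z3); first by have := lv _ _ i3 i1 W3 W1; have :=
      lv _ _ i2 i1 W2 W1; lra.
    by have := lv _ _ i2 i3 W2 W3; have := lv _ _ i2 i1 W2 W1;  lra.
  - have [W3|W3] := pselect (W z3); first by have := lv _ _ i3 i1 W3 W1; have :=
      lv _ _ i4 i1 W4 W1; lra.
    by have := lv _ _ i4 i3 W4 W3; have := lv _ _ i4 i1 W4 W1;  lra.
pose N := (Num.truncn (eta^-1)).+1.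
have N0 : 0 < N%:R :> R by rewrite ltr0n.
have Neta : N%:R^-1 < eta.
  by rewrite -[eta]invrK ltf_pV2 ?posrE ?invr_gt0// Num.Theory.truncnS_gt.
pose M := (N + N)%N.
have M0 : 0 < M%:R :> R by rewrite ltr0n addn_gt0.
have Meta : M%:R^-1 < eta.
  apply: le_lt_trans Neta; rewrite lef_pV2 ?posrE// ler_nat; exact: leq_addr.
pose x (i : nat) : R := i%:R / M%:R.
(* [tau] must be a grid value, so each of [0, tau] and [tau, 1] is cut in [N] steps; [x] has [N + N]
   steps in order to have equally many. *)
pose y (j : nat) : R := if (j <= N)%N then tau * (j%:R / N%:R)
                        else tau + (1 - tau) * ((j - N)%N%:R / N%:R).
have frac (k n : nat) : (0 < n)%N -> (k <= n)%N -> 0 <= (k%:R / n%:R : R) <= 1.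
  move=> n0 kn; apply/andP; split; first by rewrite divr_ge0 ?ler0n.
  by rewrite ler_pdivrMr ?ltr0n// mul1r ler_nat.
have x01 i : (i <= M)%N -> 0 <= x i <= 1 by apply: frac.
have xS i : x i.+1 = x i + M%:R^-1 by rewrite /x -natr1 mulrDl mul1r.
have y01 j : (j <= M)%N -> 0 <= y j <= 1.
  move=> jM; rewrite /y; case: leqP => jN.
    by have /andP[] := @frac j N isT jN; nra.
  have jN' : (j - N <= N)%N by rewrite leq_subLR.
  by have /andP[] := @frac _ N isT jN'; nra.
have yS j : (j < M)%N -> 0 <= y j.+1 - y j <= N%:R^-1.
  move=> jM; have i0 : 0 < N%:R^-1 :> R by rewrite invr_gt0.
  rewrite /y; case: (ltngtP j N) => jN.
  - by rewrite -natr1 mulrDl mul1r; nra.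
  - by rewrite subSn ?(ltnW jN)// -natr1 mulrDl mul1r; nra.
  - by rewrite jN subSn// subnn divff ?gt_eqF// mul1r; nra.
pose pt i j : R * R := (x i, y j).
have spt i j : (i <= M)%N -> (j <= M)%N -> in_square (pt i j).
  by move=> iM jM; rewrite /in_square /= x01// y01.
have cells i j : (i < M)%N -> (j < M)%N -> o (pt i j) (pt i.+1 j) + o (pt i.+1 j) (pt i.+1 j.+1)
    - o (pt i j.+1) (pt i.+1 j.+1) - o (pt i j) (pt i j.+1) = 0.
  move=> iM jM.
  apply: cell; try by apply: spt => //; exact: ltnW.
  have xx : `|x i - x i.+1| < eta.
    by rewrite xS opprD addrA subrr add0r normrN ger0_norm// invr_ge0 ltW.
  have yy : `|y j - y j.+1| < eta.
    by have /andP[y1 y2] := yS _ jM; rewrite distrC ger0_norm//; exact: le_lt_trans Neta.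
  move=> z w; rewrite !inE => /or4P[] /eqP-> /or4P[] /eqP-> /=;
    by rewrite ?subrr ?normr0; split => //; rewrite distrC.
have cbig z : d <= g z -> c z = d / 2 by move=> gz; apply: cutoff_ge => //; lra.
have oc z w : d <= g z -> d <= g w -> o z w = 0.
  by move=> gz gw; rewrite /o !cbig// subrr if_same.
have := @discrete_stokes M (fun i j => o (pt i j) (pt i.+1 j)) (fun i j => o (pt i j)
  (pt i j.+1)) cells.
have x0 : x 0%N = 0 by rewrite /x mul0r.
have xM : x M = 1 by rewrite /x divff// gt_eqF.
have y0 : y 0%N = 0 by rewrite /y leq0n mul0r mulr0.
have yN : y N = tau by rewrite /y leqnn divff ?mulr1// gt_eqF.
have yM : y M = 1.
  rewrite /y leqNgt /M -{1}[N]addn0 ltn_add2l ltnS leq0n /= addnK divff ?gt_eqF//; lra.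
rewrite [X in _ = X + _ - _]big1; last first.
  move=> i _; apply: oc; rewrite /pt y0; apply: (ghor _ _).1; apply: x01 => //.
  exact: ltnW.
rewrite [X in _ = _ + X - _]big1; last first.
  move=> i _; apply: oc; rewrite /pt xM; apply: gver; apply: y01 => //.
  exact: ltnW.
rewrite [X in _ = _ + _ - X]big1; last first.
  move=> i _; apply: oc; rewrite /pt yM; apply: (ghor _ _).2; apply: x01 => //.
  exact: ltnW.
rewrite big_split_ord /= [X in _ + X = _]big1; last first.
  move=> j _; rewrite /o; case: asboolP => // -[s st]; rewrite /pt x0 => J.
  exfalso; apply: noc; exists s, (y (N + j)%N); split => //.
  have /andP[_ ->] : 0 <= y (N + j)%N <= 1.
    by apply: y01; rewrite leq_add2l ltnW.
  rewrite andbT /y; case: ifPn => jN.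
    have -> : (N + j = N)%N by apply/eqP; rewrite eqn_leq jN leq_addr.
    by rewrite divff ?mulr1// gt_eqF.
  by rewrite lerDl mulr_ge0 ?divr_ge0//; lra.
have -> : \sum_(j < N) o (pt 0%N j) (pt 0%N j.+1) = \sum_(0 <= j < N) (c (pt 0%N j.+1)
  - c (pt 0%N j)).
  rewrite big_mkord; apply: eq_bigr => j _; rewrite /o; case: asboolP => // nW.
  have jM : (j.+1 <= M)%N by rewrite (leq_trans (ltn_ord j))// leq_addr.
  have sj := spt 0%N j isT (ltnW jM).
  rewrite (@far (pt 0%N j) (pt 0%N j.+1)) ?subrr//.
  - exact: spt.
  - by rewrite normr0.
  - by have /andP[y1 y2] := yS _ jM; rewrite distrC ger0_norm//; exact: le_lt_trans Neta.
  (* A start point outside [W] has [|g| >= 3/4 d], as otherwise the constant path puts it in [W]. *)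
  - rewrite leNgt; apply/negP => gj; apply: nW; exists (y j); last first.
      by rewrite -x0; apply: joined_refl => //; lra.
    have jN : (j <= N)%N by rewrite ltnW.
    rewrite /y jN; have /andP[] := @frac j N isT jN; nra.
rewrite telescope_sumr// /c /pt x0 y0 yN cutoff_le//; last lra.
by rewrite cutoff_ge//; [lra|have [] := ghor 0; lra].
Qed.

End planar.

(** * Homotopically small paths *)

Section small_paths.
Context (R : realType) (Y : topologicalType) (dst : Y -> Y -> R).
Hypotheses (dst_sym : forall x y, dst x y = dst y x).
Hypotheses (dst_tri : forall x y z, dst x z <= dst x y + dst y z).
Implicit Types (f g : R -> Y) (s t u d : R).

Local Notation "p ~ q" := (htp setT p q) (at level 70).

Lemma htp_sub_add f g s t u s' t' u' : continuous f -> continuous g ->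
  sub f s t ~ sub g s' t' -> sub f t u ~ sub g t' u' -> sub f s u ~ sub g s' u'.
Proof.
move=> cf cg st tu; apply: htp_trans (htp_add _ _ st tu) _ => //.
by apply: htp_sym; exact: htp_sub_pc.
Qed.

Lemma htp_sub_rev f g s t s' t' : sub f s t ~ sub g s' t' -> sub f t s ~ sub g t' s'.
Proof.
by move=> /htp_rev h; apply: (htp_eq h) => x _; rewrite sub_rev.
Qed.

Lemma htp_sub_refl f s t : continuous f -> sub f s t ~ sub f s t.
Proof. by move=> cf; apply: htp_refl => //; exact: continuous_sub. Qed.

Lemma eq_sub f g s t e : (forall x, x <= e -> f x = g x) -> s <= e -> t <= e ->
  forall x, 0 <= x <= 1 -> sub f s t x = sub g s t x.
Proof. by move=> fg se te x /andP[x0 x1]; apply: fg; nra. Qed.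

(* [f] runs through a null-homotopic loop between the times [s] and [t]. *)
Definition zer f s t := sub f s t ~ sub f t t.

Lemma zer_end f s t : zer f s t -> f s = f t.
Proof. by move=> /htp_ends [+ _]; rewrite !sub0. Qed.

Lemma zer_refl f s : continuous f -> zer f s s.
Proof. exact: htp_sub_refl. Qed.

Lemma zer_sym f s t : zer f s t -> zer f t s.
Proof.
move=> st; have fE := zer_end st; have := htp_sub_rev st.
by move=> h; apply: (htp_eq h) => x _ //; rewrite /sub !subrr !mulr0 !addr0 fE.
Qed.

Lemma zer_trans f s t u : continuous f -> zer f s t -> zer f t u -> zer f s u.
Proof.
move=> cf st tu; apply: htp_trans tu.
apply: (htp_sub_add (t := t) (t' := t)) => //; exact: htp_sub_refl.
Qed.

Lemma zer_eq f g s t e : (forall x, x <= e -> f x = g x) -> s <= e -> t <= e ->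
  zer f s t -> zer g s t.
Proof. by move=> fg se te h; apply: (htp_eq h) => x x01; exact: (eq_sub fg). Qed.

(** To be used with [dst] the pseudometric [rho] of some [X_F] and [f] the projection of the
    loop. *)
Definition small f s t d := exists q, [/\ continuous q, sub f s t ~ q &
  forall x y, 0 <= x <= 1 -> 0 <= y <= 1 -> dst (q x) (q y) < d].

Lemma small_le f s t d e : d <= e -> small f s t d -> small f s t e.
Proof.
move=> de [q [cq hq qd]]; exists q; split => // x y x01 y01.
exact: lt_le_trans (qd _ _ x01 y01) de.
Qed.

Lemma small_eq f g s t d e : (forall x, x <= e -> f x = g x) -> s <= e -> t <= e ->
  small f s t d -> small g s t d.
Proof.
move=> fg se te [q [cq hq qd]]; exists q; split => //.
by apply: (htp_eq hq) => // x x01; exact: (eq_sub fg).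
Qed.

Lemma small_dst f s t d : small f s t d -> dst (f s) (f t) < d.
Proof.
move=> [q [_ /htp_ends]]; rewrite sub0 sub1 => -[<- <-].
by apply; rewrite lexx ler01.
Qed.

Lemma small_sym f s t d : small f s t d -> small f t s d.
Proof.
move=> [q [cq hq qd]]; exists (fun x => q (1 - x)); split.
- by cts.
- by apply: (htp_eq (htp_rev hq)) => x _ //; rewrite sub_rev.
- by move=> x y x01 y01; apply: qd; lra.
Qed.

Lemma small_tri f s t u d e : continuous f ->
  small f s t d -> small f t u e -> small f s u (d + e).
Proof.
move=> cf [p [cp hp pd]] [q [cq hq qe]].
have [p0 p1] := htp_ends hp; have [q0 q1] := htp_ends hq.
have pq : p 1 = q 0 by rewrite p1 q0 sub0 sub1.
have i0 : 0 <= (0 : R) <= 1 by rewrite lexx ler01.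
have i1 : 0 <= (1 : R) <= 1 by rewrite lexx ler01.
have d0 x : 0 <= dst x x by have := dst_tri x x x; lra.
have dp : 0 < d by apply: le_lt_trans (pd _ _ i0 i0).
have ep : 0 < e by apply: le_lt_trans (qe _ _ i0 i0).
exists (pc p q); split.
- exact: continuous_pc.
- by apply: (htp_add cf _ hp hq).
- move=> x y x01 y01; rewrite /pc; case: ifPn => xh; case: ifPn => yh;
    rewrite -?ltNge in xh yh.
  + apply: lt_trans (pd _ _ _ _) _; lra.
  + apply: le_lt_trans (dst_tri _ (p 1) _) _; rewrite {2}pq.
    by apply: ltrD; [apply: pd|apply: qe]; lra.
  + apply: le_lt_trans (dst_tri _ (p 1) _) _; rewrite {1}pq [_ + _]addrC.
    by apply: ltrD; [apply: pd|apply: qe]; lra.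
  + apply: lt_trans (qe _ _ _ _) _; lra.
Qed.

Lemma small_path f s t d : continuous f ->
  (forall x y, Num.min s t <= x <= Num.max s t -> Num.min s t <= y <= Num.max s t ->
     dst (f x) (f y) < d) -> small f s t d.
Proof.
move=> cf h; exists (sub f s t); split; [exact: continuous_sub|exact: htp_sub_refl|].
have btw x : 0 <= x <= 1 -> Num.min s t <= s + x * (t - s) <= Num.max s t.
  move=> /andP[x0 x1]; rewrite ge_min le_max.
  by case: (lerP s t) => st; apply/andP; split; apply/orP; [left|right|right|left]; nra.
by move=> x y x01 y01; apply: h; exact: btw.
Qed.

Lemma zer_small f s t d : continuous f -> dst (f t) (f t) < d -> zer f s t -> small f s t d.
Proof.
move=> cf d0 st; exists (sub f t t); split => //; first exact: continuous_sub.
by move=> x y _ _; rewrite /sub !subrr !mulr0 !addr0.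
Qed.

(** A walk is coded as an extension of [f] to later times: [zer f e s] says that at the present time
    [e] the walk has come, up to homotopy, to the position [s]. Appending [q] during [e, e + 1]
    moves it on to [t]. *)
Lemma append_path f e s t q : continuous f -> s <= e -> t <= e -> zer f e s ->
  continuous q -> sub f s t ~ q ->
  exists f', [/\ continuous f', forall x, x <= e -> f' x = f x, zer f' (e + 1) t &
    forall x, 0 <= x <= 1 -> f' (e + x) = q x].
Proof.
move=> cf se te es cq hq; have [q0 q1] := htp_ends hq.
pose f' x := if x <= e then f x else q (clamp_real (x - e)).
have cf' : continuous f'.
  apply: continuous_if_le; [by cts|by []|by cts|].
  by move=> x ->; rewrite subrr clampr0 q0 sub0 (zer_end es).
have ff' x : x <= e -> f x = f' x by rewrite /f' => ->.
have f'q x : 0 <= x <= 1 -> f' (e + x) = q x.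
  move=> x01; rewrite /f'; case: ifPn => xe.
    have -> : x = 0 by lra.
    by rewrite addr0 (zer_end es) q0 sub0.
  by rewrite addrC addKr clampr_id.
exists f'; split => //; first by move=> x xe; rewrite ff'.
have e1 : sub f' e (e + 1) ~ sub f' s t.
  apply: htp_sym; apply: (htp_eq hq) => x x01; first exact: (eq_sub ff').
  by rewrite -f'q// /sub; congr f'; lra.
have e2 : sub f' e t ~ sub f' s t.
  apply: (htp_sub_add (t := s) (t' := s)) => //; last exact: htp_sub_refl.
  exact: (zer_eq ff').
exact: htp_sub_add (htp_sub_rev e1) e2.
Qed.

Inductive chain (A : set R) (S : R -> R -> Prop) (s : R) : R -> Prop :=
| chain0 : A s -> chain A S s s
| chainS t u : chain A S s t -> S t u -> A u -> chain A S s u.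

Lemma chain_last A S s t : chain A S s t -> A t.
Proof. by case. Qed.

Lemma chain_cat A S s t u : chain A S s t -> chain A S t u -> chain A S s u.
Proof. by move=> st; elim => // v w _ sv; exact: chainS. Qed.

(** One unit of time is spent on each link. A moment [r] within a link is joined to the beginning of
    the link by a piece of the small path, and this beginning to a point of [A] by a null-homotopic
    one; hence [d + d]. *)
Lemma chain_walk (A : set R) a d s t f e0 : (forall x, A x -> x <= 1) ->
  (forall x : R, dst (a x) (a x) < d) ->
  chain A (fun x y => small a x y d) s t ->
  continuous f -> (forall x, x <= 1 -> f x = a x) -> 1 <= e0 -> zer f e0 s ->
  exists f' e, [/\ continuous f', forall x, x <= e0 -> f' x = f x, e0 <= e, zer f' e t &
     forall r, e0 <= r <= e -> exists2 t', A t' & small f' r t' (d + d)].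
Proof.
move=> A1 ad; move=> + cf fa e01 e0s; elim => [As|{}t u st IH tu Au].
  exists f, e0; split => // r rr; have -> : r = e0 by lra.
  exists s => //; apply: zer_small => //; rewrite fa ?A1//.
  have := ad s; have := dst_tri (a s) (a s) (a s); lra.
have [f1 [e [cf1 f1f e0e e1t f1P]]] := IH.
have At := chain_last st; have t1 := A1 _ At; have u1 := A1 _ Au.
have f1a x : x <= 1 -> f1 x = a x by move=> x1; rewrite f1f ?fa//; lra.
have [q [cq hq qd]] := tu.
have hq' : sub f1 t u ~ q.
  by apply: (htp_eq hq) => // x x01; apply/esym; exact: (eq_sub f1a).
have [||f2 [cf2 f2f1 f2u f2q]] := append_path cf1 _ _ e1t cq hq'; try lra.
exists f2, (e + 1); split => //.
- by move=> x xe; rewrite f2f1 ?f1f//; lra.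
- by lra.
- move=> r /andP[r0 r1]; case: (lerP r e) => re.
    have [|t' At' rt'] := f1P r; first by rewrite r0 re.
    have := A1 _ At' => t'1.
    exists t' => //; apply: (@small_eq f1 f2 _ _ _ e) rt' => //; last lra.
    by move=> x xe; rewrite f2f1.
  exists t => //; apply: (small_tri (t := e)) => //.
    apply: small_path => // x y; rewrite (min_idPr (ltW re)) (max_idPl (ltW re)) => xr yr.
    have -> : x = e + (x - e) by lra.
    have -> : y = e + (y - e) by lra.
    by rewrite !f2q; [apply: qd| |]; lra.
  apply: zer_small => //; first by rewrite f2f1 ?f1a//; lra.
  apply: (@zer_eq f1 f2 e t e) e1t; [by move=> x xe; rewrite f2f1|exact: lexx|lra].
Qed.

Lemma htp_plane (H : R * R -> Y) (k l : R -> R * R) : continuous H ->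
  continuous k -> continuous l -> k 0 = l 0 -> k 1 = l 1 -> (H \o k) ~ (H \o l).
Proof.
move=> cH ck cl kl0 kl1.
exists (fun z => H ((1 - z.1) * (k z.2).1 + z.1 * (l z.2).1,
                    (1 - z.1) * (k z.2).2 + z.1 * (l z.2).2)); split => //=.
- by cts.
- by move=> t _; rewrite subr0 !mul1r !mul0r !addr0 -surjective_pairing.
- by move=> t _; rewrite subrr !mul1r !mul0r !add0r -surjective_pairing.
- by move=> s _; rewrite kl0 kl1; split; rewrite -!mulrDl !subrK !mul1r -surjective_pairing.
Qed.

(** [plane_crossing] is applied to [phi] on a null-homotopy of the loop: one side of the square is
    [f], the other three are the base point. The path found in the square is homotopic to the part
    of the first side between its ends because the plane is convex. *)
Lemma loop_crossing f a k b (phi : Y -> R) d : continuous f -> continuous phi ->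
  a <= k <= b -> a < b -> zer f a b -> 0 < d -> d <= phi (f a) -> phi (f k) <= - d ->
  exists r1 r2 q, [/\ a <= r1 <= k, k <= r2 <= b, continuous q, sub f r1 r2 ~ q &
    forall x, 0 <= x <= 1 -> `|phi (q x)| < d].
Proof.
move=> cf cphi /andP[ak kb] ab zab d0 pa pk.
have fab := zer_end zab; move: zab => [H [cH _ H0 H1 Hs]].
have cg : continuous (fun z => phi (H z)) by cts.
have ba : 0 < b - a by lra.
pose tau := (k - a) / (b - a).
have tauE : a + tau * (b - a) = k by rewrite /tau divfK ?gt_eqF//; lra.
have tau01 : 0 <= tau <= 1.
  by rewrite /tau divr_ge0 ?ler_pdivrMr ?mul1r//=; lra.
have [|||s1 [s2 [s1t s2t [l [cl l0 l1 lP]]]]] := plane_crossing cg d0 tau01 (_ : _ <= _).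
- by rewrite H0// /sub tauE.
- by move=> s s01; have [-> ->] := Hs _ s01; rewrite sub0 sub1 -fab.
- by move=> t t01; rewrite H1// /sub subrr mulr0 addr0 -fab.
exists (a + s1 * (b - a)), (a + s2 * (b - a)), (H \o l); split.
- by rewrite -tauE; nra.
- by apply/andP; split; nra.
- by apply: cont_comp.
- apply: (@htp_eq _ _ _ (H \o (fun x => (0, s1 + x * (s2 - s1)))) (H \o l)) => //.
    apply: htp_plane => //; first by cts.
      by rewrite l0 mul0r addr0.
    by rewrite l1 mul1r addrC subrK.
  by move=> x x01; rewrite /= H0; [rewrite /sub; congr f; lra|nra].
- by move=> x x01; have [] := lP _ x01.
Qed.

(** Every link is homotopic to a part of [a], so the closed chain amounts to running to and fro over
    the line and is null-homotopic. Its crossing joins a moment of the first chain to one of the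
    second within [|phi| < d], and these moments have points of [A1] and [A2] near them. *)
Lemma chain_crossing (a : R -> Y) (A1 A2 : set R) s t (phi : Y -> R) d :
  continuous a -> continuous phi ->
  (forall y y', `|phi y - phi y'| <= 2 * dst y y') ->
  (forall y y', `|phi y| < d -> `|phi y'| < d -> dst y y' < d + d) ->
  (forall y, dst y y = 0) ->
  (forall x, A1 x -> x <= 1) -> (forall x, A2 x -> x <= 1) -> 0 < d ->
  chain A1 (fun x y => small a x y d) s t -> chain A2 (fun x y => small a x y d) t s ->
  d <= phi (a s) -> phi (a t) <= - d ->
  exists t1 t2, [/\ A1 t1, A2 t2, small a t1 t2 (6 * d),
    `|phi (a t1)| < 5 * d & `|phi (a t2)| < 5 * d].
Proof.
move=> ca cphi phiL phid dxx A11 A21 d0 st ts pas pat.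
have s1 : s <= 1 by apply: A21; exact: chain_last ts.
have t1 : t <= 1 by apply: A11; exact: chain_last st.
(* The walk extends [a] to the right of 1, so it begins by going from 1 back to [s] during [1, 2];
   the loop proper starts at time [1 + 1]. *)
have [f1 [cf1 f1a f1s _]] := append_path ca (lexx 1) s1 (zer_refl _ ca)
  (@continuous_sub _ _ a 1 s ca) (htp_sub_refl 1 s ca).
have add x : dst (a x) (a x) < d by rewrite dxx.
have e0 : 1 <= 1 + 1 :> R by lra.
have [f2 [e2 [cf2 f2f1 le2 f2t f2P]]] := chain_walk A11 add st cf1 f1a e0 f1s.
have f2a x : x <= 1 -> f2 x = a x by move=> x1; rewrite f2f1 ?f1a//; lra.
have [|f3 [e3 [cf3 f3f2 le3 f3s f3P]]] := chain_walk A21 add ts cf2 f2a _ f2t; first by lra.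
have f3a x : x <= 1 -> f3 x = a x by move=> x1; rewrite f3f2 ?f2a//; lra.
have f3s0 : zer f3 (1 + 1) s.
  apply: (@zer_eq f1 f3 _ _ (1 + 1)) f1s; [|exact: lexx|lra].
  by move=> x x2; rewrite f3f2 ?f2f1//; lra.
have zl : zer f3 (1 + 1) e3 by apply: zer_trans f3s0 (zer_sym f3s).
have ps : d <= phi (f3 (1 + 1)) by rewrite (zer_end f3s0) f3a.
have pt : phi (f3 e2) <= - d by rewrite f3f2// (zer_end f2t) f2a.
have lt12 : 1 + 1 < e2.
  rewrite lt_neqAle le2 andbT; apply/eqP => e12; move: ps pt; rewrite e12; lra.
have mid : 1 + 1 <= e2 <= e3 by rewrite le2 le3.
have lt13 : 1 + 1 < e3 by lra.
have [r1 [r2 [q [r1P r2P cq hq qd]]]] := loop_crossing cf3 cphi mid lt13 zl d0 ps pt.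
have [t1' At1 rt1] := f2P r1 r1P; have [t2' At2 rt2] := f3P r2 r2P.
have t11 := A11 _ At1; have t21 := A21 _ At2.
have {}rt1 : small f3 r1 t1' (d + d).
  apply: (@small_eq f2 f3 _ _ _ e2) rt1; [|lra|lra].
  by move=> x xe; rewrite f3f2.
have r12 : small f3 r1 r2 (d + d).
  by exists q; split => // x y x01 y01; apply: phid; exact: qd.
have [q0 q1] := htp_ends hq; rewrite sub0 in q0; rewrite sub1 in q1.
(* [phi] is 2-Lipschitz: [d + 2 * (d + d) = 5 * d]. *)
have bnd r t' : small f3 r t' (d + d) -> t' <= 1 -> `|phi (f3 r)| < d -> `|phi (a t')| < 5 * d.
  move=> /small_dst rt t'1 pr; have := phiL (f3 r) (f3 t'); rewrite (f3a t')// in rt *.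
  by move: pr rt; rewrite !ltr_norml ler_norml; lra.
exists t1', t2'; split => //.
- apply: (@small_eq f3 a _ _ _ 1) => //.
  have := small_tri cf3 (small_tri cf3 (small_sym rt1) r12) rt2.
  by apply: small_le; lra.
- by apply: bnd rt1 _ _ => //; rewrite -q0; apply: qd; rewrite lexx ler01.
- by apply: bnd rt2 _ _ => //; rewrite -q1; apply: qd; rewrite lexx ler01.
Qed.

End small_paths.

(** * Closed sets of times and their gaps *)

Section closed_sets.
Context (R : realType).

Lemma closed_out (K : set R) t : closed K -> ~ K t ->
  exists2 d : R, 0 < d & forall s, `|t - s| < d -> ~ K s.
Proof.
move=> cK nKt; have /nbhs_ballP [d /= d0 dP] : nbhs t (~` K).
  by apply: open_nbhs_nbhs; split => //; exact: closed_openC.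
by exists d => // s ts; exact: dP.
Qed.

Lemma last_before (K : set R) k0 t : closed K -> K k0 -> k0 <= t ->
  exists m, [/\ K m, k0 <= m, m <= t & forall k, K k -> k <= t -> k <= m].
Proof.
move=> cK Kk0 k0t; pose A := [set k | K k /\ k <= t].
have nA : A !=set0 by exists k0.
have hA : has_sup A by split => //; exists t => k [].
have mA k : A k -> k <= sup A by apply: sup_upper_bound.
have mt : sup A <= t by apply: ge_sup => // k [].
exists (sup A); split => //; [|by apply: mA|by move=> k Kk kt; apply: mA].
apply: contrapT => /(closed_out cK) [d d0 dP].
have [k [Kk kt] km] := sup_adherent d0 hA.
apply: (dP k) => //; have := mA _ (conj Kk kt); rewrite ltr_norml; lra.
Qed.

Lemma first_after (K : set R) k0 t : closed K -> K k0 -> t <= k0 ->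
  exists m, [/\ K m, m <= k0, t <= m & forall k, K k -> t <= k -> m <= k].
Proof.
move=> cK Kk0 tk0; pose A := [set k | K k /\ t <= k].
have nA : A !=set0 by exists k0.
have hA : has_inf A by split => //; exists t => k [].
have mA k : A k -> inf A <= k by apply: ge_inf; case: hA.
have mt : t <= inf A by apply: lb_le_inf => // k [].
exists (inf A); split => //; [|by apply: mA|by move=> k Kk kt; apply: mA].
apply: contrapT => /(closed_out cK) [d d0 dP].
have [k [Kk kt] km] := inf_adherent d0 hA.
apply: (dP k) => //; have := mA _ (conj Kk kt); rewrite ltr_norml; lra.
Qed.

Lemma real_induction (a b : R) (T : set R) : a <= b -> T a ->
  (forall x, a <= x < b -> (forall y, a <= y <= x -> T y) ->
     exists2 d, 0 < d & forall y, x <= y < x + d -> T y) ->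
  (forall x, a < x <= b -> (forall y, a <= y < x -> T y) -> T x) ->
  forall x, a <= x <= b -> T x.
Proof.
move=> ab Ta step lim.
pose A := [set x | a <= x <= b /\ forall y, a <= y <= x -> T y].
have Aa : A a by split=> [|y ya]; [lra|have -> : y = a by lra].
have hA : has_sup A by split; [exists a|exists b => x [/andP[_ ->]]].
have sA x : A x -> x <= sup A by apply: sup_upper_bound.
have sb : sup A <= b by apply: ge_sup; [exists a|move=> x [/andP[_ ->]]].
have below y : a <= y < sup A -> T y.
  move=> /andP[ay ys]; have e0 : 0 < sup A - y by lra.
  have [x [xab xT] yx] := sup_adherent e0 hA; apply: xT; lra.
have as_ := sA _ Aa.
have upto y : a <= y <= sup A -> T y.
  move=> /andP[ay]; rewrite le_eqVlt => /orP[/eqP ->|ys]; last by apply: below; rewrite ay.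
  move: (as_); rewrite le_eqVlt => /orP[/eqP <- //|as'].
  by apply: lim => //; rewrite as'.
suff <- : sup A = b by [].
apply/eqP; rewrite eq_le sb /= leNgt; apply/negP => sltb.
have [|d d0 dP] := step (sup A) _ upto; first by rewrite as_.
pose x := Num.min b (sup A + d / 2).
have xs : sup A < x by rewrite lt_min sltb /=; lra.
have : A x.
  split; first by rewrite /x ge_min lexx /= andbT (le_trans as_)// ltW.
  move=> y /andP[ay yx]; case: (lerP y (sup A)) => ys; first by apply: upto; rewrite ay.
  apply: dP; rewrite ltW//=; apply: le_lt_trans yx _; rewrite gt_min; lra.
by move=> /sA; rewrite leNgt xs.
Qed.

End closed_sets.

Section collapse_gaps.
Context (R : realType) (V : pseudoMetricType R) (K : set R).
Hypotheses (cK : closed K) (K0 : forall t, t <= 0 -> K t) (K1 : forall t, 1 <= t -> K t).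

Lemma last_in_subproof t : exists m, [/\ K m, m <= t & forall k, K k -> k <= t -> k <= m].
Proof.
have k0 : K (Num.min t 0) by apply: K0; rewrite ge_min lexx orbT.
have k0t : Num.min t 0 <= t by rewrite ge_min lexx.
have [m [Km _ mt mP]] := last_before cK k0 k0t.
by exists m.
Qed.

(** Sends a gap to its left end, and jumps at the right end of each gap. *)
Definition last_in t := sval (cid (last_in_subproof t)).

Lemma last_inP t : [/\ K (last_in t), last_in t <= t &
  forall k, K k -> k <= t -> k <= last_in t].
Proof. exact: svalP (cid (last_in_subproof t)). Qed.

Lemma last_in_id t : K t -> last_in t = t.
Proof.
move=> Kt; have [_ lt tl] := last_inP t.
by apply/eqP; rewrite eq_le lt tl.
Qed.

Lemma last_in_le s t : s <= t -> last_in s <= last_in t.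
Proof.
move=> st; have [Ks ls _] := last_inP s; have [_ _ h] := last_inP t.
by apply: h => //; exact: le_trans st.
Qed.

Definition gap p q := [/\ K p, K q, p < q & forall x, p < x < q -> ~ K x].

Lemma next_in s t : last_in s < last_in t ->
  exists k, [/\ K k, s <= k, k <= last_in t & k = last_in s \/ gap (last_in s) k].
Proof.
move=> lst; have [Ks ls sP] := last_inP s; have [Kt lt tP] := last_inP t.
have st : s < last_in t by rewrite ltNge; apply/negP => h; have := sP _ Kt h; lra.
have [k [Kk kt sk kP]] := first_after cK Kt (ltW st).
exists k; split => //.
case: (eqVneq k (last_in s)) => [->|kl]; [by left|right].
have lk : last_in s < k by rewrite lt_neqAle eq_sym kl (le_trans ls).
split => // x /andP[lx xk] Kx; case: (lerP s x) => sx.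
  by have := kP _ Kx sx; rewrite leNgt xk.
by have := sP _ Kx (ltW sx); rewrite leNgt lx.
Qed.

Context (f : R -> V).
Hypotheses (cf : continuous f) (gapf : forall p q, gap p q -> f p = f q).

(** If [last_in] changes between [s] and [t], let [k] be the first time of [K] after [s]: either [k]
    is [last_in s] or a gap with equal values at its ends leads there. So the jumps of [last_in] do
    not show in [f (last_in t)]. *)
Lemma collapse_gaps_between s t : s <= t ->
  last_in s = last_in t \/ exists k, [/\ K k, s <= k, k <= last_in t & f (last_in s) = f k].
Proof.
move=> st; have := last_in_le st; rewrite le_eqVlt => /orP[/eqP ->|/next_in]; first by left.
move=> [k [Kk sk kt kgap]]; right; exists k; split => //.
by case: kgap => [->//|/gapf].
Qed.

Lemma continuous_collapse_gaps : continuous (fun t => f (last_in t)).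
Proof.
apply/contP => t e e0; have e2 : 0 < e / 2 by lra.
have [d d0 dP] := (contP f).1 cf t _ e2; exists d => // s ts.
have both x y : `|t - x| < d -> `|t - y| < d -> ball (f x) e (f y).
  move=> tx ty; rewrite (splitr e); apply: ball_triangle (dP _ ty).
  by apply: ball_sym; exact: dP.
have [_ lt _] := last_inP t; have [_ ls _] := last_inP s.
move: ts; rewrite ltr_norml => ts.
case: (lerP t s) => tl.
  have [->|[k [_ tk ks ->]]] := collapse_gaps_between tl; first exact: ballxx.
  by apply: both; rewrite ltr_norml; lra.
have [->|[k [_ tk ks ->]]] := collapse_gaps_between (ltW tl); first exact: ballxx.
by apply: both; rewrite ltr_norml; lra.
Qed.

End collapse_gaps.

(* Pointwise form of the fact that a continuous surjection from a compact space onto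
   a Hausdorff one is a quotient map. *)
Lemma quotient_near (R : realType) (Z W : topologicalType) (V : pseudoMetricType R)
    (K : set Z) (q : Z -> W) (f : Z -> V) (z0 : Z) (e : R) :
  compact K -> hausdorff_space W -> continuous q -> continuous f -> 0 < e ->
  (forall z, K z -> q z = q z0 -> f z = f z0) ->
  \forall w \near q z0, forall z, K z -> q z = w -> ball (f z0) e (f z).
Proof.
move=> cK hW cq cf e0 fib.
pose C := K `&` ~` (f @^-1` (ball (f z0) e)^°).
have cC : compact C.
  apply: compact_closedI => //; apply: open_closedC.
  by move/continuousP: cf; apply; exact: open_interior.
have : closed (q @` C).
  by apply: compact_closed => //; apply: continuous_compact => //; exact: continuous_subspaceT.
move=> cqC; have : nbhs (q z0) (~` (q @` C)).
  apply: open_nbhs_nbhs; split; first exact: closed_openC.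
  move=> [z [Kz nz] qz]; apply: nz; rewrite /= (fib z)//.
  by apply: nbhsx_ballx.
apply: filterS => w nw z Kz qz; apply: contrapT => nb; apply: nw.
by exists z => //; split => // /interior_subset.
Qed.

(** * Monotone factorisation: making a path non-constant on every interval *)

Section running_sup.
Context (R : realType) (k : R -> R).
Hypotheses (ck : continuous k) (k01 : forall x, 0 <= k x <= 1).

Definition runsup t := sup [set k x | x in [set x | x <= t]].

Lemma has_sup_runsup t : has_sup [set k x | x in [set x | x <= t]].
Proof.
split; first by exists (k t), t => //=.
by exists 1 => _ [x _ <-]; have /andP[] := k01 x.
Qed.

Lemma le_runsup x t : x <= t -> k x <= runsup t.
Proof. by move=> xt; apply: sup_upper_bound; [exact: has_sup_runsup|exists x]. Qed.

Lemma runsup_le t c : (forall x, x <= t -> k x <= c) -> runsup t <= c.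
Proof.
move=> h; apply: ge_sup; first by case: (has_sup_runsup t).
by move=> _ [x xt <-]; exact: h.
Qed.

Lemma runsup_mono s t : s <= t -> runsup s <= runsup t.
Proof. by move=> st; apply: runsup_le => x xs; apply: le_runsup; exact: le_trans st. Qed.

Lemma runsup01 t : 0 <= runsup t <= 1.
Proof.
apply/andP; split; last by apply: runsup_le => x _; have /andP[] := k01 x.
by apply: le_trans (le_runsup (lexx t)); have /andP[] := k01 t.
Qed.

Lemma runsup_step s t c : s <= t -> (forall x, s <= x <= t -> k x <= k s + c) -> 0 <= c ->
  runsup t <= runsup s + c.
Proof.
move=> st h c0; apply: runsup_le => x xt; case: (lerP x s) => xs.
  by apply: le_trans (le_runsup xs) _; rewrite lerDl.
apply: le_trans (h _ _) _; first by rewrite (ltW xs).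
by rewrite lerD2r le_runsup.
Qed.

Lemma continuous_runsup : continuous runsup.
Proof.
apply/contP => t e e0; have e3 : 0 < e / 3 by lra.
have [d d0 dP] := (contP k).1 ck t _ e3; exists d => // s ts.
have near x : `|t - x| < d -> `|k t - k x| < e / 3 by move=> /dP.
rewrite ballR; move: ts; rewrite ltr_norml => ts.
have bnd x y : `|t - x| < d -> `|t - y| < d -> k y <= k x + 2 * (e / 3).
  by move=> /near + /near; rewrite !ltr_norml; lra.
case: (lerP t s) => st.
  have h : runsup s <= runsup t + 2 * (e / 3).
    by apply: runsup_step; [|move=> x xst; apply: bnd; rewrite ltr_norml|]; lra.
  by have := runsup_mono st; rewrite ltr_norml; lra.
have h : runsup t <= runsup s + 2 * (e / 3).
  by apply: runsup_step; [|move=> x xst; apply: bnd; rewrite ltr_norml|]; lra.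
by have := runsup_mono (ltW st); rewrite ltr_norml; lra.
Qed.

End running_sup.

Section weighted_sum.
Context (R : realType) (th : nat -> R -> R).
Hypotheses (cth : forall n, continuous (th n)) (th01 : forall n x, 0 <= th n x <= 1).
Hypotheses (thm : forall n s t, s <= t -> th n s <= th n t).

Let S N t := \sum_(n < N) 2 ^- n.+1 * th n t.

Let SS N t : S N.+1 t = S N t + 2 ^- N.+1 * th N t.
Proof. by rewrite /S big_ord_recr. Qed.

Let half_gt0 N : 0 < 2 ^- N :> R. Proof. by rewrite invr_gt0 exprn_gt0. Qed.
Let halfS N : 2 ^- N = 2 ^- N.+1 + 2 ^- N.+1 :> R.
Proof. by rewrite exprS invfM; lra. Qed.

Let S_mono_idx N M t : (N <= M)%N -> S N t <= S M t <= S N t + (2 ^- N - 2 ^- M).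
Proof.
move=> /subnK <-; elim: (M - N)%N => [|k IH]; first by rewrite subrr addr0 lexx.
rewrite addSn SS; have /andP[t0 t1] := th01 (k + N)%N t; move: IH => /andP[I1 I2].
have := half_gt0 (k + N)%N.+1; have := halfS (k + N)%N; nra.
Qed.

(** The weights sum to 1, so the remainder after [N] terms is at most [2 ^- N], uniformly in [t]. *)
Definition wsum t := sup [set S N t | N in [set: nat]].

Let hs t : has_sup [set S N t | N in [set: nat]].
Proof.
split; first by exists (S 0%N t), 0%N.
exists 1 => _ [N _ <-]; have /andP[_] := @S_mono_idx 0%N N t isT.
by rewrite /S big_ord0 add0r expr0 invr1 => h; apply: le_trans h _; rewrite gerBl ltW.
Qed.

Let S_le_wsum N t : S N t <= wsum t <= S N t + 2 ^- N.
Proof.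
apply/andP; split; first by apply: sup_upper_bound => //; exists N.
apply: ge_sup => [|_ [M _ <-]]; first by case: (hs t).
have h0 := half_gt0 M; have hN := half_gt0 N; case: (leqP N M) => NM.
  by have /andP[_] := S_mono_idx t NM; lra.
by have /andP[] := S_mono_idx t (ltnW NM); lra.
Qed.

Let S_mono N s t : s <= t -> S N s <= S N t.
Proof.
move=> st; apply: ler_sum => n _; apply: ler_wpM2l; first exact: ltW.
exact: thm.
Qed.

Lemma wsum_mono s t : s <= t -> wsum s <= wsum t.
Proof.
move=> st; apply: ge_sup => [|_ [N _ <-]]; first by case: (hs s).
by apply: le_trans (S_mono N st) _; have /andP[] := S_le_wsum N t.
Qed.

Lemma wsum_lt n s t : s <= t -> th n s < th n t -> wsum s < wsum t.
Proof.
move=> st lt; pose c := 2 ^- n.+1 * (th n t - th n s).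
have c0 : 0 < c by rewrite mulr_gt0// subr_gt0.
suff : wsum s <= wsum t - c by lra.
apply: ge_sup => [|_ [N _ <-]]; first by case: (hs s).
have big M : (n < M)%N -> S M s + c <= S M t.
  move=> /subnK <-; elim: (M - n.+1)%N => [|k IH].
    rewrite add0n !SS; have := S_mono n st; rewrite /c; lra.
  rewrite addSn !SS; have := thm (k + n.+1)%N st; have := half_gt0 (k + n.+1)%N.+1; nra.
have /andP[+ _] := S_mono_idx s (leq_maxl N n.+1).
have := big (maxn N n.+1) (leq_maxr _ _).
have /andP[+ _] := S_le_wsum (maxn N n.+1) t; lra.
Qed.

Lemma wsum_eq s t : (forall n, th n s = th n t) -> wsum s = wsum t.
Proof.
move=> h; rewrite /wsum; congr sup; apply/seteqP.
by split=> _ [N _ <-]; exists N => //; apply: eq_bigr => n _; rewrite h.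
Qed.

Lemma continuous_wsum : continuous wsum.
Proof.
have cS N : continuous (S N).
  elim: N => [|N IH].
    have -> : S 0%N = fun=> 0 by apply/funext => t; rewrite /S big_ord0.
    exact: cont_cst.
  have -> : S N.+1 = fun t => S N t + 2 ^- N.+1 * th N t by apply/funext => t; exact: SS.
  by have cN : continuous (th N) := @cth N; cts.
apply/contP => t e e0.
have [N hN] : exists N, 2 ^- N < e / 3.
  have e3 : 0 < e / 3 by lra.
  exists (Num.truncn (e / 3)^-1).+1.
  rewrite -[ltRHS]invrK ltf_pV2 ?posrE ?exprn_gt0 ?invr_gt0//.
  apply: lt_trans (Num.Theory.truncnS_gt _) _.
  by rewrite -natrX ltr_nat ltn_expl.
have e3 : 0 < e / 3 by lra.
have [d d0 dP] := (contP (S N)).1 (cS N) t _ e3; exists d => // s /dP.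
rewrite !ballR !ltr_norml => h.
by have := S_le_wsum N t; have := S_le_wsum N s; lra.
Qed.

End weighted_sum.

Section monotone_factorisation.
Context (R : realType) (V : metricType R) (f : R -> V).
Hypotheses (cf : continuous f) (f0 : forall t, t <= 0 -> f t = f 0)
  (f1 : forall t, 1 <= t -> f t = f 1).

Definition const_on s t := forall x, s <= x <= t -> f x = f s.

Hypothesis (nf : ~ const_on 0 1).

Lemma continuous_mdist (Y : topologicalType) (g h : Y -> V) :
  continuous g -> continuous h -> continuous (fun y => mdist (g y) (h y)).
Proof.
move=> cg ch y; apply/cvg_ballP => e e0; have e2 : 0 < e / 2 by lra.
near=> z; rewrite ballR.
have : mdist (g y) (g z) < e / 2.
  by near: z; have := cg y _ (nbhsx_ballx (g y) _ e2); rewrite ballEmdist.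
have : mdist (h y) (h z) < e / 2.
  by near: z; have := ch y _ (nbhsx_ballx (h y) _ e2); rewrite ballEmdist.
have := metric_triangle (g y) (g z) (h y); have := metric_triangle (g z) (h z) (h y).
have := metric_triangle (g z) (g y) (h z); have := metric_triangle (g y) (h y) (h z).
rewrite (metric_sym (h z) (h y)) (metric_sym (g z) (g y)) ltr_norml; lra.
Unshelve. all: by end_near. Qed.

(** Rationals [q n], with 0 for the numbers that are not codes. The running supremum of [k n]
    vanishes up to [q n] and then records how far [f] has departed from [f (q n)]; it is constant
    wherever [f] is. *)
Let q (n : nat) : R := if unpickle n is Some r then ratr (r : rat) else 0.
Let k n x := Num.min 1 (mdist (f (Num.max x (q n))) (f (q n))).

Let ck n : continuous (k n).
Proof.
apply: contmin; first exact: cont_cst.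
apply: continuous_mdist; last exact: cont_cst.
by apply: cont_comp => //; cts.
Qed.

Let k01 n x : 0 <= k n x <= 1.
Proof. by rewrite /k le_min ler01 mdist_ge0 ge_min lexx. Qed.

Let phi0 := wsum (fun n => runsup (k n)).

Let cphi0 : continuous phi0.
Proof. by apply: continuous_wsum => n; [exact: continuous_runsup|exact: runsup01]. Qed.

Let phi0_mono s t : s <= t -> phi0 s <= phi0 t.
Proof. by apply: wsum_mono => n; [exact: runsup01|exact: runsup_mono]. Qed.

Let phi0_const s t : s <= t -> const_on s t -> phi0 s = phi0 t.
Proof.
move=> st cst; apply: wsum_eq => n; apply/eqP; rewrite eq_le runsup_mono//=.
apply: runsup_le => // x xt; case: (lerP x s) => xs; first exact: le_runsup.
suff : k n x = k n s \/ k n x = 0.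
  by case=> ->; [exact: le_runsup|have /andP[] := runsup01 (k01 n) s].
rewrite /k; case: (lerP (q n) s) => qs.
  have qx := le_trans qs (ltW xs).
  by left; rewrite ?(max_idPl qx) ?(max_idPl qs) cst// (ltW xs).
right; case: (lerP x (q n)) => qx.
  by rewrite mdistxx (min_idPr _).
rewrite (cst x) ?(ltW xs)// (cst (q n)); last by rewrite (ltW qs) (le_trans (ltW qx)).
by rewrite mdistxx (min_idPr _).
Qed.

Let phi0_strict s t : s <= t -> ~ const_on s t -> phi0 s < phi0 t.
Proof.
move=> st nc; have [x [xst nx]] : exists x, s <= x <= t /\ f x <> f s.
  by apply: contrapT => h; apply: nc => x xst; apply: contrapT => fx; apply: h; exists x.
have d0 : 0 < mdist (f x) (f s) by rewrite mdist_gt0; apply/eqP.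
have [d dp dP] := (contP f).1 cf s _ d0.
have sx : s < x by rewrite lt_neqAle; case/andP: xst => -> _; rewrite andbT; apply/eqP => sx;
  apply: nx; rewrite sx.
(* For a rational [r] right after [s], [f r] differs from [f x]; the running supremum for [r] is 0
   at [s] and positive at [t]. *)
have lt : s < Num.min x (s + d) by rewrite lt_min sx ltrDl.
have [r] := rat_in_itvoo lt; rewrite in_itv /= lt_min => /and3P[sr rx rd].
have qr : q (pickle r) = ratr r by rewrite /q pickleK.
apply: (@wsum_lt _ _ _ _ (pickle r)) => //; [by move=> n y; exact: runsup01|by move=> n a b;
  exact: runsup_mono|].
have frs : f x <> f (ratr r).
  move=> fxr; have := dP (ratr r); rewrite ballEmdist /= -fxr (metric_sym (f s)) ltxx.
  by move=> h; have : false by apply: h; rewrite ltr_norml; lra.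
apply: (@le_lt_trans _ _ 0).
  apply: runsup_le => // y ys; rewrite /k qr (max_idPr _) ?mdistxx ?(min_idPr _)//.
  by apply: ltW; exact: le_lt_trans sr.
apply: (@lt_le_trans _ _ (k (pickle r) x)); last by apply: le_runsup => //; case/andP: xst.
by rewrite /k qr (max_idPl (ltW rx)) lt_min ltr01 mdist_gt0; apply/eqP.
Qed.

Let D := phi0 1 - phi0 0.
Let D0 : 0 < D. Proof. by rewrite subr_gt0; exact: phi0_strict. Qed.

Let phi t := (phi0 t - phi0 0) / D.

Lemma monotone_factorisation : exists (phi : R -> R) (g : R -> V),
  [/\ continuous phi, continuous g & forall t, f t = g (phi t)] /\
  [/\ forall s t, s <= t -> phi s <= phi t,
      forall t, t <= 0 -> phi t = 0, forall t, 1 <= t -> phi t = 1,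
      forall y, 0 <= y <= 1 -> exists2 t, 0 <= t <= 1 & phi t = y &
      forall s t, s <= t -> (const_on s t <-> phi s = phi t)].
Proof.
have cphi : continuous phi by rewrite /phi; cts.
have phim s t : s <= t -> phi s <= phi t.
  by move=> st; rewrite ler_pM2r ?invr_gt0// lerD2r phi0_mono.
have phic s t : s <= t -> (const_on s t <-> phi s = phi t).
  move=> st; split; first by move=> /(phi0_const st) h; rewrite /phi h.
  move=> /divIf; rewrite gt_eqF// => /(_ isT) h; apply: contrapT => /(phi0_strict st); lra.
have phi_0 : phi 0 = 0 by rewrite /phi subrr mul0r.
have phi_1 : phi 1 = 1 by rewrite /phi divff// gt_eqF.
have le0 t : t <= 0 -> phi t = 0.
  move=> t0; rewrite -phi_0; apply: (phic _ _ t0).1 => x /andP[_ x0]; rewrite f0//.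
  by rewrite [RHS]f0.
have ge1 t : 1 <= t -> phi t = 1.
  move=> t1; rewrite -phi_1; apply/esym; apply: (phic _ _ t1).1 => x /andP[x1 _].
  by rewrite f1.
have onto y : 0 <= y <= 1 -> exists2 t, 0 <= t <= 1 & phi t = y.
  move=> y01; have [||t t01 <-] := @IVT R phi 0 1 y ler01.
  - exact: continuous_subspaceT.
  - by rewrite phi_0 phi_1 (min_idPl ler01) (max_idPr ler01).
  - by exists t => //; move: t01; rewrite in_itv.
(* An arbitrary section of [phi], possibly discontinuous; [f \o psi] is continuous because [phi] is
   a quotient map and [f] is constant on its fibres. *)
pose psi y := xget 0 [set t | 0 <= t <= 1 /\ phi t = clamp_real y].
have psiP y : 0 <= psi y <= 1 /\ phi (psi y) = clamp_real y.
  have [t t01 ty] := onto _ (clampr_itv y).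
  exact: (@xgetPex _ 0 [set t | 0 <= t <= 1 /\ phi t = clamp_real y] (ex_intro _ t (conj t01 ty))).
have fphi s t : phi s = phi t -> f s = f t.
  wlog st : s t / s <= t => [h pst|/(phic _ _ st).2 c].
    by case: (lerP s t) => [/h->//|/ltW/h/(_ (esym pst))->].
  by apply/esym; apply: c; rewrite st lexx.
exists phi, (fun y => f (psi y)); split; split => //.
- apply/contP => y e e0; have [py01 py] := psiP y.
  have := quotient_near (z0 := psi y) (@segment_compact R 0 1) (@Rhausdorff R) cphi cf e0.
  case/(_ _)/nbhs_ballP => [z _ /fphi //|d /= d0 dP].
  have [r r0 rP] := (contP _).1 (cont_clamp (@cont_id R)) y _ d0.
  exists r => // s /rP ys; have [ps01 ps] := psiP s.
  by apply: (dP (clamp_real s)) => //=; rewrite ?py// in_itv.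
- move=> t; apply: fphi; have [_ ->] := psiP (phi t); rewrite clampr_id//.
  case: (lerP t 0) => t0; first by rewrite le0// lexx ler01.
  case: (lerP 1 t) => t1; first by rewrite ge1// lexx ler01.
  by rewrite -{1}phi_0 -phi_1 !phim// ltW.
Qed.

End monotone_factorisation.

(** * Arcs and simple closed curves *)

Section arcs.
Context (R : realType) (X : metricType R).
Implicit Types (f : R -> X) (K : set R).

(** The times that are kept when excursions of [f] that return to their starting point are cut
    out. *)
Definition closing f K := [/\ closed K, forall t, t <= 0 -> K t, forall t, 1 <= t -> K t &
  forall p q, gap K p q -> f p = f q].

(** Since the [U] form a chain of open sets, one of them covers the compact subinterval
    [p + dd, q - dd] of a gap (p, q) of the limit. The gap of its complement around this subinterval
    has ends within [dd] of [p] and [q], with equal values of [f]. *)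
Lemma closing_bigcup f (F : set (set R)) : continuous f ->
  (forall U, F U -> closing f (~` U)) -> total_on F subset -> closing f (~` \bigcup_(U in F) U).
Proof.
move=> cf FP Ftot; split.
- apply: open_closedC; apply: bigcup_open => U FU; rewrite -[U]setCK.
  by apply: closed_openC; have [] := FP _ FU.
- by move=> t t0 [U FU Ut]; have [_ h _ _] := FP _ FU; exact: h Ut.
- by move=> t t1 [U FU Ut]; have [_ _ h _] := FP _ FU; exact: h Ut.
move=> p q [np nq pq inner]; apply: contrapT => /eqP; rewrite -mdist_gt0 => e0.
set e := mdist _ _ in e0; have e2 : 0 < e / 2 by lra.
have [d1 d10 d1P] := (contP f).1 cf p _ e2.
have [d2 d20 d2P] := (contP f).1 cf q _ e2.
pose dd := Num.min (Num.min d1 d2) ((q - p) / 3) / 2.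
have qp3 : 0 < (q - p) / 3 by lra.
have dd0 : 0 < dd by rewrite divr_gt0// !lt_min d10 d20.
have [dd1 dd2 dd3] : [/\ dd < d1, dd < d2 & dd < (q - p) / 3].
  have h : dd < Num.min (Num.min d1 d2) ((q - p) / 3) by rewrite /dd in dd0 *; lra.
  by move: h; rewrite !lt_min -andbA => /and3P[].
pose T x := exists2 U, F U & forall y, p + dd <= y <= x -> U y.
have Uopen U x : F U -> U x -> exists2 d, 0 < d & forall y, `|x - y| < d -> U y.
  move=> FU Ux; have [cU _ _ _] := FP _ FU.
  have nUx : ~ (~` U) x by move=> h; exact: h Ux.
  have [d d0 dP] := closed_out cU nUx.
  by exists d => // y /dP /contrapT.
have cover x : p < x < q -> exists2 U, F U & U x.
  by move=> xpq; have /contrapT [U FU Ux] := inner _ xpq; exists U.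
have [||||//|U FU Ucov] := @real_induction _ (p + dd) (q - dd) T _ _ _ _ (q - dd).
- by lra.
- have [|U FU Ux] := cover (p + dd); first lra.
  by exists U => // y ydd; have -> : y = p + dd by lra.
- move=> x /andP[x1 x2] /(_ x) []; first by rewrite x1 lexx.
  move=> U FU Uc; have [|d d0 dP] := Uopen U x FU; first by apply: Uc; rewrite x1 lexx.
  exists d => // y yx; exists U => // z zy; case: (lerP z x) => zx; first by apply: Uc; lra.
  by apply: dP; rewrite ltr_norml; lra.
- move=> x /andP[x1 x2] IH; have [|U FU Ux] := cover x; first lra.
  have [d d0 dP] := Uopen U x FU Ux.
  pose y := Num.max (p + dd) (x - d / 2).
  have yx : y < x by rewrite gt_max x1; lra.
  have yp : p + dd <= y by rewrite le_max lexx.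
  have yd : x - d / 2 <= y by rewrite le_max lexx orbT.
  have [|U' FU' U'c] := IH y; first by rewrite yp.
  have near z : y < z <= x -> U z by move=> zx; apply: dP; rewrite ltr_norml; lra.
  case: (Ftot _ _ FU FU') => sub.
    exists U' => // z zx; case: (lerP z y) => zy; first by apply: U'c; lra.
    by apply/sub/near; lra.
  exists U => // z zx; case: (lerP z y) => zy; first by apply/sub/U'c; lra.
  by apply/near; lra.
- by lra.
have [cU U0 U1 Ug] := FP _ FU.
have Kp : (~` U) p by move=> Up; apply: np; exists U.
have Kq : (~` U) q by move=> Uq; apply: nq; exists U.
have pdd : p <= p + dd by lra.
have [a [Ka pa ad aP]] := last_before cU Kp pdd.
have qdd : q - dd <= q by lra.
have [b [Kb bq bd bP]] := first_after cU Kq qdd.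
have fab : f a = f b.
  apply: Ug; split => //; first by lra.
  move=> x /andP[ax xb] Kx; case: (lerP x (p + dd)) => xp; first by have := aP _ Kx xp; lra.
  case: (lerP (q - dd) x) => xq; first by have := bP _ Kx xq; lra.
  by apply: Kx; apply: Ucov; lra.
have : mdist (f p) (f a) < e / 2.
  by have := d1P a; rewrite ballEmdist; apply; rewrite ltr_norml; lra.
have : mdist (f q) (f b) < e / 2.
  by have := d2P b; rewrite ballEmdist; apply; rewrite ltr_norml; lra.
have := metric_triangle (f p) (f a) (f q).
by rewrite fab (metric_sym (f b)) -/e; lra.
Qed.

Lemma minimal_closing f : continuous f -> exists2 K, closing f K &
  forall K', closing f K' -> K' `<=` K -> K `<=` K'.
Proof.
move=> cf; have [U [UP Umax]] := @Zorn_bigcup R (fun U => closing f (~` U))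
  (fun F FP Ft => closing_bigcup cf FP Ft).
exists (~` U) => // K' cK' K'U t nUt; apply: contrapT => nK't.
apply: (Umax (~` K')); last by rewrite setCK.
split; last by move=> h; apply: nUt; exact: h.
by move=> x Ux K'x; exact: K'U K'x Ux.
Qed.

(** Loop erasure. For a minimal closing [K], the path [f \o last_in] takes a value twice only if it
    is constant in between: otherwise the kept times strictly in between could be dropped.
    [monotone_factorisation] then removes the intervals of constancy. *)
Lemma arc_in_path f : continuous f -> (forall t, t <= 0 -> f t = f 0) ->
  (forall t, 1 <= t -> f t = f 1) -> f 0 <> f 1 ->
  exists g : R -> X, [/\ continuous g, g 0 = f 0, g 1 = f 1,
    forall x, exists2 t, 0 <= t <= 1 & g x = f t &
    forall x y, 0 <= x <= 1 -> 0 <= y <= 1 -> g x = g y -> x = y].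
Proof.
move=> cf f0 f1 f01; have [K [cK K0 K1 Kg] Kmin] := minimal_closing cf.
pose s := last_in cK K0; pose h t := f (s t).
have sP t := last_inP cK K0 t.
have sid t : K t -> s t = t by exact: last_in_id.
have smono a b : a <= b -> s a <= s b by exact: last_in_le.
have ch : continuous h by exact: continuous_collapse_gaps.
have h0 : h 0 = f 0 by rewrite /h sid//; exact: (K0 _).
have h1 : h 1 = f 1 by rewrite /h sid//; exact: K1.
have hle0 t : t <= 0 -> h t = h 0 by move=> t0; rewrite h0 /h sid ?f0//; exact: (K0 _).
have hge1 t : 1 <= t -> h t = h 1 by move=> t1; rewrite h1 /h sid ?f1//; exact: K1.
have hconst a b : 0 <= a -> b <= 1 -> a <= b -> h a = h b -> const_on h a b.
  move=> a0 b1 ab hab; case: (eqVneq (s a) (s b)) => sab.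
    move=> x /andP[ax xb]; rewrite /h; congr f; apply/eqP.
    by rewrite eq_le; apply/andP; split; [rewrite sab|]; exact: smono.
  have lab : s a < s b by rewrite lt_neqAle sab smono.
  pose K' := K `&` [set x | x <= s a \/ s b <= x].
  have [Ka la aP] := sP a; have [Kb lb bP] := sP b.
  have cK' : closing f K'.
    split.
    - apply: closedI => //; rewrite (_ : [set x | _] = [set x | x <= s a] `|` [set x | x >= s b]).
        by apply: closedU; [exact: closed_le|exact: closed_ge].
      by apply/seteqP; split.
    - move=> t t0; split; [exact: (K0 _)|left].
      exact: le_trans t0 (aP 0 (K0 _ (lexx 0)) a0).
    - by move=> t t1; split; [exact: K1|right]; apply: le_trans lb (le_trans b1 t1).
    - move=> p q [[Kp pP] [Kq qP] pq inner].
      case: (pselect (exists2 x, p < x < q & K x)) => [[x xpq Kx]|nx]; last first.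
        by apply: Kg; split => // x xpq Kx; apply: nx; exists x.
      have xab : s a < x < s b.
        case: (lerP x (s a)) => xa; first by exfalso; apply: (inner _ xpq); split => //; left.
        by case: (lerP (s b) x) => xb //; exfalso; apply: (inner _ xpq); split => //; right.
      have pa : p <= s a by case: pP => //; lra.
      have qb : s b <= q by case: qP => //; lra.
      have -> : p = s a.
        apply/eqP; rewrite eq_le pa leNgt; apply/negP => pa'.
        by apply: (inner (s a)); [lra|split => //; left].
      have -> // : q = s b.
      apply/eqP; rewrite eq_le qb andbT leNgt; apply/negP => qb'.
      by apply: (inner (s b)); [lra|split => //; right].
  have KK' := Kmin _ cK' (@subIsetl _ _ _).
  move=> x /andP[ax xb]; have [Kx lx xP] := sP x.
  have [_ []] := KK' _ Kx.
    by move=> xa; rewrite /h; congr f; apply/eqP; rewrite eq_le xa smono.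
  by move=> bx; rewrite hab /h; congr f; apply/eqP; rewrite eq_le bx smono.
have nh : ~ const_on h 0 1.
  by move=> c; apply: f01; rewrite -h0 -h1 c// lexx ler01.
have [phi [g [[cphi cg hg] [phim phi0 phi1 onto phic]]]] := monotone_factorisation ch hle0 hge1 nh.
exists (fun x => g (clamp_real x)); split.
- by cts.
- by rewrite clampr0 -h0 hg phi0.
- by rewrite clampr1 -h1 hg phi1.
- move=> x; have [t t01 <-] := onto _ (clampr_itv x).
  rewrite -hg /h; have [Kt lt tP] := sP t; exists (s t) => //.
  apply/andP; split; last by apply: le_trans lt _; case/andP: t01.
  by apply: tP; [exact: (K0 _)|case/andP: t01].
- move=> x y x01 y01; rewrite !clampr_id//.
  have [a /andP[a0 a1] <-] := onto _ x01; have [b /andP[b0 b1] <-] := onto _ y01.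
  rewrite -!hg; case: (lerP a b) => [ab hab|/ltW ab /esym hab].
    by apply: (phic _ _ ab).1; exact: hconst.
  by apply/esym/(phic _ _ ab).1; exact: hconst.
Qed.

End arcs.

(** For maps defined by choosing preimages under [q], such as the angle of a point of the circle:
    the choice may be discontinuous, but its composite with [f] is not. *)
Lemma continuous_through (R : realType) (Z W : topologicalType) (V : pseudoMetricType R)
    (K : set Z) (q : Z -> W) (f : Z -> V) (A : set W) (h : A -> V) :
  compact K -> hausdorff_space W -> continuous q -> continuous f ->
  (forall s t, K s -> K t -> q s = q t -> f s = f t) ->
  (forall y : A, exists t, [/\ K t, q t = set_val y & h y = f t]) -> continuous h.
Proof.
move=> cK hW cq cf fib hP y U /nbhs_ballP [e /= e0 eU].
have [t [Kt qt hy]] := hP y; rewrite hy in eU.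
have := quotient_near (z0 := t) cK hW cq cf e0 (fun s Ks => fib s t Ks Kt).
rewrite qt => /(@initial_continuous A W set_val y) nW.
apply: (@filterS _ _ (@nbhs_filter A y)) nW => y' /= h'.
by apply: eU; have [t' [Kt' qt' ->]] := hP y'; exact: h'.
Qed.

(** * The circle and simple closed curves *)

Section circle.
Context (R : realType).

Definition circle (t : R) : R * R := (cos (2 * pi * t), sin (2 * pi * t)).

Lemma continuous_circle : continuous circle.
Proof.
have c1 := @continuous_cos R; have c2 := @continuous_sin R.
by rewrite /circle; cts.
Qed.

Lemma circle_unit t : @unit_circle R (circle t).
Proof. by rewrite /unit_circle /circle /= cos2Dsin2. Qed.

Lemma circle0 : circle 0 = (1, 0).
Proof. by rewrite /circle !mulr0 cos0 sin0. Qed.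

Lemma circle1 : circle 1 = (1, 0).
Proof. by rewrite /circle !mulr1 mulr_natl cos2pi sin2pi. Qed.

Lemma cos2piB (a : R) : cos (2 * pi - a) = cos a.
Proof. by rewrite mulr_natl addrC cosD2pi cosN. Qed.

Lemma sin2piB (a : R) : sin (2 * pi - a) = - sin a.
Proof. by rewrite mulr_natl addrC sinD2pi sinN. Qed.

Lemma circle_onto z : @unit_circle R z -> exists2 t, 0 <= t <= 1 & circle t = z.
Proof.
case: z => x y; rewrite /unit_circle /= => xy.
have x1 : -1 <= x <= 1 by apply/andP; split; nra.
have p0 := @pi_gt0 R; have p2 : 2 * pi != 0 :> R by rewrite gt_eqF//; lra.
have a0 := acos_ge0 x1; have a1 := acos_lepi x1.
have ca : cos (acos x) = x by apply: acosK; rewrite in_itv.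
have sa : sin (acos x) = `|y| by rewrite sin_acos// -sqrtr_sqr; congr Num.sqrt; lra.
have i0 : 0 < (2 * pi)^-1 :> R by rewrite invr_gt0; lra.
have b : 0 <= acos x / (2 * pi) <= 1.
  by rewrite divr_ge0//= ?ler_pdivrMr ?mul1r; lra.
have m : 2 * pi * (acos x / (2 * pi)) = acos x by rewrite mulrC divfK.
case: (lerP 0 y) => y0.
  by exists (acos x / (2 * pi)) => //; rewrite /circle m ca sa ger0_norm.
exists (1 - acos x / (2 * pi)); first lra.
by rewrite /circle mulrBr mulr1 m cos2piB sin2piB ca sa ltr0_norm// opprK.
Qed.

Lemma circle_inj s t : 0 <= s <= 1 -> 0 <= t <= 1 -> circle s = circle t ->
  [\/ s = t, s = 0 /\ t = 1 | s = 1 /\ t = 0].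
Proof.
wlog st : s t / s <= t => [h s01 t01 e|].
  case: (lerP s t) => [/h|/ltW/h]; first exact.
  case=> // [->|[-> ->]|[-> ->]]; [exact: Or31|exact: Or33|exact: Or32].
move=> s01 t01 [ce se]; have p0 := @pi_gt0 R.
pose th := 2 * pi * (t - s); have cth : cos th = 1.
  by rewrite /th mulrBr cosB ce se -!expr2 cos2Dsin2.
have th0 : 0 <= th by rewrite /th mulr_ge0//; lra.
have th1 : th <= 2 * pi by rewrite /th; nra.
have key (a : R) : 0 <= a <= pi -> cos a = 1 -> a = 0.
  move=> a0 ca; have ia : a \in `[0, pi] by rewrite in_itv.
  have i0 : 0 \in `[0, pi : R] by rewrite in_itv /= lexx; lra.
  by apply: (cos_inj ia i0); rewrite cos0.
have p2 : 2 * pi != 0 :> R by rewrite gt_eqF//; lra.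
case: (lerP th pi) => thp.
  have h : th = 0 by apply: key => //; rewrite th0.
  have : t - s = 0 by apply: (mulfI p2); rewrite mulr0.
  by move=> ts; apply: Or31; lra.
have h : 2 * pi - th = 0 by apply: key; [lra|rewrite cos2piB].
have : t - s = 1 by apply: (mulfI p2); rewrite mulr1 -/th; lra.
by move=> ts; apply: Or32; split; lra.
Qed.

Lemma hausdorff_plane : hausdorff_space (R * R)%type.
Proof. exact: norm_hausdorff. Qed.

Lemma simple_closed_curve_of_loop (X : metricType R) (g : R -> X) :
  continuous g -> g 0 = g 1 ->
  (forall s t, 0 <= s <= 1 -> 0 <= t <= 1 -> g s = g t ->
     [\/ s = t, s = 0 /\ t = 1 | s = 1 /\ t = 0]) ->
  simple_closed_curve R [set g t | t in [set t | 0 <= t <= 1]].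
Proof.
move=> cg g01 ginj; set C := [set g t | t in _].
have K01 : compact [set t : R | 0 <= t <= 1].
  have -> : [set t : R | 0 <= t <= 1] = [set` `[0, 1]] by apply/seteqP; split=> t /=;
    rewrite in_itv.
  exact: segment_compact.
have E01 : circle 0 = circle 1 by rewrite circle0 circle1.
have argP (z : @unit_circle R) : exists t, 0 <= t <= 1 /\ circle t = set_val z.
  by have [t t01 tz] := circle_onto (set_valP z); exists t.
pose arg z := sval (cid (argP z)).
have argE z : 0 <= arg z <= 1 /\ circle (arg z) = set_val z by exact: svalP (cid (argP z)).
have parP (y : C) : exists t, 0 <= t <= 1 /\ g t = set_val y.
  by have [t t01 ty] := set_valP y; exists t.
pose par y := sval (cid (parP y)).
have parE y : 0 <= par y <= 1 /\ g (par y) = set_val y by exact: svalP (cid (parP y)).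
have inC z : g (arg z) \in C by apply/mem_set; exists (arg z) => //; exact: (argE z).1.
have inU y : circle (par y) \in @unit_circle R by apply/mem_set/circle_unit.
have EE s t : 0 <= s <= 1 -> 0 <= t <= 1 -> circle s = circle t -> g s = g t.
  by move=> s01 t01 /(circle_inj s01 t01) [->|[-> ->]|[-> ->]].
have gg s t : 0 <= s <= 1 -> 0 <= t <= 1 -> g s = g t -> circle s = circle t.
  by move=> s01 t01 /(ginj _ _ s01 t01) [->|[-> ->]|[-> ->]].
exists (fun z => SigSub (inC z) : C), (fun y => SigSub (inU y) : @unit_circle R); split.
- apply: (@continuous_comp_initial _ _ _ set_val).
  apply: (continuous_through (K := [set t : R | 0 <= t <= 1]) (q := circle) (f := g)) => //.
  + exact: continuous_circle.
  + by move=> z; exists (arg z); have [? ?] := argE z.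
- apply: (@continuous_comp_initial _ _ _ set_val).
  apply: (continuous_through (K := [set t : R | 0 <= t <= 1]) (q := g) (f := circle)) => //.
  + exact: metric_hausdorff.
  + exact: continuous_circle.
  + by move=> y; exists (par y); have [? ?] := parE y.
- move=> z; apply: val_inj; have [z01 zE] := argE z; apply: etrans _ zE.
  have [y01 yE] := parE (SigSub (inC z)); exact: gg y01 z01 yE.
- move=> y; apply: val_inj; have [y01 yE] := parE y; apply: etrans _ yE.
  have [z01 zE] := argE (SigSub (inU y)); exact: EE z01 y01 zE.
Qed.

End circle.

(** * Cut points and retractions onto pieces *)

Section fpath.
Context (R : realType).

(** Functions on the whole line, constant outside [0, 1], so that statements about their image need
    no bounds on [t]. *)
Definition fpath (X : topologicalType) (f : R -> X) x y :=
  [/\ continuous f, forall t, t <= 0 -> f t = x & forall t, 1 <= t -> f t = y].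

Section topological.
Context (X : topologicalType).
Implicit Types (f : R -> X) (x y z : X) (A : set X).
Local Notation I := (unit_interval R).

Lemma fpath_path x y (p : {path I from x to y}) : fpath (fun t => p (clamp t)) x y.
Proof.
split; first by apply: continuous_path_clamp; exact: cont_id.
- by move=> t; exact: path_clamp_le0.
- by move=> t; exact: path_clamp_ge1.
Qed.

Lemma fpath01 f x y : fpath f x y -> f 0 = x /\ f 1 = y.
Proof. by move=> [_ f0 f1]; rewrite f0// f1. Qed.

Lemma path_fun f x y : continuous f -> f 0 = x -> f 1 = y ->
  exists p : {path I from x to y}, forall u, p u = f (ival u).
Proof.
move=> cf f0 f1; have cp : continuous (f \o @ival R).
  by apply: cont_comp => //; exact: continuous_ival.
have p0 : (f \o @ival R) zero = x by rewrite /= ival_zero.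
have p1 : (f \o @ival R) one = y by rewrite /= ival_one.
by exists (mk_path cp p0 p1).
Qed.

Lemma fpath_sub f s t : continuous f -> fpath (fun r => f (s + clamp_real r * (t - s))) (f s) (f t).
Proof.
move=> cf; split; first by cts.
- by move=> r r0; rewrite clampr_le0// mul0r addr0.
- by move=> r r1; rewrite clampr_ge1// mul1r addrC subrK.
Qed.

Lemma fpath_cst x : fpath (fun=> x) x x.
Proof. by split => //; exact: cont_cst. Qed.

Lemma fpath_rev f x y : fpath f x y -> fpath (fun t => f (1 - t)) y x.
Proof.
move=> [cf f0 f1]; split; first by cts.
- by move=> t t0; apply: f1; lra.
- by move=> t t0; apply: f0; lra.
Qed.

Lemma fpath_pc f g x y z : fpath f x y -> fpath g y z -> fpath (pc f g) x z.
Proof.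
move=> [cf f0 f1] [cg g0 g1]; split.
- by apply: continuous_pc => //; rewrite f1// g0.
- by move=> t t0; rewrite /pc ifT ?f0//; lra.
- by move=> t t1; rewrite /pc ifF ?g1//; [lra|apply/negbTE; rewrite -ltNge; lra].
Qed.

Definition conn A x y := exists2 f, fpath f x y & forall t, A (f t).

Lemma conn_refl A x : A x -> conn A x x.
Proof. by move=> Ax; exists (fun=> x) => //; exact: fpath_cst. Qed.

Lemma conn_sym A x y : conn A x y -> conn A y x.
Proof. by move=> [f fxy fA]; exists (fun t => f (1 - t)) => //; exact: fpath_rev. Qed.

Lemma conn_trans A x y z : conn A x y -> conn A y z -> conn A x z.
Proof.
move=> [f fxy fA] [g gyz gA]; exists (pc f g); first exact: fpath_pc fxy gyz.
by move=> t; rewrite /pc; case: ifP.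
Qed.

Lemma conn_sub A B x y : A `<=` B -> conn A x y -> conn B x y.
Proof. by move=> AB [f fxy fA]; exists f => // t; exact: AB. Qed.

Lemma conn_ends A x y : conn A x y -> A x /\ A y.
Proof. by move=> [f /fpath01[<- <-] fA]. Qed.

Lemma conn_fun A f s t : continuous f -> (forall r, A (f r)) -> conn A (f s) (f t).
Proof. by move=> cf Af; exists (fun r => f (s + clamp_real r * (t - s))); [exact: fpath_sub|]. Qed.

Lemma conn_image A x y f : fpath f x y -> (forall t, A (f t)) -> forall t, conn A x (f t).
Proof. by move=> fxy Af t; have [<- _] := fpath01 fxy; case: fxy => cf _ _; exact: conn_fun. Qed.

Lemma path_componentE A x y : path_component R A x y <-> conn A x y.
Proof.
split=> [[p pA]|[f fxy fA]].
  by exists (fun t => p (clamp t)); [exact: fpath_path|move=> t; apply: pA; exists (clamp t)].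
have [f0 f1] := fpath01 fxy; have [cf _ _] := fxy.
have [p pE] := path_fun cf f0 f1.
by exists p => _ [u _ <-]; rewrite pE.
Qed.

End topological.

Section path_diameter.
Context (X : metricType R) (pdm : path_diameter_metric X).

(** The form in which the hypothesis on the metric is used: nearby points are joined by a path that
    stays small. *)
Lemma short_path (a b : X) (e : R) : 0 < e ->
  exists2 f, fpath f a b & forall s t, mdist (f s) (f t) < mdist a b + e.
Proof.
move=> e0; have : (ereal_inf [set diam (range p) | p in [set: {path unit_interval R from a to b}]]
    < (mdist a b + e)%:E)%E by rewrite -pdm lte_fin ltrDl.
move=> /ereal_inf_lt [_ [p _ <-] dp]; exists (fun t => p (clamp t)); first exact: fpath_path.
move=> s t; rewrite -lte_fin; apply: le_lt_trans dp; apply: ereal_sup_ubound.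
by exists (p (clamp s), p (clamp t)); first by split; [exists (clamp s)|exists (clamp t)].
Qed.

End path_diameter.
End fpath.

Section tree_graded.
Context (R : realType) (X : metricType R) (P : set (set X)).
Hypotheses (pdm : path_diameter_metric X) (tg : disjointly_tree_graded P).
Implicit Types (A B : set X) (f : R -> X) (x y z : X).

Lemma ex_fpath x y : exists f : R -> X, fpath f x y.
Proof.
have [_ /(_ x y I I) /path_componentE [f fxy _]] := dtg_path_connected tg.
by exists f.
Qed.

Lemma piece_component A y : P A -> A y -> forall z, A z <-> conn R (Pc P) y z.
Proof.
move=> PA; have : path_components R (Pc P) A by rewrite -(dtg_pieces tg).
move=> [x Px <-] /path_componentE + z; rewrite path_componentE.
by move=> xy; split=> h; [exact: conn_trans (conn_sym xy) h|exact: conn_trans xy h].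
Qed.

Lemma piece_eq A B y : P A -> P B -> A y -> B y -> A = B.
Proof.
move=> PA PB Ay By; apply/seteqP; split => z.
  by move=> /(piece_component PA Ay) /(piece_component PB By).
by move=> /(piece_component PB By) /(piece_component PA Ay).
Qed.

Lemma piece_path A y z : P A -> A y -> A z -> conn R A y z.
Proof.
move=> PA Ay /(piece_component PA Ay) [f fyz fP]; exists f => // t.
apply/(piece_component PA Ay); exact: (conn_image fyz fP).
Qed.

Lemma conn_piece y z : conn R (Pc P) y z -> exists2 A, P A & A y /\ A z.
Proof.
move=> yz; have [[A PA Ay] _] := conn_ends yz; exists A => //.
by split => //; apply/(piece_component PA Ay).
Qed.

(* An arc together with a path between its end points that misses an interior point
   of the arc contain a simple closed curve, which lies in a single piece. *)
Lemma arc_path_piece (a b : R -> X) (s0 : R) :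
  continuous a -> (forall r s : R, 0 <= r <= 1 -> 0 <= s <= 1 -> a r = a s -> r = s) ->
  fpath b (a 0) (a 1) -> 0 <= s0 <= 1 -> (forall t, b t <> a s0) ->
  exists u v B, [/\ P B, u < s0 < v, forall s, u <= s <= v -> B (a s) & exists t, b t = a u].
Proof.
move=> ca ainj bab s01 bs0; have [b0 b1] := fpath01 bab; have [cb _ _] := bab.
pose S := [set s | exists2 t, 0 <= t <= 1 & b t = a s].
have cS : closed S.
  have -> : S = a @^-1` (b @` [set` `[0, 1]]).
    apply/seteqP; split=> s /=; first by move=> [t t01 bt]; exists t => //=; rewrite in_itv.
    by move=> [t /=]; rewrite in_itv /= => t01 bt; exists t.
  move/continuous_closedP: ca; apply; apply: compact_closed; first exact: metric_hausdorff.
  by apply: continuous_compact; [exact: continuous_subspaceT|exact: segment_compact].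
have S0 : S 0 by exists 0; rewrite ?lexx ?ler01.
have S1 : S 1 by exists 1; rewrite ?lexx ?ler01.
have nS : ~ S s0 by move=> [t _]; exact: bs0.
have /andP[s00 s11] := s01.
(* The open arc between [a u] and [a v] is not met by [b]. The part of [b] that connects these two
   points may intersect itself, so it is replaced by an arc [g] in its image, which closes the arc
   to a simple closed curve. *)
have [u [Su u0 us uP]] := last_before cS S0 s00.
have [v [Sv v1 sv vP]] := first_after cS S1 s11.
have us' : u < s0 by rewrite lt_neqAle us andbT; apply/eqP => us'; apply: nS; rewrite -us'.
have sv' : s0 < v by rewrite lt_neqAle sv andbT; apply/eqP => us''; apply: nS; rewrite us''.
have [t1 t101 bt1] := Su; have [t2 t201 bt2] := Sv.
pose b' r := b (t2 + clamp_real r * (t1 - t2)).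
have [cb' b'0 b'1] : fpath b' (b t2) (b t1) := fpath_sub t2 t1 cb.
have [|||g [cg g0 g1 gb ginj]] := @arc_in_path R X b' cb'.
- by move=> t t0; rewrite !b'0.
- by move=> t t0; rewrite !b'1.
- rewrite b'0// b'1// bt1 bt2 => /ainj h.
  have e : v = u by apply: h; lra.
  by lra.
rewrite b'0// bt2 in g0; rewrite b'1// bt1 in g1.
pose h := pc (sub a u v) g.
have gS (x w : R) : g x = a w -> S w.
  have [t t01 ->] := gb x; rewrite /b' => bw; exists (t2 + clamp_real t * (t1 - t2)) => //.
  by rewrite clampr_id//; nra.
have mixed (x y : R) : 0 <= x <= 2^-1 -> 2^-1 < y <= 1 -> h x = h y -> x = 0 /\ y = 1.
  move=> /andP[x0 x1] /andP[y0 y1]; rewrite /h /pc x1 leNgt y0 /= /sub.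
  set w := u + _ => e; have Sw : S w := gS _ _ (esym e).
  have wuv : u <= w <= v by rewrite /w; apply/andP; split; nra.
  case/andP: (wuv) => uw wv'.
  have i1 : 0 <= 2 * y - 1 <= 1 by lra.
  case: (lerP w s0) => ws.
    have wu : w = u by apply/eqP; rewrite eq_le uP//; lra.
    have x00 : x = 0 by move: wu; rewrite /w; nra.
    have : 2 * y - 1 = 1 by apply: ginj => //; [lra|rewrite g1 -e wu].
    by split => //; lra.
  have wv : w = v by apply/eqP; rewrite eq_le vP ?(ltW ws)//; lra.
  have : 2 * y - 1 = 0 by apply: ginj => //; [lra|rewrite g0 -e wv].
  by lra.
have scc : simple_closed_curve R [set h t | t in [set t | 0 <= t <= 1]].
  apply: simple_closed_curve_of_loop.
  - by apply: continuous_pc => //; [exact: continuous_sub|rewrite sub1 g0].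
  - by rewrite /h pc0 pc1 sub0 g1.
  move=> s t /andP[s_0 s_1] /andP[t_0 t_1].
  case: (lerP s 2^-1) => sh; case: (lerP t 2^-1) => th.
  - rewrite /h /pc sh th /sub => /ainj e; apply: Or31.
    have : u + 2 * s * (v - u) = u + 2 * t * (v - u) by apply: e; apply/andP; split; nra.
    nra.
  - by move=> e; apply: Or32; apply: mixed e; rewrite ?s_0 ?th.
  - by move=> /esym e; have [-> ->] := mixed t s (introT andP (conj t_0 th))
      (introT andP (conj sh s_1)) e; exact: Or33.
  - rewrite /h /pc !leNgt sh th /= => /ginj e; apply: Or31.
    have : 2 * s - 1 = 2 * t - 1 by apply: e; lra.
    lra.
have [B PB CB] := dtg_simple_closed_curve tg scc.
exists u, v, B; split => //; [by rewrite us'| |by exists t1].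
move=> s /andP[us1 sv1]; apply: CB; exists ((s - u) / (2 * (v - u))) => /=.
  by rewrite divr_ge0 ?ler_pdivrMr ?mul1r//=; lra.
have e : 2 * ((s - u) / (2 * (v - u))) * (v - u) = s - u.
  by rewrite mulrAC mulrC divfK// mulf_neq0//; lra.
rewrite /h /pc ifT; last by rewrite ler_pdivrMr; lra.
by rewrite /sub e addrC subrK.
Qed.

(** An arc from [p] to [q] leaves Pc(X), as otherwise [p] and [q] are in one piece, and it does so
    at an interior point since Pc(X) is closed. A path avoiding this point would put it in a piece
    by [arc_path_piece]. *)
Lemma cut_point p q : p <> q -> ~ (exists2 A, P A & A p /\ A q) ->
  exists x, [/\ ~ Pc P x, x <> p, x <> q & forall f, fpath f p q -> exists t, f t = x].
Proof.
move=> pq npq; have [f fpq] := ex_fpath p q; have [f0 f1] := fpath01 fpq.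
have [cf f0' f1'] := fpq.
have [|||a [ca a0 a1 _ ainj]] := @arc_in_path R X f cf.
- by move=> t t0; rewrite !f0'.
- by move=> t t0; rewrite !f1'.
- by rewrite f0 f1.
have i0 : 0 <= (0 : R) <= 1 by rewrite lexx ler01.
have i1 : 0 <= (1 : R) <= 1 by rewrite lexx ler01.
have [s1 s101 ns1] : exists2 s, 0 <= s <= 1 & ~ Pc P (a s).
  apply: contrapT => h; apply: npq; apply: conn_piece.
  exists (fun t => a (clamp_real t)).
    split; first by cts.
      by move=> t t0; rewrite clampr_le0// a0 f0.
    by move=> t t0; rewrite clampr_ge1// a1 f1.
  by move=> t; apply: contrapT => nt; apply: h; exists (clamp_real t) => //; exact: clampr_itv.
have cPa : closed (a @^-1` (Pc P)).
  by move/continuous_closedP: ca; apply; exact: dtg_Pc_closed tg.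
have [d d0 dP] := closed_out cPa ns1.
have [s0 s00 ns0] : exists2 s, 0 < s < 1 & ~ Pc P (a s).
  pose m := Num.min (d / 2) (1 / 2).
  have m0 : 0 < m by rewrite lt_min; lra.
  have [md m2] : m <= d / 2 /\ m <= 1 / 2 by rewrite /m !ge_min !lexx orbT.
  case: (lerP s1 (1 / 2)) => s1h.
    exists (s1 + m / 2); first lra.
    by apply: dP; rewrite ltr_norml; lra.
  exists (s1 - m / 2); first lra.
  by apply: dP; rewrite ltr_norml; lra.
have i (s : R) : 0 < s < 1 -> 0 <= s <= 1 by lra.
exists (a s0); split => //.
- by rewrite -f0 -a0 => /(ainj _ _ (i _ s00) i0) h; move: s00; rewrite h ltxx.
- by rewrite -f1 -a1 => /(ainj _ _ (i _ s00) i1) h; move: s00; rewrite h ltxx andbF.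
move=> b bpq; apply: contrapT => nb.
have [||u [v [B [PB us B_a _]]]] := @arc_path_piece a b s0 ca ainj _ (i _ s00).
- by rewrite a0 a1 f0 f1.
- by move=> t bt; apply: nb; exists t.
by apply: ns0; exists B => //; apply: B_a; lra.
Qed.

End tree_graded.

(** * The signed distance to a cut point *)

Section cut_function.
Context (R : realType) (X : metricType R) (P : set (set X)).
Hypotheses (pdm : path_diameter_metric X) (tg : disjointly_tree_graded P).
Context (p x : X) (xp : x <> p) (nx : ~ Pc P x).

Lemma far_Pc : exists2 r : R, 0 < r & forall y, Pc P y -> r <= mdist y x.
Proof.
have : nbhs x (~` Pc P).
  by apply: open_nbhs_nbhs; split => //; apply: closed_openC; exact: dtg_Pc_closed tg.
move=> /nbhs_ballP [r /= r0 rP]; exists r => // y Py; rewrite leNgt; apply/negP => yx.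
by apply: (rP y) => //; rewrite ballEmdist /= metric_sym.
Qed.

(* The signed distance to the cut point [x], positive on the side of [p] and
   truncated so as to be constant on the pieces. *)
Lemma cut_function : exists (phi : X -> R) (r : R), [/\ 0 < r,
  forall y z, `|phi y - phi z| <= 2 * mdist y z,
  forall A y z, P A -> A y -> A z -> phi y = phi z &
  forall y d, d <= r -> `|phi y| < d -> mdist y x < d] /\
  [/\ phi x = 0, 0 < phi p &
    forall q, q <> x -> (forall f : R -> X, fpath f p q -> exists t, f t = x) -> phi q < 0].
Proof.
have [r r0 rP] := far_Pc.
pose S y := conn R (~` [set x]) p y.
pose m y := Num.min r (mdist y x).
pose phi y := if `[< S y >] then m y else - m y.
have m0 y : 0 <= m y by rewrite le_min (ltW r0) mdist_ge0.
have mlt y : y <> x -> 0 < m y.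
  by move=> yx; rewrite lt_min r0 mdist_gt0; apply/eqP.
have absphi y : `|phi y| = m y.
  by rewrite /phi; case: ifP => _; rewrite ?normrN ger0_norm.
have m_lip y z : m y <= m z + mdist y z.
  have h := metric_triangle y z x; have h0 := mdist_ge0 y z.
  by rewrite /m; case: (lerP r (mdist y x)) => ?; case: (lerP r (mdist z x)) => ?; lra.
(* A short path from one side to the other passes through [x], so both distances to [x] are at most
   [mdist y z]; their sum causes the Lipschitz constant 2. *)
have cross y z : S y -> ~ S z -> mdist y x <= mdist y z /\ mdist z x <= mdist y z.
  move=> Sy nSz; have hit e : 0 < e -> mdist y x < mdist y z + e /\ mdist z x < mdist y z + e.
    move=> e0; have [f fyz fd] := short_path pdm y z e0; have [f0 f1] := fpath01 fyz.
    have [t ft] : exists t, f t = x.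
      apply: contrapT => nt; apply: nSz; apply: conn_trans Sy _; exists f => // t ft.
      by apply: nt; exists t.
    by have := fd 0 t; have := fd 1 t; rewrite f0 f1 ft.
  by split; apply/ler_addgt0Pl => e /hit [h1 h2]; rewrite addrC ltW.
exists phi, r; split; split => //.
- move=> y z; have := mdist_ge0 y z => d0.
  have m1 := m_lip y z; have m2 := m_lip z y; rewrite (metric_sym z y) in m2.
  have mx w : m w <= mdist w x by rewrite ge_min lexx orbT.
  have my := mx y; have mz := mx z; have m0y := m0 y; have m0z := m0 z.
  rewrite /phi; case: asboolP => Sy; case: asboolP => Sz; rewrite ler_norml; apply/andP.
  + by split; lra.
  + by have [h1 h2] := cross _ _ Sy Sz; split; lra.
  + by have [h1 h2] := cross _ _ Sz Sy; rewrite (metric_sym z y) in h1 h2; split; lra.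
  + by split; lra.
- move=> A y z PA Ay Az; have Pyz w : A w -> Pc P w by exists A.
  have my : m y = m z by rewrite /m !(min_idPl _)//; exact/rP/Pyz.
  have yz : conn R (~` [set x]) y z.
    apply: conn_sub (piece_path tg PA Ay Az) => w Aw /= wx.
    by apply: nx; rewrite -wx; exact: Pyz.
  rewrite /phi my; congr (if _ then _ else _); apply/asboolP/asboolP => h.
    exact: conn_trans h yz.
  exact: conn_trans h (conn_sym yz).
- by move=> y d dr; rewrite absphi /m gt_min => /orP[|//]; lra.
- by apply/eqP; rewrite -normr_eq0 absphi /m mdistxx (min_idPr (ltW r0)).
- rewrite /phi ifT; first by apply: mlt => px; exact: xp.
  by apply/asboolP/conn_refl => px; exact: xp.
- move=> q qx hq; rewrite /phi ifF ?oppr_lt0; first exact: mlt.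
  by apply/asboolP => -[f fpq fx]; have [t ft] := hq _ fpq; exact: fx ft.
Qed.

End cut_function.

(** * The retraction onto a piece *)

Section retraction.
Context (R : realType) (X : metricType R) (P : set (set X)).
Hypotheses (pdm : path_diameter_metric X) (tg : disjointly_tree_graded P).
Context (A : set X) (PA : P A).

Definition hits y z := A z /\ exists2 f : R -> X, fpath f y z & forall t, A (f t) -> f t = z.

Lemma first_hit (f : R -> X) y w t0 : fpath f y w -> 0 <= t0 <= 1 -> A (f t0) ->
  exists t, hits y (f t).
Proof.
move=> fyw t01 At0; have [cf f0 f1] := fyw; have /andP[t00 _] := t01.
have cA : closed (f @^-1` A).
  by move/continuous_closedP: cf; apply; exact: dtg_piece_closed tg _ PA.
have [t [At tt0 t0' tP]] := first_after cA (k0 := t0) (t := 0) At0 t00.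
exists t; split => //; exists (fun r => f (0 + clamp_real r * (t - 0))).
  by have := fpath_sub 0 t cf; rewrite (f0 0).
move=> r Ar; have := tP _ Ar; rewrite add0r subr0.
have /andP[c0 c1] := clampr_itv r => h.
have -> : clamp_real r * t = t by apply/eqP; rewrite eq_le; apply/andP; split; [nra|apply: h; nra].
by [].
Qed.

Lemma hits_exists y : exists z, hits y z.
Proof.
have [a Aa] := dtg_piece_nonempty tg PA.
have [f fya] := ex_fpath tg y a; have [f0 f1] := fpath01 fya.
by have [||t ht] := first_hit (t0 := 1) fya; [rewrite ler01 lexx|rewrite f1|exists (f t)].
Qed.

(** Otherwise the two paths together contain an arc from [z] to [z'] whose mid point is not in [A].
    A path from [z] to [z'] in [A] misses that point, so by [arc_path_piece] the mid point lies in a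
    piece that meets [A], hence in [A]. *)
Lemma hits_unique y z z' : hits y z -> hits y z' -> z = z'.
Proof.
move=> [Az [f fyz fA]] [Az' [f' fyz' fA']]; apply: contrapT => zz'.
pose b := pc (fun t => f (1 - t)) f'.
have bz : fpath b z z' := fpath_pc (fpath_rev fyz) fyz'.
have bA t : A (b t) -> b t = z \/ b t = z'.
  by rewrite /b /pc; case: ifP => _ /[dup] h; [move=> /fA|move=> /fA']; [left|right].
have [b0 b1] := fpath01 bz; have [cb b0' b1'] := bz.
have [|||a [ca a0 a1 ab ainj]] := @arc_in_path R X b cb.
- by move=> t t0; rewrite !b0'.
- by move=> t t1; rewrite !b1'.
- by rewrite b0 b1.
rewrite b0 in a0; rewrite b1 in a1.
have i0 : 0 <= (0 : R) <= 1 by rewrite lexx ler01.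
have i1 : 0 <= (1 : R) <= 1 by rewrite lexx ler01.
have ih : 0 <= (2^-1 : R) <= 1 by lra.
have nA : ~ A (a 2^-1).
  have [t _ E] := ab 2^-1; rewrite E => /bA; rewrite -E -a0 -a1.
  by case=> /ainj h; [have : 2^-1 = 0 :> R by exact: h|have : 2^-1 = 1 :> R by exact: h]; lra.
have [c cz cA] := piece_path tg PA Az Az'.
have [||u [v [B [PB us Ba [t ct]]]]] := arc_path_piece tg ca ainj (b := c) (s0 := 2^-1) _ ih.
- by rewrite a0 a1.
- by move=> t ct; apply: nA; rewrite -ct.
apply: nA; have -> : A = B.
  by apply: (piece_eq tg PA PB (y := a u)); [rewrite -ct|apply: Ba; lra].
by apply: Ba; lra.
Qed.

Definition retr y := sval (cid (hits_exists y)).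

Lemma retrP y : hits y (retr y). Proof. exact: svalP (cid (hits_exists y)). Qed.

Lemma retr_in y : A (retr y). Proof. by have [] := retrP y. Qed.

Lemma retr_hits y z : hits y z -> retr y = z.
Proof. exact: hits_unique (retrP y). Qed.

Lemma retr_id y : A y -> retr y = y.
Proof.
move=> Ay; apply: retr_hits; split => //; exists (fun=> y) => //; exact: fpath_cst.
Qed.

Lemma retr_miss y z : conn R (~` A) y z -> retr y = retr z.
Proof.
move=> /conn_sym [f fzy fA]; apply/esym/retr_hits; split; first exact: retr_in.
have [_ [g gy gA]] := retrP y; exists (pc f g); first exact: fpath_pc fzy gy.
by move=> t; rewrite /pc; case: ifP => _; [move=> /fA|move=> /gA].
Qed.

Lemma retr_piece B y z : P B -> B <> A -> B y -> B z -> retr y = retr z.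
Proof.
move=> PB BA By Bz; apply: retr_miss; apply: conn_sub (piece_path tg PB By Bz) => w Bw Aw.
by apply: BA; exact: piece_eq tg _ _ w PB PA Bw Aw.
Qed.

(** On a short path from [y] to [z], the first and the last point in [A] are the two retractions; if
    the path misses [A], the retractions coincide. *)
Lemma retr_lip y z : mdist (retr y) (retr z) <= mdist y z.
Proof.
apply/ler_addgt0Pl => e e0; rewrite addrC.
have [f fyz fd] := short_path pdm y z e0; have [f0 f1] := fpath01 fyz.
have [[t t01 At]|nA] := pselect (exists2 t, 0 <= t <= 1 & A (f t)).
  have [t1 /retr_hits ->] := first_hit fyz t01 At.
  have [||t2 /retr_hits ->] := first_hit (t0 := 1 - t) (fpath_rev fyz).
  - lra.
  - by rewrite opprB addrC subrK.
  exact/ltW/fd.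
rewrite (retr_miss (y := y) (z := z)) ?mdistxx ?addr_ge0 ?mdist_ge0 ?ltW//.
have [cf f0' f1'] := fyz.
exists f => // t At; apply: nA; exists (clamp_real t); first exact: clampr_itv.
case: (lerP t 0) => t0; first by rewrite clampr_le0// f0 -(f0' t).
case: (lerP 1 t) => t1; first by rewrite clampr_ge1// f1 -(f1' t).
by rewrite clampr_id// !ltW.
Qed.

Lemma continuous_retr : continuous retr.
Proof.
move=> y U /nbhs_ballP [e /= e0 eU]; apply/nbhs_ballP; exists e => //= z.
rewrite ballEmdist /= => yz; apply: eU; rewrite ballEmdist /=.
exact: le_lt_trans (retr_lip y z) yz.
Qed.

End retraction.

(** * Lipschitz maps that descend to the collapsed spaces *)

Section descent.
Context (R : realType) (X : metricType R) (P Q : set (set X)) (V : pseudoMetricType R).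
Context (D : V -> V -> R) (C : R) (k : X -> V).
Hypotheses (Dball : forall v w e, D v w < e -> ball v e w) (Dxx : forall v, D v v = 0)
  (Dtri : forall u v w, D u w <= D u v + D v w) (C0 : 0 < C)
  (klip : forall y z, D (k y) (k z) <= C * mdist y z)
  (kconst : forall A y z, P A -> ~ Q A -> A y -> A z -> k y = k z).

(** [D] is kept explicit in order to cover both [mdist] on [X], for retractions, and the absolute
    value on [R], for cut functions. *)
Definition descend (y : collapse P Q) : V := k (repr y).

Lemma kGamma y z : Gamma P Q y = Gamma P Q z -> k y = k z.
Proof.
rewrite GammaP; elim=> [a b [A [PA QA] [Aa Ab]]|//|a b _ -> //|a b c _ -> _ -> //].
exact: kconst Aa Ab.
Qed.

Lemma descendE y : descend (Gamma P Q y) = k y.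
Proof. by apply: kGamma; rewrite Gamma_repr. Qed.

Lemma descend_lip y z : D (descend y) (descend z) <= C * rho y z.
Proof.
rewrite -ler_pdivrMl//; apply: lb_le_inf; first by case: (has_inf_chain_lengths y z).
move=> _ [n [a [b [[ay bz ab] ->]]]]; rewrite ler_pdivrMl// -ay -bz !descendE.
rewrite /chain_length; elim: n ab {bz} => [|n IH] ab; first by rewrite big_ord1.
rewrite big_ord_recr /= mulrDr.
apply: le_trans (Dtri _ (k (b n)) _) _; apply: lerD.
  by apply: IH => i ni; apply: ab; exact: ltnW.
by rewrite (kGamma (ab n (ltnSn n))).
Qed.

Lemma continuous_descend : continuous descend.
Proof.
move=> y U /nbhs_ballP [e /= e0 eU]; apply/nbhs_ballP; exists (C^-1 * e) => /=.
  by rewrite mulr_gt0// invr_gt0.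
move=> z; rewrite collapse_ballE /= => yz; apply/eU/Dball.
by apply: le_lt_trans (descend_lip y z) _; rewrite -ltr_pdivlMl.
Qed.

End descent.

(** * Laminar families of chords *)

Section laminar.
Context (R : realType) (G : R -> R -> Prop).
Hypothesis G01 : G 0 1.
Hypotheses (Gclosed : forall s t, (forall e, 0 < e ->
  exists s' t', [/\ `|s - s'| < e, `|t - t'| < e & G s' t']) -> G s t).
Implicit Types (c : R * R) (C : set (R * R)).

Definition cross c c' := [/\ c.1 < c'.1, c'.1 < c.2 & c.2 < c'.2].

Definition is_chord c := [/\ 0 <= c.1, c.1 <= c.2, c.2 <= 1 & G c.1 c.2].

Definition laminar C := (forall c, C c -> is_chord c) /\
  forall c c', C c -> C c' -> ~ cross c c'.

Lemma maximal_laminar : exists C, laminar C /\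
  forall c, is_chord c -> (forall c', C c' -> ~ cross c c' /\ ~ cross c' c) -> C c.
Proof.
have [F FP Ftot|C [lC mC]] := @Zorn_bigcup _ laminar.
  split; first by move=> c [C FC Cc]; exact: (FP _ FC).1 Cc.
  move=> c c' [C FC Cc] [C' FC' Cc'].
  case: (Ftot _ _ FC FC') => sub; first by apply: (FP _ FC').2 => //; exact: sub.
  by apply: (FP _ FC).2 => //; exact: sub.
exists C; split => // c hc nc; apply: contrapT => nCc.
have sub : C `<` C `|` [set c].
  by split=> [|h]; [exact: subsetUl|apply: nCc; apply: h; right].
apply: (mC _ sub); split.
  by move=> c' [Cc'|->//]; exact: lC.1.
move=> c1 c2 [C1|->] [C2|->]; first exact: lC.2.
- by have [] := nc _ C1.
- by have [] := nc _ C2.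
- by move=> [/lt_trans h /h]; rewrite ltxx.
Qed.

Context (C : set (R * R)) (lC : laminar C)
  (mC : forall c, is_chord c -> (forall c', C c' -> ~ cross c c' /\ ~ cross c' c) -> C c).

Lemma chord01 : C (0, 1).
Proof.
apply: mC; first by split; rewrite ?ler01.
by move=> c' /lC.1 [c0 _ c1 _]; split; move=> [] /=; lra.
Qed.

(** Crossing is an open condition, so a limit of chords crosses no chord, and maximality makes it a
    member. *)
Lemma chord_limit c : (forall e, 0 < e -> exists c', [/\ C c',
  `|c.1 - c'.1| < e & `|c.2 - c'.2| < e]) -> C c.
Proof.
move=> h; apply: mC.
  have near (P : R * R -> R) : (forall c', C c' -> 0 <= P c') ->
     (forall c' e, `|c.1 - c'.1| < e -> `|c.2 - c'.2| < e -> P c' <= P c + 2 * e) -> 0 <= P c.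
    move=> P0 Pe; rewrite leNgt; apply/negP => Pc; have e0 : 0 < - P c / 4 by lra.
    by have [c' [/P0 c'0 c1 c2]] := h _ e0; have := Pe _ _ c1 c2; lra.
  split.
  - apply: (near (fun c => c.1)); first by move=> c' /lC.1 [].
    by move=> c' e; rewrite ltr_norml => ? ?; lra.
  - rewrite -subr_ge0; apply: (near (fun c => c.2 - c.1)); first by move=> c' /lC.1 [] *; lra.
    by move=> c' e; rewrite !ltr_norml => ? ?; lra.
  - rewrite -subr_ge0; apply: (near (fun c => 1 - c.2)); first by move=> c' /lC.1 [] *; lra.
    by move=> c' e _; rewrite !ltr_norml => ?; lra.
  - by apply: Gclosed => e /h [c' [/lC.1 [_ _ _ g] c1 c2]]; exists c'.1, c'.2.
have sep (x y z w : R) : x < y -> y < z -> z < w ->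
    exists2 e, 0 < e & e < y - x /\ (e < z - y /\ e < w - z).
  move=> xy yz zw; exists (Num.min (y - x) (Num.min (z - y) (w - z)) / 2).
    by rewrite divr_gt0// !lt_min; lra.
  have : 0 < Num.min (y - x) (Num.min (z - y) (w - z)) by rewrite !lt_min; lra.
  set m := Num.min _ _ => m0; have : m / 2 < m by lra.
  by rewrite {2}/m !lt_min => /and3P[].
move=> d Cd; split=> -[h1 h2 h3].
  have [e e0 [e1 [e2 e3]]] := sep _ _ _ _ h1 h2 h3.
  have [c' [Cc' c1 c2]] := h _ e0; apply: (lC.2 _ _ Cc' Cd).
  by move: c1 c2; rewrite !ltr_norml => c1 c2; split; lra.
have [e e0 [e1 [e2 e3]]] := sep _ _ _ _ h1 h2 h3.
have [c' [Cc' c1 c2]] := h _ e0; apply: (lC.2 _ _ Cd Cc').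
by move: c1 c2; rewrite !ltr_norml => c1 c2; split; lra.
Qed.

Definition encloses c u v := c.1 <= u /\ v <= c.2.

(** As [u < v], two chords around both times overlap, so they are nested; the intersection of all of
    them is a limit of chords. *)
Lemma minimal_chord u v : 0 <= u -> u < v -> v <= 1 -> exists c, [/\ C c, encloses c u v &
  forall c', C c' -> encloses c' u v -> encloses c' c.1 c.2].
Proof.
move=> u0 uv v1; pose E c := C c /\ encloses c u v.
have E01 : E (0, 1) by split; [exact: chord01|split].
pose A := [set c.1 | c in E]; pose B := [set c.2 | c in E].
have hA : has_sup A by split; [exists 0, (0, 1)|exists u => _ [c [_ [cu _]] <-]].
have hB : has_inf B by split; [exists 1, (0, 1)|exists v => _ [c [_ [_ cv]] <-]].
have sA c : E c -> c.1 <= sup A by move=> Ec; apply: sup_upper_bound => //; exists c.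
have iB c : E c -> inf B <= c.2 by move=> Ec; apply: ge_inf; [case: hB|exists c].
have Au : sup A <= u by apply: ge_sup; [case: hA|move=> _ [c [_ [cu _]] <-]].
have Bv : v <= inf B by apply: lb_le_inf; [case: hB|move=> _ [c [_ [_ cv]] <-]].
exists (sup A, inf B); split => //=; last by move=> c' Cc' ec'; split; [apply: sA|apply: iB].
apply: chord_limit => e e0 /=.
have [_ [c1 Ec1 <-] h1] := sup_adherent e0 hA; have [_ [c2 Ec2 <-] h2] := inf_adherent e0 hB.
have s1 := sA _ Ec1; have s2 := sA _ Ec2; have i1 := iB _ Ec1; have i2 := iB _ Ec2.
case: (lerP c1.2 c2.2) => c12.
  by exists c1; rewrite !ltr_norml; split; [by case: Ec1|lra|lra].
have : c1.1 <= c2.1.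
  rewrite leNgt; apply/negP => c21; apply: (lC.2 _ _ Ec2.1 Ec1.1).
  by split => //; apply: le_lt_trans (lt_le_trans uv _); [case: Ec1 => _ []|case: Ec2 => _ []].
by exists c2; rewrite !ltr_norml; split; [by case: Ec2|lra|lra].
Qed.

Definition proper c' c := [/\ C c', encloses c c'.1 c'.2 & c' <> c].

(** Times outside [c] are included, so that all gaps lie inside [c] and the results on closed sets
    containing both half-lines apply. *)
Definition core c t := forall c', proper c' c -> ~ (c'.1 < t < c'.2).

Lemma core_closed c : closed (core c).
Proof.
rewrite -[core c]setCK; apply: open_closedC.
have -> : ~` core c = \bigcup_(c' in proper^~ c) [set` `]c'.1, c'.2[].
  apply/seteqP; split => t.
    move=> nt; apply: contrapT => h; apply: nt => c' pc' ct; apply: h.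
    by exists c' => //=; rewrite in_itv.
  by move=> [c' pc']; rewrite /= in_itv /= => ct h; exact: h ct.
by apply: bigcup_open => c' _; exact: interval_open.
Qed.

Lemma core_left c t : t <= c.1 -> core c t.
Proof. by move=> tc c' [_ [c1 _] _] /andP[]; lra. Qed.

Lemma core_right c t : c.2 <= t -> core c t.
Proof. by move=> tc c' [_ [_ c2] _] /andP[]; lra. Qed.

Lemma core_gap_in c p q : c.1 <= c.2 -> gap (core c) p q -> c.1 <= p /\ q <= c.2.
Proof.
move=> c12 [Kp Kq pq inner]; split; rewrite leNgt; apply/negP => h.
  apply: (inner ((p + Num.min q c.1) / 2)).
    have : p < Num.min q c.1 by rewrite lt_min pq.
    have : Num.min q c.1 <= q by rewrite ge_min lexx.
    lra.
  apply: core_left; have : Num.min q c.1 <= c.1 by rewrite ge_min lexx orbT.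
  lra.
apply: (inner ((q + Num.max p c.2) / 2)).
  have : Num.max p c.2 < q by rewrite gt_max pq.
  have : p <= Num.max p c.2 by rewrite le_max lexx.
  lra.
apply: core_right; have : c.2 <= Num.max p c.2 by rewrite le_max lexx orbT.
lra.
Qed.

(** The gap is covered by proper subchords. Overlapping ones do not cross, so they are nested, and
    real induction along [u, v] finds one around the whole interval. *)
Lemma core_gap_proper c p q u v : gap (core c) p q -> p < u -> u <= v -> v < q ->
  exists2 c', proper c' c & c'.1 < u /\ v < c'.2.
Proof.
move=> [Kp Kq pq inner] pu uv vq.
have out x : p < x < q -> exists2 c', proper c' c & c'.1 < x /\ x < c'.2.
  move=> /inner nK; apply: contrapT => h; apply: nK => c' pc' /andP[c1 c2].
  by apply: h; exists c'.
pose T x := exists2 c', proper c' c & c'.1 < u /\ x < c'.2.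
apply: (@real_induction _ u v T) => //; last by rewrite uv lexx.
- by apply: out; lra.
- move=> x /andP[ux xv] /(_ x) []; first by rewrite ux lexx.
  move=> c' pc' [c1 c2]; exists (c'.2 - x); first by lra.
  by move=> y xy; exists c' => //; split => //; lra.
- move=> x /andP[ux xv] IH; have [|c2 pc2 [c21 c22]] := out x; first lra.
  case: (lerP u c2.1) => cu; last by exists c2.
  pose y := (c2.1 + x) / 2.
  have [|c1 pc1 [c11 c12]] := IH y; first by rewrite /y; lra.
  have yx : c2.1 < y < x by rewrite /y; lra.
  exists c1 => //; split => //; rewrite ltNge; apply/negP => c1x.
  have [C1 _ _] := pc1; have [C2 _ _] := pc2.
  by apply: (lC.2 _ _ C1 C2); split; lra.
Qed.

(** Subchords around [p + d, q - d] do not extend beyond [p, q], since [p] and [q] are core times;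
    for small [d] they approach (p, q). *)
Lemma core_gap_chord c p q : gap (core c) p q -> C (p, q).
Proof.
move=> g; have [Kp Kq pq inner] := g; apply: chord_limit => e e0 /=.
pose d := Num.min (e / 2) ((q - p) / 3).
have d0 : 0 < d by rewrite lt_min; lra.
have [de dq] : d <= e / 2 /\ d <= (q - p) / 3 by rewrite /d !ge_min !lexx orbT.
have [|||c' pc' [c1 c2]] := core_gap_proper (u := p + d) (v := q - d) g; try lra.
exists c'; have [Cc' _ _] := pc'.
have pc1 : p <= c'.1 by rewrite leNgt; apply/negP => h; apply: (Kp _ pc'); lra.
have qc2 : c'.2 <= q by rewrite leNgt; apply/negP => h; apply: (Kq _ pc'); lra.
by split => //; rewrite ltr_norml; lra.
Qed.

(** By maximality: a chord crossing (s, t) has [s] or [t] strictly inside, so it is not a proper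
    subchord of [c], and then it crosses [c]. *)
Lemma core_chord c s t : C c -> c.1 <= s -> s <= t -> t <= c.2 -> core c s -> core c t ->
  G s t -> C (s, t).
Proof.
move=> Cc cs st tc Ks Kt Gst; have [c0 _ c1 _] := lC.1 _ Cc.
apply: mC; first by split => //=; lra.
move=> c' Cc'; split=> -[/= h1 h2 h3].
- have [pc'|npc'] := pselect (proper c' c); first by apply: (Kt _ pc'); rewrite h2.
  case: (lerP c'.2 c.2) => h; last by apply: (lC.2 _ _ Cc Cc'); split; lra.
  by apply: npc'; split => //; [split; lra|move=> c'c; move: h1; rewrite c'c; lra].
- have [pc'|npc'] := pselect (proper c' c); first by apply: (Ks _ pc'); rewrite h1.
  case: (lerP c.1 c'.1) => h; last by apply: (lC.2 _ _ Cc' Cc); split; lra.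
  by apply: npc'; split => //; [split; lra|move=> c'c; move: h3; rewrite c'c; lra].
Qed.

Lemma core_no_chord c s t x : C c -> c.1 <= s -> t <= c.2 -> (s, t) <> c -> C (s, t) ->
  core c x -> ~ (s < x < t).
Proof. by move=> Cc cs tc nc Cst Kx; apply: (Kx (s, t)). Qed.

End laminar.

(** * Good pairs of times *)

Section good.
Context (R : realType) (X : metricType R) (P : set (set X)).
Hypotheses (pdm : path_diameter_metric X) (tg : disjointly_tree_graded P).
Context (a : R -> X).
Hypothesis (ca : continuous a).

Definition fin (F : set (set X)) := finite_set F /\ F `<=` P.

Lemma fin0 : fin set0. Proof. by split. Qed.

Lemma fin1 A : P A -> fin [set A].
Proof. by move=> PA; split; [exact: finite_set1|move=> _ ->]. Qed.

Lemma finU F F' : fin F -> fin F' -> fin (F `|` F').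
Proof.
move=> [f1 s1] [f2 s2]; split; first by rewrite finite_setU.
by move=> A [/s1|/s2].
Qed.

Definition proj (F : set (set X)) t := Gamma P F (a t).

Lemma continuous_proj F : continuous (proj F).
Proof. by apply: cont_comp => //; exact: continuous_Gamma. Qed.

Definition smallF F s t d := small (@rho R X P F) (proj F) s t d.

Definition good s t := forall F d, fin F -> 0 < d -> smallF F s t d.

Lemma smallF_sym F s t d : smallF F s t d -> smallF F t s d.
Proof. exact: small_sym. Qed.

Lemma smallF_tri F s t u d e : smallF F s t d -> smallF F t u e -> smallF F s u (d + e).
Proof. by apply: small_tri (@continuous_proj F); exact: rho_triangle. Qed.

Lemma smallF_osc F s t d : (forall x, Num.min s t <= x <= Num.max s t -> mdist (a s) (a x)
  < d / 2) ->
  smallF F s t d.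
Proof.
move=> h; apply: small_path; first exact: continuous_proj.
move=> x y /h hx /h hy; apply: le_lt_trans (rho_Gamma_le _ _ _ _) _.
by have := metric_triangle (a x) (a s) (a y); rewrite (metric_sym (a x) (a s)); lra.
Qed.

Lemma smallF_near F s d : 0 < d -> exists2 e, 0 < e & forall t, `|s - t| < e -> smallF F s t d.
Proof.
move=> d0; have d2 : 0 < d / 2 by lra.
have [e e0 eP] := (contP a).1 ca s _ d2; exists e => // t st.
apply: smallF_osc => x xst; have := eP x; rewrite ballEmdist; apply.
move: st xst; rewrite !ltr_norml ge_min le_max.
by move=> st /andP[/orP[] h1 /orP[] h2]; lra.
Qed.

(** Bonding maps do not increase [rho]. Conditions for finitely many [F] thus follow from the one
    for their union. *)
Lemma smallF_mono F F' s t d : F `<=` F' -> smallF F' s t d -> smallF F s t d.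
Proof.
move=> FF' [q [cq hq qd]]; exists (@Gamma_bond R X P _ _ FF' \o q); split.
- by apply: cont_comp => //; exact: continuous_Gamma_bond.
- have h := htp_map (B := setT) (@continuous_Gamma_bond R X P _ _ FF') (fun _ _ => I) hq.
  by apply: (htp_eq h) => // x _; rewrite /sub /proj /= Gamma_bondE.
- by move=> x y x01 y01; apply: le_lt_trans (rho_Gamma_bond_le _ _ _) (qd _ _ x01 y01).
Qed.

Lemma good_refl t : good t t.
Proof.
move=> F d fF d0; apply: smallF_osc => x; rewrite minxx maxxx => xt.
have -> : x = t by lra.
by rewrite mdistxx; lra.
Qed.

Lemma good_sym s t : good s t -> good t s.
Proof. by move=> st F d fF d0; apply: smallF_sym; exact: st. Qed.

Lemma good_limit s t : (forall F d e, fin F -> 0 < d -> 0 < e ->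
  exists s' t', [/\ `|s - s'| < e, `|t - t'| < e & smallF F s' t' d]) -> good s t.
Proof.
move=> h F d fF d0; have d3 : 0 < d / 3 by lra.
have [e1 e10 e1P] := smallF_near F s d3; have [e2 e20 e2P] := smallF_near F t d3.
have e0 : 0 < Num.min e1 e2 by rewrite lt_min e10.
have [s' [t' [ss tt st]]] := h F _ _ fF d3 e0.
move: ss tt; rewrite !lt_min => /andP[/e1P ss _] /andP[_ /e2P tt].
have := smallF_tri (smallF_tri ss st) (smallF_sym tt).
by apply: small_le; lra.
Qed.

(** Distinct values in one piece are told apart by the retraction onto it, which descends to [X_F]
    for [F] that single piece; otherwise a cut function, which descends for empty [F], separates
    them. Being Lipschitz on [X_F], these functions differ arbitrarily little at the ends of small
    paths. *)
Lemma good_eq s t : good s t -> a s = a t.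
Proof.
move=> st; apply: contrapT => ast.
have [[A PA [As At]]|nA] := pselect (exists2 A, P A & A (a s) /\ A (a t)).
  have d0 : 0 < mdist (a s) (a t) by rewrite mdist_gt0; apply/eqP.
  have := small_dst (st _ _ (fin1 PA) d0).
  have kc : forall B y z, P B -> ~ [set A] B -> B y -> B z -> retr tg PA y = retr tg PA z.
    by move=> B y z PB nB; apply: (retr_piece tg PA PB) => // BA; exact: nB.
  have rl y z : mdist (retr tg PA y) (retr tg PA z) <= 1 * mdist y z by rewrite mul1r retr_lip.
  have := @descend_lip R X P [set A] X (@mdist R X) 1 (retr tg PA) (@metric_triangle _ _)
    ltr01 rl kc
    (proj [set A] s) (proj [set A] t).
  by rewrite /proj !descendE// !retr_id// mul1r => h /(le_lt_trans h); rewrite ltxx.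
have [x [nx xs xt xP]] := cut_point tg ast nA.
have [phi [r [[r0 plip pconst _] [_ ps pneg]]]] := cut_function pdm tg xs nx.
have pt : phi (a t) < 0 by apply: pneg => //; exact/nesym.
have e0 : 0 < phi (a s) / 2 by lra.
have := small_dst (st _ _ fin0 e0).
have L := @descend_lip R X P set0 R (fun u v => `|u - v|) 2 phi.
have tri (u v w : R) : `|u - w| <= `|u - v| + `|v - w| by rewrite -[u - w](subrKA v) ler_normD.
have kc : forall A y z, P A -> ~ set0 A -> A y -> A z -> phi y = phi z.
  by move=> A y z PA _; exact: pconst.
have := L tri (ltr0n _ 2) plip kc (proj set0 s) (proj set0 t).
by rewrite /proj !descendE// ler_norml; lra.
Qed.

End good.

(** * Walking along a core in small steps *)

Section core_chain.
Context (R : realType) (X : metricType R) (P : set (set X)) (a : R -> X) (ca : continuous a).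
Context (K : set R) (cK : closed K) (K0 : forall t, t <= 0 -> K t) (K1 : forall t, 1 <= t -> K t).
Hypothesis gapK : forall p q, gap K p q -> good P a p q.

(** Follow [last_in] while time advances a little: a step crosses at most one gap, which is good,
    and otherwise stays among nearby times. *)
Lemma core_chain F d s t : fin P F -> 0 < d -> K s -> K t -> s <= t ->
  chain [set x | K x /\ s <= x <= t] (fun x y => smallF P a F x y d) s t.
Proof.
move=> fF d0 Ks Kt st; set A := [set x | _]; set S := fun x y => _.
pose l := last_in cK K0.
have lid x : K x -> l x = x by exact: last_in_id.
have lA x : s <= x <= t -> A (l x).
  move=> /andP[sx xt]; have [Kl lx lP] := last_inP cK K0 x; split => //.
  by rewrite lP//= (le_trans lx).
(* Half of [d] is for the gap. For the other half, [smallF_osc] wants oscillation below [d / 4]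
   about [k], which follows from [d / 8] about [x]. *)
have step x y : s <= x -> x <= y -> y <= t -> (forall z, x <= z <= y -> mdist (a x) (a z)
  < d / 8) ->
    S (l x) (l y).
  move=> sx xy yt osc; have := last_in_le cK K0 xy; rewrite le_eqVlt => /orP[/eqP e|lxy].
    by rewrite /l e; exact: good_refl.
  have [k [Kk xk ky kgap]] := next_in lxy.
  have [_ ly _] := last_inP cK K0 y.
  have lk : smallF P a F (l x) k (d / 2).
    case: kgap => [->|/gapK g]; last by apply: g => //; lra.
    by apply: good_refl => //; lra.
  suff h : smallF P a F (l x) (l y) (d / 2 + d / 2) by apply: small_le h; lra.
  apply: (smallF_tri ca lk); apply: smallF_osc => //.
  move=> z; rewrite (min_idPl ky) (max_idPr ky) => /andP[kz zy].
  have h1 : mdist (a x) (a z) < d / 8 by apply: osc; rewrite (le_trans xk)//= (le_trans zy).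
  have h2 : mdist (a x) (a k) < d / 8 by apply: osc; rewrite xk (le_trans ky).
  by have := metric_triangle (a k) (a x) (a z); rewrite (metric_sym (a k) (a x)); lra.
have d8 : 0 < d / 8 / 2 by lra.
suff : chain A S s (l t) by rewrite lid.
apply: (@real_induction R s t (fun x => chain A S s (l x))) => //; last by rewrite st lexx.
- rewrite lid//; apply: chain0; split => //; by rewrite lexx.
- move=> x /andP[sx xt] /(_ x) ch; have [e e0 eP] := (contP a).1 ca x _ d8.
  exists (Num.min e (t - x)); first by rewrite lt_min e0 subr_gt0.
  move=> y /andP[xy]; rewrite -ltrBlDl lt_min => /andP[ye yt].
  apply: chainS (ch _) _ _; first by rewrite sx lexx.
    apply: step => //; first lra.
    move=> z xzy; have := eP z; rewrite ballEmdist /= ltr_norml => h.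
    by apply: lt_trans (h _) _; lra.
  by apply: lA; lra.
- move=> x /andP[sx xt] IH; have [e e0 eP] := (contP a).1 ca x _ d8.
  pose y := Num.max s (x - e / 2).
  have sy : s <= y by rewrite le_max lexx.
  have yx : y < x by rewrite gt_max sx; lra.
  have ye : x - e / 2 <= y by rewrite le_max lexx orbT.
  apply: chainS (IH y _) _ _; [by rewrite sy| |by apply: lA; lra].
  apply: step => //; first lra.
  have near z : y <= z <= x -> mdist (a x) (a z) < d / 8 / 2.
    by move=> yzx; have := eP z; rewrite ballEmdist /= ltr_norml; apply; lra.
  move=> z yzx; have := metric_triangle (a y) (a x) (a z).
  have := near z yzx; have := near y; rewrite lexx (ltW yx) => /(_ isT).
  by rewrite (metric_sym (a x) (a y)); lra.
Qed.

End core_chain.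

(** * The image of a core is a point or lies in one piece *)

Section single_piece.
Context (R : realType) (X : metricType R) (P : set (set X)).
Hypotheses (pdm : path_diameter_metric X) (tg : disjointly_tree_graded P).
Context (a : R -> X) (ca : continuous a).
Context (C : set (R * R)) (lC : laminar (good P a) C)
  (mC : forall c, is_chord (good P a) c -> (forall c', C c' -> ~ cross c c' /\ ~ cross c' c) ->
    C c).

Lemma core_single_piece c s t : C c -> c.1 <= s -> s < t -> t <= c.2 ->
  core C c s -> core C c t -> a s <> a t -> exists2 A, P A & A (a s) /\ A (a t).
Proof.
move=> Cc cs st tc Ks Kt ast; apply: contrapT => nA.
have [c0 c12 c1 Gc] := lC.1 _ Cc.
have [x [nx xs xt xP]] := cut_point tg ast nA.
have [phi [r [[r0 plip pconst pnear] [px ps pneg]]]] := cut_function pdm tg xs nx.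
have {pneg} pt : phi (a t) < 0 by apply: pneg => //; exact/nesym.
have Gcl : forall s t, (forall e, 0 < e -> exists s' t', [/\ `|s - s'| < e,
  `|t - t'| < e & good P a s' t']) -> good P a s t.
  move=> s1 t1 h; apply: good_limit => // F d e fF d0 e0.
  by have [s' [t' [h1 h2 g]]] := h e e0; exists s', t'; split => //; exact: g.
pose K := core C c.
have cK : closed K by exact: core_closed.
have K0 t' : t' <= 0 -> K t' by move=> h; apply: core_left; lra.
have K1 t' : 1 <= t' -> K t' by move=> h; apply: core_right; lra.
have gapK p q : gap K p q -> good P a p q.
  by move=> /(core_gap_chord Gcl lC mC) /lC.1 [].
have Kc1 : K c.1 by exact: core_left.
have Kc2 : K c.2 by exact: core_right.
pose A1 := [set y | K y /\ s <= y <= t].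
(* The way back from [t] to [s] goes to [c.2], jumps to [c.1] because (c.1, c.2) is good, and goes
   on to [s]. *)
pose A2 := [set y | K y /\ (t <= y <= c.2 \/ c.1 <= y <= s)].
(* The bound [r] places points with [|phi| < d] within [d] of [x]; the other two give the values at
   [s] and [t] needed for the crossing. *)
pose d0 := Num.min r (Num.min (phi (a s)) (- phi (a t))).
have d00 : 0 < d0 by rewrite !lt_min r0 ps oppr_gt0 pt.
have [d0r d0s d0t] : [/\ d0 <= r, d0 <= phi (a s) & d0 <= - phi (a t)].
  by split; rewrite /d0 !ge_min lexx ?orbT.
have cphi : continuous phi.
  move=> y U /nbhs_ballP [e /= e0 eU]; apply/nbhs_ballP; exists (e / 2) => /=; first lra.
  move=> z; rewrite ballEmdist /= => yz; apply: eU; rewrite ballR.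
  by apply: le_lt_trans (plip _ _) _; lra.
have find F d : fin P F -> 0 < d -> d <= d0 -> exists t1 t2, [/\ A1 t1, A2 t2,
    smallF P a F t1 t2 (6 * d), `|phi (a t1)| < 5 * d & `|phi (a t2)| < 5 * d].
  move=> fF dp dd0.
  have tri (u v w : R) : `|u - w| <= `|u - v| + `|v - w| by rewrite -[u - w](subrKA v) ler_normD.
  have kc : forall A y z, P A -> ~ F A -> A y -> A z -> phi y = phi z.
    by move=> A y z PA _; exact: pconst.
  have dE := descendE kc.
  have dl := @descend_lip R X P F R (fun u v => `|u - v|) 2 phi tri (ltr0n _ 2) plip kc.
  have dc : continuous (descend (Q := F) (P := P) phi).
    apply: (@continuous_descend R X P F R (fun u v => `|u - v|) 2 phi) => //.
  have [||||||||t1 [t2 [h1 h2 h3 h4 h5]]] := @chain_crossing R _ (@rho R X P F)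
     (@rho_triangle R X P F) (proj P a F) A1 A2 s t (descend phi)
       d (@continuous_proj R X P a ca F) dc dl _ _ _ _ dp.
  - move=> y y'; rewrite -(Gamma_repr y) -(Gamma_repr y') !dE => hy hy'.
    have dr := le_trans dd0 d0r.
    apply: le_lt_trans (rho_Gamma_le _ _ _ _) _.
    have := pnear _ _ dr hy; have := pnear _ _ dr hy'.
    have := metric_triangle (repr y) x (repr y'); rewrite (metric_sym x (repr y')); lra.
  - exact: rhoxx.
  - by move=> y [_ /andP[_ yt]]; lra.
  - by move=> y [_ []] /andP[_ yt]; lra.
  - by apply: core_chain => //; exact: ltW.
  - have ch1 := core_chain ca cK K0 gapK fF dp Kt Kc2 tc.
    have ch2 := core_chain ca cK K0 gapK fF dp Kc1 Ks cs.
    have sub1 : [set y | K y /\ t <= y <= c.2] `<=` A2 by move=> y [Ky h]; split => //; left.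
    have sub2 : [set y | K y /\ c.1 <= y <= s] `<=` A2 by move=> y [Ky h]; split => //; right.
    have mono (B B' : set R) S u v : B `<=` B' -> chain B S u v -> chain B' S u v.
      move=> BB'; elim => [Bu|v' w _ ch sw Bw]; first by apply: chain0; exact: BB'.
      by apply: chainS ch sw _; exact: BB'.
    apply: chain_cat (mono _ _ _ _ _ sub1 ch1) _.
    apply: chain_cat (mono _ _ _ _ _ sub2 ch2).
    apply: chainS; first by apply: chain0; split => //; left; rewrite tc lexx.
      by apply: smallF_sym; exact: Gc.
    by split => //; right; rewrite cs lexx.
  - by rewrite /proj dE; lra.
  - by rewrite /proj dE; lra.
  by exists t1, t2; split => //; rewrite -dE.
(* Each finite [F] and small [d] has its own pairs of times. Uniting families and taking the smaller
   [d] shows that these sets of pairs generate a filter, and a cluster point in the compact square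
   serves all [F] at once. *)
pose D (i : set (set X) * R) := fin P i.1 /\ 0 < i.2 /\ i.2 <= d0.
pose B (i : set (set X) * R) := [set z : R * R | [/\ A1 z.1, A2 z.2,
    smallF P a i.1 z.1 z.2 (6 * i.2), `|phi (a z.1)| < 5 * i.2 & `|phi (a z.2)| < 5 * i.2]].
pose Fl := filter_from D B.
have FlF : ProperFilter Fl.
  apply: filter_from_proper; last first.
    by move=> [F d] [/= fF [dp dd0]]; have [t1 [t2 h]] := find F d fF dp dd0; exists (t1, t2).
  apply: filter_from_filter; first by exists (set0, d0); split; [exact: fin0|].
  move=> [F d] [F' d'] [/= fF [dp dd0]] [/= fF' [dp' dd0']].
  exists (F `|` F', Num.min d d').
    by split; [exact: finU|rewrite /= lt_min dp dp' ge_min dd0].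
  have [m1 m2] : Num.min d d' <= d /\ Num.min d d' <= d' by rewrite !ge_min !lexx orbT.
  have le5 (e e' f : R) : f < 5 * e -> e <= e' -> f < 5 * e'.
    by move=> fe ee; apply: lt_le_trans fe _; rewrite ler_pM2l.
  have le6 (e e' : R) : e <= e' -> 6 * e <= 6 * e' by move=> ee; rewrite ler_pM2l.
  move=> [t1 t2] [/= h1 h2 h3 h4 h5]; split; split => //=; try exact: le5 m1; try exact: le5 m2.
    exact: small_le (le6 _ _ m1) (smallF_mono (@subsetUl _ F F') h3).
  exact: small_le (le6 _ _ m2) (smallF_mono (@subsetUr _ F F') h3).
have cS : compact (([set` `[0, 1]] : set R) `*` ([set` `[0, 1]] : set R)).
  by apply: compact_setX; exact: segment_compact.
have [|[t1 t2] [_ clu]] := cS Fl FlF.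
  exists (set0, d0); first by split; [exact: fin0|].
  move=> [y z] [/= [_ /andP[y1 y2]] [_ h] _ _ _]; split; rewrite /= in_itv /=; first lra.
  by case: h => /andP[z1 z2]; lra.
have near F d e : fin P F -> 0 < d -> d <= d0 -> 0 < e -> exists t1' t2',
    [/\ `|t1 - t1'| < e, `|t2 - t2'| < e & B (F, d) (t1', t2')].
  move=> fF dp dd0 e0; have [||[t1' t2'] [h1 [h2 h3]]] := clu (B (F, d)) (ball (t1, t2) e).
  - by exists (F, d).
  - exact: nbhsx_ballx.
  by exists t1', t2'.
have near0 e := near set0 d0 e (@fin0 _ _ P) d00 (lexx _).
have G12 : good P a t1 t2.
  apply: good_limit => // F d e fF dp e0.
  have m0 : 0 < Num.min (d / 6) d0 by rewrite lt_min d00 andbT; lra.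
  have md : Num.min (d / 6) d0 <= d0 by rewrite ge_min lexx orbT.
  have md2 : Num.min (d / 6) d0 <= d / 6 by rewrite ge_min lexx.
  have [t1' [t2' [h1 h2 [_ _ h _ _]]]] := near F _ e fF m0 md e0.
  by exists t1', t2'; split => //; apply: small_le h => /=; lra.
have lims (L : set R) (g : R * R -> R) : closed L -> (forall z, A1 z.1 -> A2 z.2 -> L (g z)) ->
    (forall z e, `|t1 - z.1| < e -> `|t2 - z.2| < e -> `|g (t1, t2) - g z| < e) -> L (g (t1, t2)).
  move=> cL AL gl; apply: contrapT => /(closed_out cL) [e e0 eP].
  have [t1' [t2' [h1 h2 [h3 h4 _ _ _]]]] := near0 e e0.
  exact: eP (gl (t1', t2') e h1 h2) (AL (t1', t2') h3 h4).
have cA1 : closed A1.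
  rewrite (_ : A1 = K `&` ([set y | s <= y] `&` [set y | y <= t])).
    by apply: closedI => //; apply: closedI; [exact: closed_ge|exact: closed_le].
  apply/seteqP; split=> y; first by move=> [Ky /andP[]].
  by move=> [Ky [y1 y2]]; split => //; apply/andP.
have cA2 : closed A2.
  rewrite (_ : A2 = K `&` (([set y | t <= y] `&` [set y | y <= c.2]) `|`
                           ([set y | c.1 <= y] `&` [set y | y <= s]))).
    by apply: closedI => //; apply: closedU; apply: closedI;
      [exact: closed_ge|exact: closed_le|exact: closed_ge|exact: closed_le].
  apply/seteqP; split=> y; first by move=> [Ky [/andP[y1 y2]|/andP[y1 y2]]]; split => //;
    [left|right].
  by move=> [Ky [[y1 y2]|[y1 y2]]]; split => //; [left|right]; apply/andP.
have At1 : A1 t1 by apply: (lims A1 fst) => // z e.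
have At2 : A2 t2 by apply: (lims A2 snd) => // z e.
have phi0 : phi (a t1) = 0 /\ phi (a t2) = 0.
  have cpa : continuous (fun u => phi (a u)) by exact: cont_comp.
  suff lim u : (forall e, 0 < e -> exists u', `|u - u'| < e /\ `|phi (a u')| < e) -> phi (a u) = 0.
    have near5 e : 0 < e -> exists t1' t2', [/\ `|t1 - t1'| < e, `|t2 - t2'| < e,
        `|phi (a t1')| < e & `|phi (a t2')| < e].
      move=> e0; have m0 : 0 < Num.min (e / 5) d0 by rewrite lt_min d00 andbT divr_gt0.
      have md : Num.min (e / 5) d0 <= d0 by rewrite ge_min lexx orbT.
      have me : 5 * Num.min (e / 5) d0 <= e by rewrite mulrC -ler_pdivlMr// ge_min lexx.
      have [t1' [t2' [h1 h2 [_ _ _ h4 h5]]]] := near set0 _ e (@fin0 _ _ P) m0 md e0.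
      exists t1', t2'; split => //; first exact: lt_le_trans h4 me.
      exact: lt_le_trans h5 me.
    by split; apply: lim => e /near5 [t1' [t2' [h1 h2 h3 h4]]]; [exists t1'|exists t2'].
  move=> h; apply/eqP; rewrite -normr_eq0 -[_ == 0]negbK; apply/negP => n0.
  have n1 : 0 < `|phi (a u)| by rewrite lt_neqAle eq_sym n0 normr_ge0.
  have n2 : 0 < `|phi (a u)| / 2 by lra.
  have [e e0 eP] := (contP _).1 cpa u _ n2.
  have m0 : 0 < Num.min e (`|phi (a u)| / 2) by rewrite lt_min e0.
  have [u' []] := h _ m0; rewrite !lt_min => /andP[/eP + _] /andP[_].
  rewrite ballR => h1 h2.
  by have := ler_normD (phi (a u) - phi (a u')) (phi (a u')); rewrite subrK; lra.
have [[Kt1 /andP[st1 tt1]] [Kt2 t2c]] := (At1, At2).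
have t1s : s < t1 by rewrite lt_neqAle st1 andbT; apply/eqP => e; move: ps; rewrite e phi0.1 ltxx.
have t1t : t1 < t by rewrite lt_neqAle tt1 andbT; apply/eqP => e; move: pt; rewrite -e phi0.1 ltxx.
(* The chord between [t1] and [t2] is a proper subchord of [c] with the core time [t] or [s]
   strictly inside. *)
case: t2c => /andP[h1 h2].
  have t2t : t < t2 by rewrite lt_neqAle h1 andbT; apply/eqP => e; move: pt; rewrite e phi0.2 ltxx.
  have : C (t1, t2) by apply: (core_chord lC mC Cc) => //; lra.
  move=> C12; apply: (@core_no_chord R C c t1 t2 t) => //; [lra|by move=> e; move: t1s cs;
    rewrite -e /=; lra|].
  by rewrite t1t.
have t2s : t2 < s by rewrite lt_neqAle h2 andbT; apply/eqP => e; move: ps; rewrite -e phi0.2 ltxx.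
have : C (t2, t1) by apply: (core_chord lC mC Cc) => //; [lra|lra|exact: good_sym].
move=> C12; apply: (@core_no_chord R C c t2 t1 s) => //; [lra|by move=> e; move: t1t tc;
  rewrite -e /=; lra|].
by rewrite t2s.
Qed.

End single_piece.

(** * Fillings in pieces *)

Section uv0.
Context (R : realType) (X : metricType R) (P : set (set X)).
Hypotheses (tg : disjointly_tree_graded P) (uv0 : uniformly_1_UV0 (Pc P)).

Lemma htp_loop (B : set X) (g : R -> X) : htp B g (cst (g 0)) -> g 0 = g 1.
Proof. by move=> /htp_ends [_ h]. Qed.

(** Radius [1 - z.1] and angle [z.2] in turns: a homotopy starts on the circle and ends at the
    centre. *)
Definition polar (z : R * R) : R * R := ((1 - z.1) * (circle z.2).1, (1 - z.1) * (circle z.2).2).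

Definition unit_square : set (R * R) := [set z | (0 <= z.1 <= 1) && (0 <= z.2 <= 1)].

Lemma compact_unit_square : compact unit_square.
Proof.
have -> : unit_square = ([set` `[0, 1]] : set R) `*` ([set` `[0, 1]] : set R).
  apply/seteqP; split=> z; rewrite /unit_square /= !in_itv /=; first by move/andP.
  by move=> [-> ->].
by apply: compact_setX; exact: segment_compact.
Qed.

Lemma continuous_polar : continuous polar.
Proof. by have c := @continuous_circle R; rewrite /polar; cts. Qed.

Lemma polar_norm z : (polar z).1 ^+ 2 + (polar z).2 ^+ 2 = (1 - z.1) ^+ 2.
Proof. by rewrite /polar /= !exprMn -mulrDr cos2Dsin2 mulr1. Qed.

Lemma polar_onto z : @closed_unit_disk R z -> exists2 w, unit_square w & polar w = z.
Proof.
case: z => x y; rewrite /closed_unit_disk /= => xy.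
have n0 : 0 <= x ^+ 2 + y ^+ 2 by nra.
pose r := Num.sqrt (x ^+ 2 + y ^+ 2); have r0 : 0 <= r by exact: sqrtr_ge0.
have r2 : r ^+ 2 = x ^+ 2 + y ^+ 2 by rewrite sqr_sqrtr.
have r1 : r <= 1 by nra.
case: (eqVneq r 0) => [r00|rn0].
  exists (1, 0); first by rewrite /unit_square /= !lexx !ler01.
  have [-> ->] : x = 0 /\ y = 0 by rewrite r00 in r2; split; nra.
  by rewrite /polar /= subrr !mul0r.
have [t t01 [tx ty]] : exists2 t, 0 <= t <= 1 & circle t = (x / r, y / r).
  apply: circle_onto; rewrite /unit_circle /= !expr_div_n -mulrDl r2 divff//.
  by rewrite -r2 expf_eq0.
exists (1 - r, t); first by rewrite /unit_square /= t01; lra.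
by rewrite /polar /= tx ty subKr mulrC divfK// mulrC divfK.
Qed.

Lemma polar_fibre z w : unit_square z -> unit_square w -> polar z = polar w ->
  [\/ z.1 = 1 /\ w.1 = 1, z.1 = w.1 /\ z.2 = w.2,
      [/\ z.1 = w.1, z.2 = 0 & w.2 = 1] | [/\ z.1 = w.1, z.2 = 1 & w.2 = 0]].
Proof.
move=> /andP[z1 z2] /andP[w1 w2] zw.
have n : (1 - z.1) ^+ 2 = (1 - w.1) ^+ 2 by rewrite -!polar_norm zw.
have e : z.1 = w.1 by have : (z.1 - w.1) * (2 - z.1 - w.1) = 0 by [nra]; nra.
case: (eqVneq z.1 1) => [z11|n1]; first by apply: Or41; rewrite -e.
have nz : 1 - z.1 != 0 by rewrite subr_eq0 eq_sym.
have : circle z.2 = circle w.2.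
  have [h1 h2] := zw; rewrite -e in h1 h2.
  by rewrite /circle; congr (_, _); apply: (mulfI nz).
move=> /(circle_inj z2 w2) [h|[h1 h2]|[h1 h2]].
- exact: Or42.
- exact: Or43.
- exact: Or44.
Qed.

(** Fillings by based homotopies instead of disks. [B] is kept in the path component of [g 0], hence
    in the same piece. *)
Definition fillable (e d : R) : Prop := forall (g : R -> X),
  continuous g -> (forall t, Pc P (g t)) -> htp (Pc P) g (cst (g 0)) ->
  (forall s t, 0 <= s <= 1 -> 0 <= t <= 1 -> mdist (g s) (g t) < d) ->
  exists B : set X, [/\ forall x, B x -> conn R (Pc P) (g 0) x,
    forall x y, B x -> B y -> mdist x y < e & htp B g (cst (g 0))].

Lemma uv0_fill (e : R) : 0 < e -> exists2 d, 0 < d & fillable e d.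
Proof.
move=> e0; have [d0 /andP[d00 d0e] dP] := uv0 e0.
(* [diam] is a supremum: pairwise bounds by [d0 / 2] make it strictly less than [d0]. *)
exists (d0 / 2); first by lra.
move=> g cg gP null gd; have g01 := htp_loop null; move: null => [H [cH HP H0 H1 Hs]].
have i0 : 0 <= (0 : R) <= 1 by rewrite lexx ler01.
have i1 : 0 <= (1 : R) <= 1 by rewrite lexx ler01.
have K01 : compact [set t : R | 0 <= t <= 1].
  have -> : [set t : R | 0 <= t <= 1] = [set` `[0, 1]] by apply/seteqP; split=> t /=;
    rewrite in_itv.
  exact: segment_compact.
have argP (z : @unit_circle R) : exists t, 0 <= t <= 1 /\ circle t = set_val z.
  by have [t t01 tz] := circle_onto (set_valP z); exists t.
pose arg z := sval (cid (argP z)).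
have argE z : 0 <= arg z <= 1 /\ circle (arg z) = set_val z by exact: svalP (cid (argP z)).
have polP (z : @closed_unit_disk R) : exists w, unit_square w /\ polar w = set_val z.
  by have [w w01 wz] := polar_onto (set_valP z); exists w.
pose pol z := sval (cid (polP z)).
have polE z : unit_square (pol z) /\ polar (pol z) = set_val z by exact: svalP (cid (polP z)).
have inP t : g t \in Pc P by exact/mem_set.
have HinP z : H z \in Pc P by apply/mem_set; case: z => s t; exact: HP.
have cgg s t : 0 <= s <= 1 -> 0 <= t <= 1 -> circle s = circle t -> g s = g t.
  by move=> s01 t01 /(circle_inj s01 t01) [->|[-> ->]|[-> ->]].
pose al (z : @unit_circle R) : Pc P := SigSub (inP (arg z)).
have cal : continuous al.
  apply: (@continuous_comp_initial _ _ _ set_val).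
  apply: (continuous_through (K := [set t : R | 0 <= t <= 1]) (q := @circle R) (f := g)) => //.
  - exact: continuous_circle.
  - by move=> z; exists (arg z); have [? ?] := argE z.
pose Hd (z : @closed_unit_disk R) : Pc P := SigSub (HinP (pol z)).
have cHd : continuous Hd.
  apply: (@continuous_comp_initial _ _ _ set_val).
  apply: (continuous_through (K := unit_square) (q := polar) (f := H)).
  - exact: compact_unit_square.
  - exact: hausdorff_plane.
  - exact: continuous_polar.
  - exact: cH.
  - move=> [z1 z2] [w1 w2] sz sw /(polar_fibre sz sw) /= h.
    have /andP[/= z101 z201] := sz; have /andP[/= w101 w201] := sw.
    case: h => [[-> ->]|[-> ->]|[-> -> ->]|[-> -> ->]] //.
    + by rewrite !H1.
    + by have [-> ->] := Hs _ w101.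
    + by have [-> ->] := Hs _ w101.
  - by move=> z; exists (pol z); have [? ?] := polE z.
have ext : extends_loop Hd al.
  move=> z; apply: val_inj; rewrite /= /Hd /al /=.
  have [/andP[p1 p2] pE] := polE (subfun (@unit_circle_sub_disk R) z); have [a01 aE] := argE z.
  have zE : set_val (subfun (@unit_circle_sub_disk R) z) = set_val z by [].
  have := polar_norm (pol (subfun (@unit_circle_sub_disk R) z)); rewrite pE zE.
  have := set_valP z; rewrite /unit_circle /= => -> n.
  have p10 : (pol (subfun (@unit_circle_sub_disk R) z)).1 = 0 by nra.
  move: pE p2; rewrite /polar p10; case: (pol _) p10 => q1 q2 /= -> pE q201.
  rewrite H0//; apply: cgg => //; rewrite aE -zE -pE subr0 !mul1r.
  by [].  
have dal : (diam (range al) < d0%:E)%E.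
  apply: (@le_lt_trans _ _ (d0 / 2)%:E); last by rewrite lte_fin; lra.
  apply: ge_ereal_sup => _ [[x y] [[z _ <-] [w _ <-]] <-] /=; rewrite lee_fin.
  by apply/ltW/gd; [case: (argE z)|case: (argE w)].
have [G [cG dG eG]] := dP al cal (ex_intro2 _ _ Hd cHd ext) dal.
(* To turn the disk back into a homotopy, it is swept by segments from the points of the circle to
   (1, 0) instead of radii, which keeps the base point fixed. *)
pose m (z : R * R) : R * R := ((1 - clamp_real z.1) * (circle (clamp_real z.2)).1 + clamp_real z.1,
  (1 - clamp_real z.1) * (circle (clamp_real z.2)).2).
have cm : continuous m by have c := @continuous_circle R; rewrite /m; cts.
have mD z : m z \in @closed_unit_disk R.
  apply/mem_set; rewrite /closed_unit_disk /m /=.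
  have := circle_unit (clamp_real z.2); rewrite /unit_circle /circle /=.
  set x := cos _; set y := sin _ => xy; have /andP[s0 s1] := clampr_itv z.1.
  have x1 : x <= 1 by nra.
  set u := clamp_real z.1 in s0 s1 *.
  have h : 0 <= u * (1 - u) * (1 - x) by rewrite !mulr_ge0// subr_ge0.
  have -> : ((1 - u) * x + u) ^+ 2 + ((1 - u) * y) ^+ 2 =
    (1 - u) ^+ 2 * (x ^+ 2 + y ^+ 2) + u ^+ 2 + 2 * (u * (1 - u) * x) by ring.
  by rewrite xy; lra.
pose K z : X := set_val (G (SigSub (mD z))).
have cK : continuous K.
  have cmD : continuous (fun z => SigSub (mD z) : @closed_unit_disk R).
    exact: (@continuous_comp_initial _ _ _ set_val).
  apply: (@cont_comp _ _ _ set_val (fun z => G (SigSub (mD z)))).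
    exact: (@initial_continuous (Pc P) X set_val).
  by apply: (@cont_comp _ _ _ G (fun z => SigSub (mD z) : @closed_unit_disk R)).
have Kcirc z t : 0 <= t <= 1 -> m z = circle t -> K z = g t.
  move=> t01 mz; have uz : m z \in @unit_circle R by rewrite mz; apply/mem_set/circle_unit.
  rewrite /K; have -> : SigSub (mD z) = subfun (@unit_circle_sub_disk R) (SigSub uz).
    exact: val_inj.
  rewrite eG /al /=; have [a01 aE] := argE (SigSub uz); apply: cgg => //.
  by rewrite aE -mz.
have KE s t : K (s, t) = K (clamp_real s, clamp_real t).
  rewrite /K; congr (set_val (G _)); apply: val_inj; rewrite /= /m /=.
  by rewrite !(clampr_id (clampr_itv _)).
have K0 t : 0 <= t <= 1 -> K (0, t) = g t.
  by move=> t01; apply: Kcirc => //; rewrite /m /= clampr0 subr0 !mul1r addr0 (clampr_id t01).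
have K1 t : 0 <= t <= 1 -> K (1, t) = g 0.
  move=> t01; apply: Kcirc => //; rewrite /m /= clampr1 subrr !mul0r add0r.
  by rewrite circle0.
exists (range K); split.
- move=> _ [[s t] _ <-]; rewrite KE.
  have := @conn_fun R X (Pc P) (fun r => K (r, clamp_real t)) 1 (clamp_real s).
  rewrite K1 ?clampr_itv//; apply; first by cts.
  by move=> r; exact: set_valP.
- move=> _ _ [z _ <-] [w _ <-]; rewrite -lte_fin; apply: le_lt_trans dG.
  apply: ereal_sup_ubound; rewrite /=; exists (G (SigSub (mD z)), G (SigSub (mD w))) => //.
  by split => /=; [exists (SigSub (mD z))|exists (SigSub (mD w))].
- exists K; split => //.
  move=> s s01; split; first by apply: Kcirc => //; rewrite /m clampr0 circle0 /=; congr (_, _);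
    ring.
  by rewrite -g01; apply: Kcirc => //; rewrite /m clampr1 circle1 circle0 /=; congr (_, _); ring.
Qed.

(* A filling of a null-homotopic loop whose size is, at every scale, controlled by
   that of the loop: it is at most twice as large as the optimal one. *)
Lemma best_fill : exists2 d : R -> R, (forall e, 0 < e -> 0 < d e) &
  forall A (g : R -> X), P A -> continuous g -> (forall t, A (g t)) -> htp A g (cst (g 0)) ->
  exists B : set X, [/\ B `<=` A, htp B g (cst (g 0)) & forall e, 0 < e ->
    (forall s t, 0 <= s <= 1 -> 0 <= t <= 1 -> mdist (g s) (g t) < d e) ->
    forall x y, B x -> B y -> mdist x y < e].
Proof.
pose d0 (e : R) := xget 1 [set d : R | 0 < d /\ fillable e d].
have d0P e : 0 < e -> 0 < d0 e /\ fillable e (d0 e).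
  by move=> /uv0_fill [d d_gt0 fd]; rewrite /d0; case: xgetP => // /(_ d); case.
exists (fun e => d0 (e / 2)); first by move=> e e0; have [] := d0P (e / 2) ltac:(lra).
move=> A g PA cg Ag null.
have APc x : A x -> Pc P x by move=> Ax; exists A.
have [cst0|nc] := pselect (forall t, 0 <= t <= 1 -> g t = g 0).
  exists [set g 0]; split; first by move=> _ ->.
    have h := @htp_refl R X [set g 0] (cst (g 0)) (@cont_cst _ _ (g 0)) (fun _ _ => erefl).
    by apply: (htp_eq h) => // t /cst0.
  by move=> e e0 _ _ _ -> ->; rewrite mdistxx.
have [t0 [t001 gt0]] : exists t, 0 <= t <= 1 /\ g t <> g 0.
  by apply: contrapT => h; apply: nc => t t01; apply: contrapT => gt; apply: h; exists t.
pose S := [set e : R | exists B : set X, [/\ B `<=` A, htp B g (cst (g 0)) &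
   forall x y, B x -> B y -> mdist x y < e]].
have m0 : 0 < mdist (g t0) (g 0) by rewrite mdist_gt0; apply/eqP.
have Slb e : S e -> mdist (g t0) (g 0) <= e.
  move=> [B [_ [H [_ HB H0 _ _]] Be]]; apply/ltW/Be; rewrite -H0 ?lexx ?ler01//.
have [nS|nS] := pselect (S !=set0); last first.
  (* Without any bounded filling, the size condition fails for every [e], so [A] itself will do. *)
  exists A; split => // e e0 ge; exfalso; apply: nS.
  have e2 : 0 < e / 2 by lra.
  have [_ /(_ g cg (fun t => APc _ (Ag t)) (htp_sub APc null) ge) [B [Bc Be hB]]] := d0P _ e2.
  exists (e / 2), B; split => // x /Bc; exact: (piece_component tg PA (Ag 0) x).2.
(* Every filling contains [g t0] and [g 0], so the infimum is positive and some filling is below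
   twice the infimum; this is why [d0] is evaluated at [e / 2]. *)
have iS : 0 < inf S by apply: lt_le_trans m0 _; apply: lb_le_inf.
have hS : has_inf S by split => //; exists (mdist (g t0) (g 0)).
have [e1 [B [BA hB Be1]] e1S] := inf_adherent iS hS.
exists B; split => // e e0 ge x y Bx By; apply: lt_trans (Be1 _ _ Bx By) _.
have e2 : 0 < e / 2 by lra.
have [_ /(_ g cg (fun t => APc _ (Ag t)) (htp_sub APc null) ge) [B' [Bc Be hB']]] := d0P _ e2.
have : inf S <= e / 2.
  apply: ge_inf; first by case: hS.
  exists B'; split => // z /Bc; exact: (piece_component tg PA (Ag 0) z).2.
lra.
Qed.

End uv0.

(** * Concatenation of infinitely many shrinking homotopies *)

Section telescope.
Context (R : realType) (X : metricType R).

Lemma htp_pc_rev (A : set X) (q r : R -> X) : continuous r -> (forall t, A (r t)) ->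
  htp A q r -> htp A (pc q (fun t => r (1 - t))) (cst (q 0)).
Proof.
move=> cr Ar qr; have [q0 q1] := htp_ends qr.
apply: (@htp_trans _ _ _ _ (pc r (fun t => r (1 - t)))).
  apply: htp_pc => //=; last by rewrite subr0 q1.
  by apply: htp_refl => //; cts.
apply: (@htp_eq _ _ _ (r \o (fun t => Num.min (2 * t) (2 - 2 * t))) (r \o (fun=> 0))).
- apply: htp_reparam => //=; try by cts.
  + by rewrite /Num.min; case: ifPn => ?; lra.
  + by rewrite /Num.min; case: ifPn => ?; lra.
- move=> t t01; rewrite /pc /=; case: ifPn => th.
    by rewrite (min_idPl _)//; lra.
  by rewrite -ltNge in th; rewrite (min_idPr _); [congr r; lra|lra].
- by move=> t _ /=.
Qed.

(** In the square of the null-homotopy, the side at time 0 is [q] followed by [r] backwards, and the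
    other three sides are the base point. The new homotopy sweeps the square by segments from these
    three sides, a third of the time for each, to the middle of the first side, where [q] and [r]
    meet. *)
Lemma htp_of_pc_rev (A : set X) (q r : R -> X) : q 1 = r 1 ->
  htp A (pc q (fun t => r (1 - t))) (cst (q 0)) -> htp A q r.
Proof.
move=> qr1 [H [cH AH H0 H1 Hs]].
have pcq t : 0 <= t <= 1 -> H (0, t / 2) = q t.
  move=> t01; rewrite H0; last lra.
  by rewrite /pc ifT; [congr q; lra|lra].
have pcr t : 0 <= t <= 1 -> H (0, 1 - t / 2) = r t.
  move=> t01; rewrite H0; last lra.
  rewrite /pc; case: ifPn => th; last by congr r; lra.
  have t1 : t = 1 by lra.
  by rewrite t1 -qr1; congr q; lra.
have bd s : 0 <= s <= 1 -> H (s, 0) = q 0 /\ H (s, 1) = r 0.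
  by move=> s01; have [-> ->] := Hs s s01; rewrite pc0 pc1 subrr.
exists (fun z => H ((1 - z.2) * Num.min (clamp_real (3 * z.1)) (clamp_real (3 - 3 * z.1)),
  z.2 / 2 + (1 - z.2) * clamp_real (3 * z.1 - 1))); split => /=.
- by cts.
- by move=> s t; exact: AH.
- move=> t t01; rewrite mulr0 clampr0 (min_idPl (clampr_ge0 _)) mulr0.
  by rewrite clampr_le0 ?mulr0 ?addr0 ?pcq//; lra.
- move=> t t01; rewrite mulr1 subrr clampr0 (min_idPr (clampr_ge0 _)) mulr0.
  by rewrite clampr_ge1; [rewrite -pcr//; congr (H (_, _)); lra|lra].
- move=> s s01; rewrite subr0 subrr !mul1r !mul0r add0r; split; last first.
    by rewrite addr0 -pcq ?mul1r ?lexx ?ler01.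
  have [q00 r00] := bd 1 ltac:(by rewrite lexx ler01).
  have mi (x y : R) : 0 <= Num.min (clamp_real x) (clamp_real y) <= 1.
    by rewrite /Num.min; case: ifP => _; exact: clampr_itv.
  case: (lerP s 3^-1) => s1.
    by rewrite (clampr_le0 (_ : 3 * s - 1 <= 0)); [exact: (bd _ (mi _ _)).1|lra].
  case: (lerP s (2 / 3)) => s2.
    rewrite [clamp_real (3 * s)]clampr_ge1 ?[clamp_real (3 - 3 * s)]clampr_ge1; [|lra|lra].
    by rewrite minxx H1 ?clampr_itv.
  rewrite [clamp_real (3 * s - 1)]clampr_ge1; last lra.
  rewrite (bd _ (mi _ _)).2.
  by rewrite -r00 H1 ?lexx ?ler01.
Qed.

Lemma continuous_approx (F : R * R -> X) : (forall e, 0 < e ->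
  exists2 G : R * R -> X, continuous G & forall z, mdist (F z) (G z) < e) -> continuous F.
Proof.
move=> FG; apply/cont2P => z e e0; have e3 : 0 < e / 3 by lra.
have [G cG GF] := FG _ e3.
have [d d0 dP] := (cont2P G).1 cG z _ e3; exists d => // w zw1 zw2.
rewrite ballEmdist /=; have := dP w zw1 zw2; rewrite ballEmdist /= => GG.
have := GF z; have := GF w; rewrite [mdist (F w) _]metric_sym => h1 h2.
have := metric_triangle (F z) (G z) (F w).
have := metric_triangle (G z) (G w) (F w); lra.
Qed.

Let w (n : nat) : R := 2^-1 ^+ n.

Lemma halves_gt0 n : 0 < w n. Proof. by rewrite exprn_gt0// invr_gt0. Qed.

Lemma halvesS n : w n.+1 = w n / 2. Proof. by rewrite /w exprS mulrC. Qed.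

Lemma halves_le n m : (n <= m)%N -> w m <= w n.
Proof.
elim: m => [|m IH]; first by rewrite leqn0 => /eqP ->.
rewrite leq_eqVlt => /orP[/eqP -> //|nm]; apply: le_trans (IH nm).
by rewrite halvesS; have := halves_gt0 m; lra.
Qed.

Lemma halves_lt (e : R) : 0 < e -> exists n, w n < e.
Proof.
move=> e0; exists (Num.bound e^-1).
have e1 : e^-1 < (Num.bound e^-1)%:R by apply: archi_boundP; rewrite invr_ge0 ltW.
have : (Num.bound e^-1)%:R < 2 ^+ Num.bound e^-1 :> R by rewrite -natrX ltr_nat ltn_expl.
move=> h; rewrite /w exprVn -[ltRHS]invrK ltf_pV2 ?posrE ?invr_gt0 ?exprn_gt0//.
exact: lt_trans e1 h.
Qed.

(* The homotopies [H n] are performed one after the other on the strips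
   [2^-(n+1) <= z.1 <= 2^-n], towards [z.1 = 0]. *)
Lemma telescope (A : set X) (x0 : X) (H : nat -> R * R -> X) : A x0 ->
  (forall n, continuous (H n)) -> (forall n z, A (H n z)) ->
  (forall n s, 0 <= s <= 1 -> H n (s, 0) = x0 /\ H n (s, 1) = x0) ->
  (forall n t, 0 <= t <= 1 -> H n (1, t) = H n.+1 (0, t)) ->
  (forall n z z', mdist (H n z) (H n z') < w n) ->
  htp A (fun t => H 0%N (0, t)) (cst x0).
Proof.
move=> Ax0 cH AH H01 Hn Hw.
have i0 : 0 <= (0 : R) <= 1 by rewrite lexx ler01.
(* The signs put the condition [w m <= z.1] in the form that [continuous_if_le] treats. The strip
   has width [w m / 2], whence the factor [2 / w m]. *)
pose fix F (n : nat) (z : R * R) {struct n} : X := if n is m.+1 then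
  (if - z.1 <= - w m then F m z
   else H m (clamp_real ((w m - z.1) * (2 / w m)), clamp_real z.2))
  else H 0%N (0, clamp_real z.2).
have Flow n z : z.1 <= w n -> F n z = H n (0, clamp_real z.2).
  case: n => [//|n] /=; rewrite halvesS => zn; have wn := halves_gt0 n.
  rewrite ifF; last by apply/negbTE; rewrite -ltNge; lra.
  rewrite [clamp_real (_ * _)]clampr_ge1 ?Hn ?clampr_itv//.
  rewrite mulrA ler_pdivlMr//; lra.
have cF n : continuous (F n).
  elim: n => [|n IH] /=; first by have := cH 0%N => c; cts.
  apply: continuous_if_le => //; [by cts|by have := cH n => c; cts|].
  move=> z zn; have {}zn : z.1 = w n by lra.
  by rewrite Flow ?zn// subrr mul0r clampr0.
have Fstep n m z : w n <= z.1 -> (n <= m)%N -> F m z = F n z.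
  move=> nz; elim: m => [|m IH]; first by rewrite leqn0 => /eqP ->.
  rewrite leq_eqVlt => /orP[/eqP -> //|nm] /=.
  by rewrite ifT ?IH// lerN2; apply: le_trans nz; exact: halves_le.
have AF n z : A (F n z) by elim: n => [|n IH] /=; [exact: AH|case: ifP].
have Fs n z : z.1 <= w n -> forall m, (n <= m)%N -> mdist (F m z) x0 < w n.
  move=> zn; elim=> [|m IH].
    by rewrite leqn0 => /eqP n0; rewrite n0 /= -(H01 0%N 0 i0).1.
  rewrite leq_eqVlt => /orP[/eqP n0|nm].
    by rewrite n0 Flow -?n0// -(H01 n 0 i0).1; exact: Hw.
  rewrite /=; case: ifP => _; first exact: IH.
  apply: lt_le_trans (halves_le (nm : (n <= m)%N)); rewrite -(H01 m 0 i0).1; exact: Hw.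
pose Finf (z : R * R) : X := if z.1 <= 0 then x0 else F (xget 0%N [set n | w n <= z.1]) z.
have FinfE n z : w n <= z.1 -> Finf z = F n z.
  move=> nz; have z0 : 0 < z.1 by apply: lt_le_trans nz; exact: halves_gt0.
  rewrite /Finf leNgt z0 /=; case: xgetP => [k _ kz|/(_ n)//].
  by case: (leqP n k) => nk; [apply: Fstep|apply/esym/Fstep => //; exact: ltnW].
have cFinf : continuous Finf.
  apply: continuous_approx => e e0; have e2 : 0 < e / 2 by lra.
  have [n ne] := halves_lt e2; exists (F n) => // z.
  case: (lerP (w n) z.1) => nz; first by rewrite (FinfE n)// mdistxx.
  have h1 := Fs n z (ltW nz) n (leqnn n).
  have h2 : mdist (Finf z) x0 < w n.
    rewrite /Finf; case: ifPn => z0; first by rewrite mdistxx halves_gt0.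
    rewrite -ltNge in z0; case: xgetP => [k _ kz|].
      apply: (Fs n z (ltW nz)); rewrite leqNgt; apply/negP => kn.
      by have := halves_le (ltnW kn); rewrite leNgt (le_lt_trans kz nz).
    by have [k kz] := halves_lt z0 => /(_ k); case; exact: ltW.
  have := metric_triangle (Finf z) x0 (F n z); rewrite [mdist x0 _]metric_sym; lra.
have Fend n s t : t = 0 \/ t = 1 -> F n (s, t) = x0.
  move=> t01; have ct : clamp_real t = t by case: t01 => ->; rewrite ?clampr0 ?clampr1.
  have Hx m r : 0 <= r <= 1 -> H m (r, t) = x0.
    by move=> r01; have [h0 h1] := H01 m r r01; case: t01 => ->.
  elim: n => [|n IH] /=; rewrite ct; first exact: Hx.
  by rewrite IH; case: ifP => // _; apply: Hx; exact: clampr_itv.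
exists (fun z => Finf (1 - z.1, z.2)); split => /=.
- by cts.
- by move=> s t; rewrite /Finf; case: ifP.
- move=> t t01; rewrite (FinfE 0%N) /= ?clampr_id// subr0 /w expr0//.
- by move=> t t01; rewrite /Finf /= ifT// subrr.
- move=> s s01; have [-> ->] := H01 0%N 0 i0.
  by rewrite /Finf /=; case: ifP => // _; split; apply: Fend; [left|right].
Qed.

End telescope.

Section hausdorff.
Context (R : realType) (X : metricType R) (P : set (set X)).
Hypotheses (tg : disjointly_tree_graded P) (uv0 : uniformly_1_UV0 (Pc P)).

(** Choose loops [q n] homotopic to [g], of sizes tending to 0. Consecutive ones differ by a small
    null-homotopic loop; its small filling is a homotopy between them, and [telescope] performs
    these homotopies one after the other. *)
Lemma null_of_small A (g : R -> X) : P A -> continuous g -> (forall t, A (g t)) -> g 0 = g 1 ->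
  (forall e, 0 < e -> exists q, [/\ continuous q, forall t, A (q t), htp A g q &
    forall s t, 0 <= s <= 1 -> 0 <= t <= 1 -> mdist (q s) (q t) < e]) ->
  htp A g (cst (g 0)).
Proof.
move=> PA cg Ag g01 sg.
pose w (n : nat) : R := 2^-1 ^+ n.
have w0 n : 0 < w n by rewrite exprn_gt0// invr_gt0.
have /choice [d dP] n : exists d, 0 < d /\ fillable P (w n) d.
  by have [d d0 dP] := uv0_fill uv0 (w0 n); exists d.
(* [q n] enters the fillings [n] and [n.-1]. Half of the bound suits the combined loop, whose points
   are compared through the base point. *)
have /choice [q qP] n : exists q, [/\ continuous q, forall t, A (q t), htp A g q &
    forall s t, 0 <= s <= 1 -> 0 <= t <= 1 -> mdist (q s) (q t) < Num.min (d n) (d n.-1) / 2].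
  by apply: sg; rewrite divr_gt0// lt_min (dP n).1 (dP n.-1).1.
have q0 n : q n 0 = g 0 by have [_ _ /htp_ends[]] := qP n.
have q1 n : q n 1 = g 0 by have [_ _ /htp_ends[_ ->]] := qP n.
have i0 : 0 <= (0 : R) <= 1 by rewrite lexx ler01.
have /choice [H HP] n : exists H : R * R -> X, [/\ continuous H, forall z, A (H z),
    forall s, 0 <= s <= 1 -> H (s, 0) = g 0 /\ H (s, 1) = g 0,
    forall t, 0 <= t <= 1 -> H (0, t) = q n t /\ H (1, t) = q n.+1 t &
    forall z z', mdist (H z) (H z') < w n].
  have [cq Aq hq dq] := qP n; have [cq' Aq' hq' dq'] := qP n.+1.
  pose l := pc (q n) (fun t => q n.+1 (1 - t)).
  have cl : continuous l by apply: continuous_pc => //; [cts|rewrite subr0 !q1].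
  have Al t : A (l t) by rewrite /l /pc; case: ifP.
  have lh : htp A l (cst (l 0)).
    by rewrite /l pc0; apply: htp_pc_rev => //; exact: htp_trans (htp_sym hq) hq'.
  have [_ fil] := dP n.
  have [|||B [BP Bw hB]] := fil l cl.
  + by move=> t; exists A.
  + by apply: htp_sub lh => x Ax; exists A.
  + have ld t : 0 <= t <= 1 -> mdist (g 0) (l t) < d n / 2.
      move=> t01; rewrite /l /pc; case: ifPn => th.
        rewrite -(q0 n); apply: lt_le_trans (dq _ _ _ _) _ => //; first lra.
        by rewrite ler_pM2r ?invr_gt0// ge_min lexx.
      rewrite -ltNge in th; rewrite -(q0 n.+1).
      apply: lt_le_trans (dq' _ _ _ _) _ => //; first lra.
      by rewrite ler_pM2r ?invr_gt0// ge_min lexx orbT.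
    move=> s t /ld h1 /ld; have := metric_triangle (l s) (g 0) (l t).
    by rewrite [mdist (l s) (g 0)]metric_sym; lra.
  have [K [cK BK K0 K1 Ks]] : htp B (q n) (q n.+1).
    by apply: htp_of_pc_rev; [rewrite !q1|move: hB; rewrite /l pc0].
  exists K; split => //.
  + move=> z; have := BK z.1 z.2; rewrite -surjective_pairing => /BP.
    by move=> /(piece_component tg PA (Al 0) _).2.
  + by move=> s s01; have := Ks s s01; rewrite q0 q1.
  + by move=> t t01; split; [exact: K0|exact: K1].
  + by move=> [s t] [s' t']; exact: Bw.
have [_ _ gq0 _] := qP 0%N; apply: htp_trans gq0 _.
have : htp A (fun t => H 0%N (0, t)) (cst (g 0)).
  apply: telescope => //.
  - by move=> n; have [] := HP n.
  - by move=> n; have [] := HP n.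
  - by move=> n; have [] := HP n.
  - move=> n t t01; have [_ _ _ /(_ t t01)[_ ->] _] := HP n.
    by have [_ _ _ /(_ t t01)[-> _] _] := HP n.+1.
  - by move=> n; have [] := HP n.
move=> h; apply: (htp_eq h) => t t01 //.
by have [_ _ _ /(_ t t01)[-> _] _] := HP 0%N.
Qed.

End hausdorff.

(** * Pasting of fillings *)

Section pasting.
Context (R : realType).

Definition near2 (d : R) (z w : R * R) := `|z.1 - w.1| < d /\ `|z.2 - w.2| < d.

Definition adherent (O : set (R * R)) z := forall d, 0 < d -> exists2 w, O w & near2 d z w.

Context (X : metricType R) (I : Type) (O : I -> set (R * R)) (G : I -> R * R -> X)
  (F : R * R -> X).
Let L z := forall i, ~ O i z.
Hypotheses (openO : forall i z, O i z -> exists2 d, 0 < d & forall w, near2 d z w -> O i w)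
  (cG : forall i, continuous (G i)) (FG : forall i z, O i z -> F z = G i z)
  (disjO : forall i j z, O i z -> O j z -> i = j)
  (bdO : forall i z, L z -> adherent (O i) z -> F z = G i z)
  (cL : forall z e, L z -> 0 < e ->
     exists2 d, 0 < d & forall w, L w -> near2 d z w -> mdist (F z) (F w) < e)
  (big : forall e, 0 < e -> exists s : seq (R * R),
     forall i z w, e <= mdist (G i z) (G i w) -> exists2 x, x \in s & O i x).

(** The first point outside [O i] on the segment from [w] to [z]. It is in no other [O j] either,
    since that set is open and disjoint from [O i]. *)
Lemma exit_point i z w d : near2 d z w -> O i w -> L z ->
  exists y, [/\ near2 d z y, L y & adherent (O i) y].
Proof.
move=> [zw1 zw2] Ow Lz.
pose y (r : R) : R * R := (w.1 + r * (z.1 - w.1), w.2 + r * (z.2 - w.2)).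
have yd r d' : 0 < d' -> exists2 d'', 0 < d'' & forall r', `|r - r'| < d'' -> near2 d' (y r) (y r').
  move=> d'0; have c1 : continuous (fun r => (y r).1) by rewrite /y /=; cts.
  have c2 : continuous (fun r => (y r).2) by rewrite /y /=; cts.
  have [d1 d10 h1] := (contP _).1 c1 r d' d'0; have [d2 d20 h2] := (contP _).1 c2 r d' d'0.
  exists (Num.min d1 d2); first by rewrite lt_min d10.
  by move=> r'; rewrite lt_min => /andP[/h1 ? /h2 ?].
pose K : set R := [set r | ~ O i (y r)].
have cK : closed K.
  rewrite -openC openE => r /= /contrapT /openO [d' d'0 dP].
  have [d'' d''0 d''P] := yd r d' d'0.
  by apply/nbhs_ballP; exists d'' => //= r' rr' /=; apply; apply: dP; exact: d''P.
have y1 : y 1 = z by rewrite /y; case: (z) (w) => a b [c e]; congr (_, _) => /=; ring.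
have y0 : y 0 = w by rewrite /y; case: (z) (w) => a b [c e]; congr (_, _) => /=; ring.
have K1 : K 1 by rewrite /K /= y1; exact: Lz.
have [m [Km m1 m0 mP]] := first_after cK K1 ler01.
have m0' : 0 < m.
  by rewrite lt_neqAle m0 andbT; apply/eqP => m00; apply: Km; rewrite -m00 y0.
have adm : adherent (O i) (y m).
  move=> d' d'0; have [d'' d''0 d''P] := yd m d' d'0.
  pose r := Num.max 0 (m - d'' / 2).
  have rm : r < m by rewrite gt_max m0'; lra.
  have r0 : 0 <= r by rewrite le_max lexx.
  exists (y r); last first.
    apply: d''P; have : m - d'' / 2 <= r by rewrite le_max lexx orbT.
    by rewrite ltr_norml; lra.
  by apply: contrapT => /mP /(_ r0); rewrite leNgt rm.
exists (y m); split => //.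
  split; rewrite /y /=.
    have -> : z.1 - (w.1 + m * (z.1 - w.1)) = (1 - m) * (z.1 - w.1) by ring.
    by move: zw1; rewrite !ltr_norml; nra.
  have -> : z.2 - (w.2 + m * (z.2 - w.2)) = (1 - m) * (z.2 - w.2) by ring.
  by move: zw2; rewrite !ltr_norml; nra.
move=> j Oj; have [d' d'0 dP] := openO Oj; have [x Ox /dP Ojx] := adm _ d'0.
by apply: Km; rewrite (disjO Ox Ojx).
Qed.

(** Near a point of [L], the sets on which the oscillation is at least [e / 2] are met by the finite
    list of [big], so by disjointness they are finitely many and are treated one at a time. Any
    other set is left through an exit point, where [F] is close to its value at [z]. *)
Lemma continuous_pasting : continuous F.
Proof.
apply/cont2P => z e e0; suff [d d0 dP] : exists2 d, 0 < d & forall w, near2 d z w -> mdist (F z)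
  (F w) < e.
  by exists d => // w z1 z2; rewrite ballEmdist /=; apply: dP; split.
have e2 : 0 < e / 2 by lra.
have cGe i e' : 0 < e' -> exists2 d, 0 < d & forall w, near2 d z w -> mdist (G i z) (G i w) < e'.
  move=> e'0; have [d d0 dP] := (cont2P _).1 (@cG i) z e' e'0; exists d => // w [z1 z2].
  by have := dP w z1 z2; rewrite ballEmdist.
have [[i Oz]|nO] := pselect (exists i, O i z).
  have [d1 d10 h1] := openO Oz; have [d2 d20 h2] := cGe i e e0.
  exists (Num.min d1 d2); first by rewrite lt_min d10.
  move=> w [+ +]; rewrite !lt_min => /andP[z11 z12] /andP[z21 z22].
  have Ow : O i w by apply: h1.
  by rewrite (FG Oz) (FG Ow); apply: h2.
have Lz : L z by move=> i Oi; apply: nO; exists i.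
have [d1 d10 h1] := cL Lz e2; have [s sP] := big e2.
have [d2 d20 h2] : exists2 d, 0 < d & forall x i w, x \in s -> O i x -> O i w ->
    near2 d z w -> mdist (F z) (F w) < e.
  elim: s {sP} => [|x s [d d0 dP]]; first by exists 1.
  have [d' d'0 dP'] : exists2 d, 0 < d & forall i w, O i x -> O i w ->
      near2 d z w -> mdist (F z) (F w) < e.
    have [[i Oix]|nOx] := pselect (exists i, O i x); last first.
      by exists 1 => // i w Oix; exfalso; apply: nOx; exists i.
    have [ad|nad] := pselect (adherent (O i) z).
      have [d' d'0 dP'] := cGe i e e0; exists d' => // j w Ojx.
      rewrite (disjO Ojx Oix) => Ow zw; rewrite (bdO Lz ad) (FG Ow); exact: dP'.
    have [d' [d'0 dP']] : exists d, 0 < d /\ forall w, O i w -> ~ near2 d z w.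
      apply: contrapT => h; apply: nad => d' d'0; apply: contrapT => h'.
      by apply: h; exists d'; split => // w Ow zw; apply: h'; exists w.
    by exists d' => // j w Ojx; rewrite (disjO Ojx Oix) => /dP' h /h.
  exists (Num.min d d'); first by rewrite lt_min d0.
  move=> y i w; rewrite inE => ys Oy Ow [+ +].
  rewrite !lt_min => /andP[z11 z12] /andP[z21 z22].
  case/orP: ys => [/eqP yx|ys]; last exact: (dP y i w).
  by apply: (dP' i w) => //; rewrite -yx.
exists (Num.min d1 d2); first by rewrite lt_min d10.
move=> w [+ +]; rewrite !lt_min => /andP[z11 z12] /andP[z21 z22].
have [[i Ow]|nOw] := pselect (exists i, O i w); last first.
  apply: lt_trans (h1 w _ _) _ => //; last lra.
  by move=> i Oi; apply: nOw; exists i.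
have [[z' [w' zw']]|nb] := pselect (exists z' w', e / 2 <= mdist (G i z') (G i w')).
  by have [x xs Ox] := sP _ _ _ zw'; apply: (h2 x i w).
have [y [zy Ly ady]] := exit_point (conj z11 z21) Ow Lz.
have hy := h1 _ Ly zy.
have hw : mdist (F y) (F w) < e / 2.
  rewrite (bdO Ly ady) (FG Ow) ltNge; apply/negP => h; apply: nb.
  by exists y, w.
have := metric_triangle (F z) (F y) (F w); lra.
Qed.

End pasting.

Lemma grid (R : realType) (d : R) : 0 < d -> exists s : seq R,
  forall p q, 0 <= p -> q <= 1 -> d <= q - p -> exists2 x, x \in s & p < x < q.
Proof.
move=> d0; have [N Nd] : exists N : nat, 2 / d < N.+1%:R.
  exists (Num.bound (2 / d)); apply: (@lt_trans _ _ (Num.bound (2 / d))%:R).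
    by apply: archi_boundP; rewrite divr_ge0// ltW.
  by rewrite ltr_nat.
have N0 : 0 < N.+1%:R :> R by rewrite ltr0n.
rewrite ltr_pdivrMr// in Nd.
exists [seq k%:R / N.+1%:R | k <- iota 0 N.+1] => p q p0 q1 dpq.
have pN : 0 <= p * N.+1%:R by rewrite mulr_ge0// ltW.
pose k := (Num.truncn (p * N.+1%:R)).+1.
have /andP[k1 k2] := Num.Theory.truncn_itv pN; rewrite -/k in k2.
have kk : k%:R <= p * N.+1%:R + 1 by rewrite /k -addn1 natrD lerD2r.
have px : p < k%:R / N.+1%:R by rewrite ltr_pdivlMr.
have xq : k%:R / N.+1%:R < q by rewrite ltr_pdivrMr//; nra.
exists (k%:R / N.+1%:R); last by rewrite px.
apply/mapP; exists k => //; rewrite mem_iota /=  add0n -(ltr_nat R).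
by move: xq; rewrite ltr_pdivrMr// => xq; nra.
Qed.

(** * Contracting all gaps of a closed set of times at once *)

Section insertion.
Context (R : realType) (X : metricType R) (P : set (set X)).
Hypotheses (tg : disjointly_tree_graded P) (uv0 : uniformly_1_UV0 (Pc P)).
Context (A : set X) (f : R -> X) (K : set R).
Hypotheses (PA : P A) (cf : continuous f) (Af : forall t, A (f t)) (cK : closed K)
  (K0 : forall t, t <= 0 -> K t) (K1 : forall t, 1 <= t -> K t)
  (gapK : forall p q, gap K p q -> htp A (sub f p q) (cst (f p))).

Lemma in_gap t : K t \/ exists2 g : R * R, gap K g.1 g.2 & g.1 < t < g.2.
Proof.
have [Kt|nKt] := pselect (K t); [by left|right].
have [Kl lt lP] := last_inP cK K0 t.
have kt : t <= Num.max t 1 by rewrite le_max lexx.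
have k1 : 1 <= Num.max t 1 by rewrite le_max lexx orbT.
have [m [Km _ tm mP]] := first_after cK (K1 k1) kt.
have lt' : last_in cK K0 t < t.
  by rewrite lt_neqAle lt andbT; apply/eqP => h; apply: nKt; rewrite -h.
have tm' : t < m by rewrite lt_neqAle tm andbT; apply/eqP => h; apply: nKt; rewrite h.
exists (last_in cK K0 t, m); rewrite /= ?lt'//; split => //; first exact: lt_trans tm'.
move=> x /andP[lx xm] Kx; case: (lerP x t) => xt.
  by have := lP _ Kx xt; rewrite leNgt lx.
by have := mP _ Kx (ltW xt); rewrite leNgt xm.
Qed.

Lemma gap_disjoint p q p' q' x : gap K p q -> gap K p' q' -> p < x < q -> p' < x < q' ->
  p = p' /\ q = q'.
Proof.
move=> [Kp Kq pq n] [Kp' Kq' pq' n'] /andP[px xq] /andP[px' xq'].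
have pp : ~~ (p < p') by apply/negP => h; apply: (n p') => //; rewrite h (lt_trans px').
have pp' : ~~ (p' < p) by apply/negP => h; apply: (n' p) => //; rewrite h (lt_trans px).
have qq : ~~ (q < q') by apply/negP => h; apply: (n' q) => //; rewrite h andbT (lt_trans px').
have qq' : ~~ (q' < q) by apply/negP => h; apply: (n q') => //; rewrite h andbT (lt_trans px).
by rewrite -!leNgt in pp pp' qq qq'; split; apply/eqP; rewrite eq_le ?pp ?pp' ?qq ?qq'.
Qed.

Lemma last_in_gap p q x : gap K p q -> p < x < q -> last_in cK K0 x = p.
Proof.
move=> [Kp _ _ n] /andP[px xq]; have [Kl lx lP] := last_inP cK K0 x.
apply/eqP; rewrite eq_le (lP _ Kp (ltW px)) andbT leNgt; apply/negP => h.
by apply: (n (last_in cK K0 x)) => //; rewrite h (le_lt_trans lx).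
Qed.

Lemma gap01 p q : gap K p q -> 0 <= p /\ q <= 1.
Proof.
move=> [Kp Kq pq n]; split; rewrite leNgt; apply/negP => h.
- apply: (n (Num.min ((p + q) / 2) 0)); last by apply: K0; rewrite ge_min lexx orbT.
  by rewrite lt_min gt_min h andbT; lra.
- apply: (n (Num.max ((p + q) / 2) 1)); last by apply: K1; rewrite le_max lexx orbT.
  by rewrite lt_max gt_max h andbT; lra.
Qed.

(** Each gap is contracted on its own strip of the square. All but finitely many gaps are short, so
    [f] varies little on them and [best_fill] gives small fillings; this makes the pasting
    continuous. *)
Lemma htp_collapse_gaps : htp A f (fun t => f (last_in cK K0 t)).
Proof.
have [D D0 DP] := best_fill tg uv0.
have fillP (g : R * R) : exists H : R * R -> X, gap K g.1 g.2 -> [/\ continuous H,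
    forall z, A (H z), forall t, 0 <= t <= 1 -> H (0, t) = sub f g.1 g.2 t /\ H (1, t) = f g.1,
    forall s, 0 <= s <= 1 -> H (s, 0) = f g.1 /\ H (s, 1) = f g.1 &
    forall e, 0 < e -> (forall s t, 0 <= s <= 1 -> 0 <= t <= 1 ->
      mdist (sub f g.1 g.2 s) (sub f g.1 g.2 t) < D e) -> forall z w, mdist (H z) (H w) < e].
  have [gg|ng] := pselect (gap K g.1 g.2); last by exists (cst (f 0)).
  have h := gapK gg; have := htp_loop (g := sub f g.1 g.2).
  rewrite sub0 sub1 => /(_ _ h) fg.
  have [||B [BA [H [cH BH H0 H1 Hs]] Be]] := DP A (sub f g.1 g.2)
    PA (@continuous_sub _ _ _ g.1 g.2 cf).
  + by move=> t; exact: Af.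
  + by rewrite sub0.
  exists H => _; split => //.
  + by move=> [s t]; exact/BA/BH.
  + by move=> t t01; rewrite H0// H1//= sub0.
  + by move=> s s01; have := Hs s s01; rewrite sub0 sub1 -fg.
  + by move=> e e0 fe [s t] [s' t']; apply: Be.
have [H HP] := choice fillP.
pose O (g : R * R) : set (R * R) := [set z | gap K g.1 g.2 /\ g.1 < z.2 < g.2].
pose G (g z : R * R) := if `[< gap K g.1 g.2 >] then
  H g (clamp_real z.1, clamp_real ((z.2 - g.1) / (g.2 - g.1))) else f 0.
pose F (z : R * R) := if `[< K z.2 >] then f z.2 else
  G (xget (0, 0) [set g | O g z]) z.
have gE g : gap K g.1 g.2 -> forall z, G g z =
    H g (clamp_real z.1, clamp_real ((z.2 - g.1) / (g.2 - g.1))).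
  by move=> gg z; rewrite /G; case: asboolP.
have OK g z : O g z -> ~ K z.2 by move=> [[_ _ _ n] /n].
have disjO i j z : O i z -> O j z -> i = j.
  move=> [gi zi] [gj zj]; have [h1 h2] := gap_disjoint gi gj zi zj.
  by rewrite [i]surjective_pairing [j]surjective_pairing h1 h2.
have FG g z : O g z -> F z = G g z.
  move=> Oz; rewrite /F; case: asboolP => [|_]; first by move/OK: Oz.
  by case: xgetP => [j _ Oj|/(_ g)//]; rewrite (disjO _ _ _ Oz Oj).
have LK z : (forall i, ~ O i z) -> K z.2.
  by move=> Lz; have [//|[g gg gz]] := in_gap z.2; case: (Lz g).
have KL z : K z.2 -> F z = f z.2 by rewrite /F; case: asboolP.
have G0 g s t : gap K g.1 g.2 -> t <= g.1 -> G g (s, t) = f g.1.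
  move=> gg tg'; have [_ _ _ Hs _] := HP g gg; have [_ _ pq _] := gg.
  rewrite gE//= (clampr_le0 (_ : (t - g.1) / (g.2 - g.1) <= 0)); last first.
    by rewrite pmulr_lle0 ?invr_gt0; lra.
  by have [] := Hs _ (clampr_itv s).
have G1 g s t : gap K g.1 g.2 -> g.2 <= t -> G g (s, t) = f g.1.
  move=> gg tg'; have [_ _ _ Hs _] := HP g gg; have [_ _ pq _] := gg.
  rewrite gE//= (clampr_ge1 (_ : 1 <= (t - g.1) / (g.2 - g.1))); last first.
    by rewrite ler_pdivlMr; lra.
  by have [] := Hs _ (clampr_itv s).
have gap_end g : gap K g.1 g.2 -> f g.1 = f g.2.
  move=> /gapK h; have := @htp_loop R X A (sub f g.1 g.2); rewrite sub0 sub1; exact.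
have cF : continuous F.
  apply: (@continuous_pasting R X _ O G F) => //.
  - move=> g z [gg /andP[z1 z2]]; exists (Num.min (z.2 - g.1) (g.2 - z.2)).
      by rewrite lt_min; lra.
    move=> w [_]; rewrite lt_min !ltr_norml => /andP[h1 h2]; split => //; lra.
  - move=> g; rewrite /G; case: asboolP => [gg|_]; last exact: cont_cst.
    by have [cH _ _ _ _] := HP g gg; cts.
  - move=> g z Lz ad; have Kz := LK z Lz; rewrite (KL z Kz).
    have [w0 [gg _] _] := ad 1 ltr01.
    have [Kp Kq pq n] := gg.
    have zp : g.1 <= z.2.
      rewrite leNgt; apply/negP => h; have [|w [_ /andP[w1 w2]] [_]] := ad (g.1 - z.2); first lra.
      by rewrite ltr_norml; lra.
    have zq : z.2 <= g.2.
      rewrite leNgt; apply/negP => h; have [|w [_ /andP[w1 w2]] [_]] := ad (z.2 - g.2); first lra.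
      by rewrite ltr_norml; lra.
    rewrite [z]surjective_pairing; move: zp; rewrite le_eqVlt => /orP[/eqP zp|zp].
      by rewrite /= (G0 _ _ _ gg) -zp.
    move: zq; rewrite le_eqVlt => /orP[/eqP zq|zq]; last by case: (n z.2); rewrite ?zp.
    by rewrite /= (G1 _ _ _ gg) zq // gap_end.
  - move=> z e Lz e0; have [d d0 dP] := (contP f).1 cf z.2 e e0.
    exists d => // w Lw [_ zw]; rewrite !KL; [|exact: LK|exact: LK].
    by have := dP _ zw; rewrite ballEmdist.
  - move=> e e0; have [d d0 dP] := unif_cont01 cf (D0 e e0).
    have d2 : 0 < d / 2 by lra.
    have [gr grP] := grid d2.
    (* An oscillation of [e] requires a gap of length at least [d / 2], and such a gap contains a
       grid point. *)
    exists [seq (0, x) | x <- gr] => g z w zw.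
    have gg : gap K g.1 g.2.
      by apply: contrapT => ng; move: zw; rewrite /G; case: asboolP => // _;
        rewrite mdistxx leNgt e0.
    have [p0 q1] := gap01 gg; have [_ _ pq _] := gg.
    have gd : d / 2 <= g.2 - g.1.
      rewrite leNgt; apply/negP => h; have [_ _ _ _ He] := HP g gg.
      move: zw; rewrite !gE// leNgt He// => s t /andP[s0 s1] /andP[t0 t1].
      have := dP (g.1 + s * (g.2 - g.1)) (g.1 + t * (g.2 - g.1)).
      rewrite ballEmdist /=; apply; first by nra.
      by rewrite ltr_norml; nra.
    have [x xg xpq] := grP _ _ p0 q1 gd.
    by exists (0, x); [apply: map_f|].
have AF z : A (F z).
  rewrite /F; case: asboolP => // _; rewrite /G; case: asboolP => // gg.
  by have [_ AH _ _ _] := HP _ gg.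
have FE z : F z = f z.2 \/ exists2 g, O g z & F z = G g z.
  have [Kz|[g gg gz]] := in_gap z.2; first by left; exact: KL.
  by right; exists g => //; apply: FG.
have cl01 (g : R * R) t : gap K g.1 g.2 -> g.1 < t < g.2 -> 0 <= (t - g.1) / (g.2 - g.1) <= 1.
  move=> [_ _ pq _] /andP[t1 t2]; rewrite divr_ge0; [|lra|lra].
  by rewrite ler_pdivrMr; lra.
exists F; split.
- exact: cF.
- by move=> s t; exact: AF.
- move=> t t01; have [->//|[g [gg gt] ->]] := FE (0, t).
  have [_ _ Ht _ _] := HP g gg; have c := cl01 g t gg gt.
  rewrite gE//= clampr0 clampr_id// (Ht _ c).1 /sub divfK; first by congr f; ring.
  by have [_ _ pq _] := gg; rewrite subr_eq0 gt_eqF.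
- move=> t t01; have [Kt|[g gg gt]] := in_gap t; first by rewrite KL// last_in_id.
  have Og : O g (1, t) by [].
  have [_ _ Ht _ _] := HP g gg; rewrite (FG _ _ Og) gE//= clampr1 (last_in_gap gg gt).
  by rewrite (Ht _ (clampr_itv _)).2.
- by move=> s s01; rewrite !KL//; [exact: K1|exact: K0].
Qed.

End insertion.

(** * Fillings of chords and of the loop *)

Section triangle.
Context (R : realType) (X : metricType R) (P : set (set X)).
Hypotheses (tg : disjointly_tree_graded P) (uv0 : uniformly_1_UV0 (Pc P)).

(* The null-homotopic loop [f] is first made non-constant on every interval; a filling
   of the resulting loop is then pulled back to the triangle. *)
Lemma fill_triangle : exists2 D : R -> R, (forall e, 0 < e -> 0 < D e) &
  forall A (f : R -> X), P A -> continuous f -> (forall t, A (f t)) ->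
    (forall t, t <= 0 -> f t = f 0) -> (forall t, 1 <= t -> f t = f 1) ->
    htp A f (cst (f 0)) -> exists G : R * R -> X,
  [/\ continuous G, forall u v, u <= v -> const_on f u v -> G (u, v) = f u,
     forall u v, const_on f 0 u -> G (u, v) = f 0,
     forall u v, const_on f v 1 -> G (u, v) = f 0 &
     forall e, 0 < e -> (forall s t, mdist (f s) (f t) < D e) ->
       forall z w, mdist (G z) (G w) < e].
Proof.
have [D D0 DP] := best_fill tg uv0; exists D => // A f PA cf Af f0 f1 null.
have [cst01|nc] := pselect (const_on f 0 1).
  have fE t : f t = f 0.
    case: (lerP t 0) => [/f0//|t0]; case: (lerP t 1) => [t1|/ltW/f1 ->].
      by apply: cst01; rewrite ltW.
    by apply: cst01; rewrite lexx ler01.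
  exists (cst (f 0)); split => //; first by move=> z; exact: cvg_cst.
  by move=> e e0 _ z w; rewrite mdistxx.
have [phi [g [[cphi cg fg] [phim phi0 phi1 phionto phic]]]] := monotone_factorisation cf f0 f1 nc.
have phi01 t : 0 <= phi t <= 1.
  apply/andP; split; [case: (lerP t 0) => [/phi0 -> //|/ltW t0]|case: (lerP 1 t) => [/phi1 ->
    //|/ltW t1]].
    by rewrite -(phi0 0)// phim.
  by rewrite -(phi1 1)// phim.
pose k (t : R) := g (clamp_real t).
have ck : continuous k by rewrite /k; cts.
have kphi t : k (phi t) = f t by rewrite /k clampr_id// fg.
have Ak t : A (k t).
  by rewrite /k; have [s _ <-] := phionto _ (clampr_itv t); rewrite -fg.
have k0 : k 0 = f 0 by have := kphi 0; rewrite phi0.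
have knull : htp A k (cst (k 0)).
  (* [f] is [k \o phi], and [phi] has the same ends as the identity. *)
  rewrite k0; apply: htp_trans null; apply: (@htp_eq _ _ _ (k \o id) (k \o phi)) => //.
    apply: htp_reparam => //=; [exact: cont_id|by rewrite phi0|by rewrite phi1].
  by move=> t _ /=; rewrite kphi.
have [B [_ [H [cH BH H0 H1 Hs]] Be]] := DP A k PA ck Ak knull.
have k1 : k 1 = k 0 by have [_ h] := htp_ends knull.
(* Write [p = phi u] and [q = phi v]. For [p = q] this is [H (0, p)]. For [p = 0] the second
   coordinate clamps to 0. For [q = 1] the first clamps to 1 if [p <= 3 / 4], and otherwise the
   second does because [2 * (2 * p - 1) >= 1]. So both sides go to the base point. *)
pose G (z : R * R) := H (clamp_real (4 * (phi z.2 - phi z.1)),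
  clamp_real (phi z.1 + 2 * (phi z.2 - phi z.1) * (2 * phi z.1 - 1))).
have bd s t : 0 <= s <= 1 -> t = 0 \/ t = 1 -> H (s, t) = f 0.
  by move=> s01; have [h0 h1] := Hs s s01; case=> ->; rewrite -k0// h1 k1.
exists G; split.
- by rewrite /G; cts.
- move=> u v uv /(phic _ _ uv) pv.
  by rewrite /G /= -pv subrr mulr0 clampr0 mulr0 mul0r addr0 H0 ?clampr_itv // clampr_id // kphi.
- move=> u v c0u; have pu : phi u = 0.
    by case: (lerP u 0) => [/phi0//|/ltW u0]; rewrite -(phi0 0)//; apply/esym/phic.
  rewrite /G /= pu; apply: bd; [exact: clampr_itv|left; rewrite clampr_le0//].
  by have /andP[] := phi01 v; lra.
- move=> u v cv1; have pv : phi v = 1.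
    by case: (lerP 1 v) => [/phi1//|/ltW v1]; rewrite -(phi1 1)//; apply/phic.
  rewrite /G /= pv; have /andP[u0 u1] := phi01 u; case: (lerP (phi u) (3 / 4)) => u34.
    by rewrite clampr_ge1 ?H1 ?clampr_itv//; lra.
  by apply: bd; [exact: clampr_itv|right; rewrite clampr_ge1//; nra].
- move=> e e0 fe [u v] [u' v']; apply: (Be e e0) => [s t /phionto[s' _ <-] /phionto[t' _ <-]||];
    [|exact: BH..].
  by rewrite !kphi.
Qed.

End triangle.

(** Compactness of [0, 1], in which [a] varies; this will show that [Lu] and [Lv] are closed. *)
Lemma closed_shadow (R : realType) (T : R -> R -> Prop) y0 x0 :
  (forall a x, (forall e, 0 < e -> exists a' x', [/\ T a' x', `|a - a'| < e & `|x - x'| < e]) ->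
    T a x) ->
  (forall a x, T a x -> 0 <= a <= 1) ->
  (forall d, 0 < d -> exists y x a, [/\ `|y0 - y| < d, `|x0 - x| < d, a <= y & T a x]) ->
  exists2 a, a <= y0 & T a x0.
Proof.
move=> Tcl T01 ad.
pose B (d : R) := [set a | exists y x, [/\ `|y0 - y| < d, `|x0 - x| < d, a <= y & T a x]].
pose Fl := filter_from [set d : R | 0 < d] B.
have FlF : ProperFilter Fl.
  apply: filter_from_proper; last by move=> d /ad [y [x [a h]]]; exists a, y, x.
  apply: filter_from_filter; first by exists 1 => /=.
  move=> d d' /= d0 d'0; exists (Num.min d d'); first by rewrite /= lt_min d0.
  move=> a [y [x []]]; rewrite !lt_min => /andP[h1 h1'] /andP[h2 h2'] ay Tax.
  by split; exists y, x.
have [|a [_ clu]] := @segment_compact R 0 1 Fl FlF.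
  by exists 1; [exact: ltr01|move=> a [y [x [_ _ _ /T01]]]; rewrite /= in_itv].
have near e : 0 < e -> exists a' y x, [/\ `|a - a'| < e, `|y0 - y| < e, `|x0 - x| < e,
  a' <= y & T a' x].
  move=> e0; have [||a' [[y [x [h1 h2 h3 h4]]] h5]] := clu (B e) (ball a e).
  - by exists e.
  - exact: nbhsx_ballx.
  by exists a', y, x.
exists a; last by apply: Tcl => e /near [a' [y [x [h1 _ h3 _ h4]]]]; exists a', x.
rewrite leNgt; apply/negP => h; have [|a' [y [x [h1 h2 _ h3 _]]]] := near ((a - y0) / 2); first lra.
by move: h1 h2; rewrite !ltr_norml; lra.
Qed.

Section null.
Context (R : realType) (X : metricType R) (P : set (set X)).
Hypotheses (pdm : path_diameter_metric X) (tg : disjointly_tree_graded P)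
  (uv0 : uniformly_1_UV0 (Pc P)).
Context (a : R -> X).
Hypothesis ca : continuous a.

Lemma good_retr_null A (PA : P A) s t : good P a s t ->
  htp A (sub (retr tg PA \o a) s t) (cst (retr tg PA (a s))).
Proof.
move=> st; have cr := continuous_retr pdm (tg := tg) (PA := PA).
have cra : continuous (retr tg PA \o a) by exact: cont_comp.
have := @null_of_small R X P tg uv0 A (sub (retr tg PA \o a) s t) PA (continuous_sub cra).
rewrite sub0 sub1 /=; apply.
- by move=> x; exact: retr_in.
- by rewrite (good_eq pdm tg st).
move=> e e0; have [q [cq hq qe]] := st _ e (fin1 PA) e0.
have kc : forall B y z, P B -> ~ [set A] B -> B y -> B z -> retr tg PA y = retr tg PA z.
  by move=> B y z PB nB; apply: (retr_piece tg PA PB) => // BA; exact: nB.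
have rl y z : mdist (retr tg PA y) (retr tg PA z) <= 1 * mdist y z by rewrite mul1r retr_lip.
have db (v w : X) e' : mdist v w < e' -> ball v e' w by rewrite ballEmdist.
have cd := continuous_descend db (@metric_triangle _ _) ltr01 rl kc.
exists (descend (retr tg PA) \o q); split.
- exact: cont_comp.
- by move=> x; exact: retr_in.
- have h := htp_map (B := A) cd (fun y _ => retr_in tg PA (repr y)) hq.
  by apply: (htp_eq h) => // x _; rewrite /sub /proj /= (descendE kc).
- move=> x y x01 y01 /=; have := descend_lip (@metric_triangle _ _) ltr01 rl kc (q x) (q y).
  by rewrite mul1r => h; apply: le_lt_trans h (qe _ _ x01 y01).
Qed.

Context (C : set (R * R)) (lC : laminar (good P a) C)
  (mC : forall c, is_chord (good P a) c -> (forall c', C c' -> ~ cross c c' /\ ~ cross c' c) ->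
    C c).

Lemma good_closed s t : (forall e, 0 < e ->
  exists s' t', [/\ `|s - s'| < e, `|t - t'| < e & good P a s' t']) -> good P a s t.
Proof.
move=> h; apply: good_limit => // F d e fF d0 e0.
by have [s' [t' [h1 h2 g]]] := h e e0; exists s', t'; split => //; exact: g.
Qed.

Lemma chord_eq c : C c -> a c.1 = a c.2.
Proof. by move=> /lC.1 [_ _ _ /(good_eq pdm tg)]. Qed.

(* The filling of the loop obtained from [a] by skipping the complement of [c] and the
   gaps of its core, which lies in a piece. *)
Lemma chord_filling : exists2 D : R -> R, (forall e, 0 < e -> 0 < D e) &
  forall c, C c -> exists G : R * R -> X, continuous G /\
  [/\ forall u, core C c u -> c.1 <= u <= c.2 -> G (u, u) = a u,
      forall p q u v, gap (core C c) p q -> p <= u -> u <= v -> v <= q -> G (u, v) = a p,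
      forall u v, u <= c.1 -> G (u, v) = a c.1,
      forall u v, c.2 <= v -> G (u, v) = a c.1 &
      forall e, 0 < e -> (forall t, core C c t -> c.1 <= t <= c.2 -> mdist (a c.1) (a t) < D e) ->
        forall z w, mdist (G z) (G w) < e].
Proof.
have [D D0 DP] := fill_triangle tg uv0.
(* Sizes are measured from [a c.1] here, but between arbitrary points in [fill_triangle]. *)
exists (fun e => D e / 2); first by move=> e /D0; lra.
move=> c Cc; have [c0 c12 c1 _] := lC.1 _ Cc.
pose K := core C c.
have cK : closed K by exact: core_closed.
have K0 t : t <= 0 -> K t by move=> h; apply: core_left; lra.
have K1 t : 1 <= t -> K t by move=> h; apply: core_right; lra.
have Kc1 : K c.1 by exact: core_left.
have Kc2 : K c.2 by exact: core_right.
have gapC p q : gap K p q -> C (p, q) by exact: (core_gap_chord good_closed lC mC).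
have gap_in p q : gap K p q -> c.1 <= p /\ q <= c.2 by exact: core_gap_in.
have ac := chord_eq Cc.
have [cst_core|nc] := pselect (forall t, K t -> c.1 <= t <= c.2 -> a t = a c.1).
  (* In this case [a c.1] may lie in no piece. *)
  exists (cst (a c.1)); split; first by move=> z; exact: cvg_cst.
  split => //.
  - by move=> u Ku cu; rewrite cst_core.
  - move=> p q u v pq _ _ _; rewrite cst_core//; first by have [] := pq.
    by have [h1 h2] := gap_in _ _ pq; have [_ _ ? _] := pq; lra.
  - by move=> e e0 _ z w; rewrite mdistxx.
have [t0 [Kt0 ct0 at0]] : exists t, [/\ K t, c.1 <= t <= c.2 & a t <> a c.1].
  apply: contrapT => h; apply: nc => t Kt ct; apply: contrapT => at_.
  by apply: h; exists t.
have piece s t : K s -> K t -> c.1 <= s <= c.2 -> c.1 <= t <= c.2 -> a s <> a t ->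
    exists2 A, P A & A (a s) /\ A (a t).
  move=> Ks Kt /andP[s1 s2] /andP[t1 t2] st.
  case: (ltgtP s t) => [lt_st|lt_ts|e]; last by rewrite e in st.
    exact: (core_single_piece pdm tg ca lC mC Cc).
  have [|A PA [At As]] := core_single_piece pdm tg ca lC mC Cc t1 lt_ts s2 Kt Ks;
    first exact: nesym.
  by exists A.
have c1c : c.1 <= c.1 <= c.2 by rewrite lexx.
have [A PA [At0 Ac1]] := piece t0 c.1 Kt0 Kc1 ct0 c1c at0.
have Acore t : K t -> c.1 <= t <= c.2 -> A (a t).
  move=> Kt ct; have [->//|tc] := pselect (a t = a c.1).
  have [B PB [Bt Bc]] := piece t c.1 Kt Kc1 ct c1c tc.
  by rewrite (piece_eq tg PA PB Ac1 Bc).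
pose r := retr tg PA; have cr : continuous r by exact: continuous_retr.
pose cl (t : R) := Num.max c.1 (Num.min t c.2).
have ccl : continuous cl by rewrite /cl; cts.
have cl_in t : c.1 <= cl t <= c.2 by rewrite le_max lexx /= ge_max c12 ge_min lexx orbT.
have cl_id t : c.1 <= t <= c.2 -> cl t = t.
  by move=> /andP[t1 t2]; rewrite /cl (min_idPl t2) (max_idPr t1).
have cl_le t : t <= c.1 -> cl t = c.1.
  by move=> t1; rewrite /cl (max_idPl _)// ge_min t1.
have cl_ge t : c.2 <= t -> cl t = c.2.
  by move=> t1; rewrite /cl (min_idPr t1) (max_idPr c12).
have clK t : K t -> K (cl t).
  move=> Kt; case: (lerP t c.1) => [/cl_le -> //|t1]; case: (lerP c.2 t) => [/cl_ge -> //|t2].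
  by rewrite cl_id// !ltW.
pose k (t : R) := r (a (cl t)).
have ck : continuous k by rewrite /k; cts.
have Ak t : A (k t) by exact: retr_in.
have kE t : K t -> k t = a (cl t) by move=> /clK Kt; rewrite /k /r retr_id//; exact: Acore.
have gapk p q : gap K p q -> htp A (sub k p q) (cst (k p)).
  move=> pq; have [p1 q2] := gap_in _ _ pq; have [Kp Kq lt_pq _] := pq.
  have [_ _ _ gpq] := lC.1 _ (gapC _ _ pq); apply: (htp_eq (good_retr_null PA gpq)) => /=.
    move=> t /andP[t1 t2]; rewrite /sub /= /k cl_id//; nra.
  by move=> t _; rewrite /k cl_id//; lra.
have gap_end p q : gap K p q -> k p = k q.
  by move=> /gapk h; have := @htp_loop R X A (sub k p q); rewrite sub0 sub1; exact.
pose f (t : R) := k (last_in cK K0 t).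
have cf : continuous f by exact: continuous_collapse_gaps.
have fK t : K t -> f t = a (cl t) by move=> Kt; rewrite /f last_in_id// kE.
have f_le t : t <= c.1 -> f t = a c.1 by move=> t1; rewrite fK ?cl_le//; exact: core_left.
have f_ge t : c.2 <= t -> f t = a c.1 by move=> t1; rewrite fK ?cl_ge//; exact: core_right.
have fgap p q t : gap K p q -> p <= t <= q -> f t = a p.
  move=> pq /andP[pt tq]; have [p1 q2] := gap_in _ _ pq; have [Kp Kq lt_pq _] := pq.
  move: pt; rewrite le_eqVlt => /orP[/eqP <-|pt]; first by rewrite fK// cl_id//; lra.
  move: tq; rewrite le_eqVlt => /orP[/eqP ->|tq].
    by rewrite fK// (chord_eq (gapC _ _ pq)) cl_id//=; lra.
  by rewrite /f (last_in_gap _ _ pq) ?pt// kE// cl_id//; lra.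
have f0 : f 0 = a c.1 by exact: f_le.
have knull : htp A k (cst (k 0)).
  have kk : htp A k (sub (r \o a) c.1 c.2).
    apply: (@htp_eq _ _ _ ((r \o a) \o cl) ((r \o a) \o (fun t => c.1 + t * (c.2 - c.1)))) => //.
    apply: htp_reparam => //.
    - exact: cont_comp.
    - by cts.
    - by move=> s t _ _; exact: retr_in.
    - by rewrite cl_le// mul0r addr0.
    - by rewrite cl_ge// mul1r addrC subrK.
  have [_ _ _ gc] := lC.1 _ Cc; apply: htp_trans kk _.
  apply: (htp_eq (good_retr_null PA gc)) => // t _ /=.
  by rewrite /k cl_le.
have fnull : htp A f (cst (f 0)).
  have k0 : k 0 = a c.1 by rewrite (kE _ (K0 _ (lexx _))) cl_le.
  rewrite f0 -k0.
  by apply: htp_trans knull; apply: htp_sym;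
    exact: (htp_collapse_gaps tg uv0 PA ck Ak cK K0 K1 gapk).
have [||||G [cG G1 G2 G3 G4]] := DP A f PA cf.
- by move=> t; exact: Ak.
- by move=> t t0'; rewrite f0 f_le//; lra.
- by move=> t t1; rewrite f_ge ?f_ge//; lra.
- exact: fnull.
exists G; split => //; split.
- move=> u Ku cu; rewrite G1//; first by rewrite fK// cl_id.
  by move=> x xu; congr f; lra.
- move=> p q u v pq pu uv vq; rewrite G1//; first by apply: (fgap p q) => //; lra.
  by move=> x xu; rewrite !(fgap p q)//; lra.
- by move=> u v uc; rewrite G2// => x xu; rewrite !f_le//; lra.
- by move=> u v vc; rewrite G3// => x xu; rewrite !f_ge//; lra.
- move=> e e0 hD; apply: G4 => // s t.
  have hf x : mdist (a c.1) (f x) < D e / 2.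
    have [Kl _ _] := last_inP cK K0 x; rewrite /f kE//; apply: hD => //; exact: clK.
  have := hf s; have := hf t; have := metric_triangle (f s) (a c.1) (f t).
  by rewrite [mdist (f s) (a c.1)]metric_sym; lra.
Qed.

End null.

(** * Pasting the fillings of all chords *)

Section assembly.
Context (R : realType) (X : metricType R) (P : set (set X)).
Hypotheses (pdm : path_diameter_metric X) (tg : disjointly_tree_graded P)
  (uv0 : uniformly_1_UV0 (Pc P)).
Context (a : R -> X).
Hypotheses (ca : continuous a) (a0 : forall t, t <= 0 -> a t = a 0)
  (a1 : forall t, 1 <= t -> a t = a 1) (g01 : good P a 0 1).
Context (C : set (R * R)) (lC : laminar (good P a) C)
  (mC : forall c, is_chord (good P a) c -> (forall c', C c' -> ~ cross c c' /\ ~ cross c' c) ->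
    C c).

(* Outside the open sets filled by the chords, the map is [a z.1] on [Lu] and [a z.2] on
   [Lv]. *)
Let Lu (z : R * R) := [\/ z.2 <= z.1, z.1 <= 0 | exists2 b, z.2 <= b & C (z.1, b)].
Let Lv (z : R * R) := z.1 <= z.2 /\ (1 <= z.2 \/ exists2 b, b <= z.1 & C (b, z.2)).

Let C_eq s t : C (s, t) -> a s = a t.
Proof. by move=> h; exact: (chord_eq pdm tg lC h). Qed.

Let a01 : a 0 = a 1. Proof. by have h := good_eq pdm tg g01. Qed.

Let C01 s t : C (s, t) -> [/\ 0 <= s, s <= t & t <= 1].
Proof. by move=> /lC.1 [? ? ? _]. Qed.

Let C_limit s t : (forall e, 0 < e -> exists s' t', [/\ C (s', t'),
  `|s - s'| < e & `|t - t'| < e]) ->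
  C (s, t).
Proof.
move=> h; apply: (chord_limit (good_closed (P := P) ca) lC mC) => e /h [s' [t' [? ? ?]]].
by exists (s', t').
Qed.

(** Chords (z.1, b) and (b', z.2) with [b' < z.1 < z.2 < b] would cross. *)
Let luv z : Lu z -> Lv z -> a z.1 = a z.2.
Proof.
move=> lu [le_z lv]; move: le_z; rewrite le_eqVlt => /orP[/eqP -> //|ltz].
case: lu => [|z0|[b zb Cb]]; first by rewrite leNgt ltz.
  case: lv => [z1|[b bz Cb]]; first by rewrite (a0 z0) (a1 z1).
  by have [b0 _ _] := C01 Cb; rewrite -(C_eq Cb); congr a; lra.
have [z0 _ b1] := C01 Cb.
case: lv => [z1|[b' bz Cb']]; first by rewrite (C_eq Cb); congr a; lra.
move: zb; rewrite le_eqVlt => /orP[/eqP ->|zb]; first exact: C_eq.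
move: bz; rewrite le_eqVlt => /orP[/eqP <-|bz]; first exact: C_eq.
by have := lC.2 _ _ Cb' Cb; case.
Qed.

Let Lu_closed z : ~ Lu z -> exists2 d, 0 < d & forall w, near2 d z w -> ~ Lu w.
Proof.
move=> nL; have z12 : z.1 < z.2 by rewrite ltNge; apply/negP => h; apply: nL; exact: Or31.
have z1 : 0 < z.1 by rewrite ltNge; apply/negP => h; apply: nL; exact: Or32.
have [d d0 dP] : exists2 d, 0 < d & forall w, near2 d z w -> ~ exists2 b, w.2 <= b & C (w.1, b).
  apply: contrapT => h; apply: nL; apply: Or33.
  (* The reflection [1 - b] turns the lower bound on [b] into an upper one. *)
  have [|||b bz Cb] := @closed_shadow R (fun b x => C (x, 1 - b)) (1 - z.2) z.1.
  - move=> b x lim; apply: C_limit => e /lim [b' [x' [h1 h2 h3]]].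
    by exists x', (1 - b'); split => //; move: h2; rewrite !ltr_norml; lra.
  - by move=> b x /C01 [? ? ?]; lra.
  - move=> d d0; apply: contrapT => h'; apply: h; exists d => // w [w1 w2] [b wb Cb].
    apply: h'; exists (1 - w.2), w.1, (1 - b); rewrite subKr; split => //; last lra.
    by move: w2; rewrite !ltr_norml; lra.
  by exists (1 - b) => //; lra.
exists (Num.min d (Num.min z.1 ((z.2 - z.1) / 2))).
  by rewrite !lt_min d0 z1; lra.
move=> w [+ +]; rewrite !lt_min => /and3P[h1 h2 h3] /and3P[h4 h5 h6].
case; [|move=> h|exact: dP].
  by move: h3 h6; rewrite !ltr_norml; lra.
by move: h2; rewrite ltr_norml; lra.
Qed.

Let Lv_closed z : ~ Lv z -> exists2 d, 0 < d & forall w, near2 d z w -> ~ Lv w.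
Proof.
move=> nL; case: (lerP z.1 z.2) => z12; last first.
  exists ((z.1 - z.2) / 2); first lra.
  by move=> w [+ +] [w12 _]; rewrite !ltr_norml; lra.
have z1 : z.2 < 1 by rewrite ltNge; apply/negP => h; apply: nL; split => //; left.
have [d d0 dP] : exists2 d, 0 < d & forall w, near2 d z w -> ~ exists2 b, b <= w.1 & C (b, w.2).
  apply: contrapT => h; apply: nL; split => //; right.
  apply: (@closed_shadow R (fun b x => C (b, x)) z.1 z.2).
  - by move=> b x lim; apply: C_limit => e /lim [b' [x' [h1 h2 h3]]]; exists b', x'.
  - by move=> b x /C01 [? ? ?]; lra.
  - move=> d d0; apply: contrapT => h'; apply: h; exists d => // w [w1 w2] [b wb Cb].
    by apply: h'; exists w.1, w.2, b.
exists (Num.min d (1 - z.2)); first by rewrite lt_min d0; lra.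
move=> w [+ +]; rewrite !lt_min => /andP[h1 h2] /andP[h3 h4] [_ []]; last exact: dP.
by move: h4; rewrite ltr_norml; lra.
Qed.

(** A core time between the two times means that no smaller chord encloses both; the strict
    inequalities make the set open. *)
Let O (c z : R * R) := [/\ C c, c.1 < z.1, z.2 < c.2 & exists2 t, core C c t & z.1 < t < z.2].

Let core_K0 c : C c -> forall t, t <= 0 -> core C c t.
Proof. by move=> /lC.1 [c0 _ _ _] t t0; apply: core_left; lra. Qed.

Let core_K1 c : C c -> forall t, 1 <= t -> core C c t.
Proof. by move=> /lC.1 [_ _ c1 _] t t1; apply: core_right; lra. Qed.

Let gap_chord c p q : gap (core C c) p q -> C (p, q).
Proof. exact: (core_gap_chord (good_closed (P := P) ca) lC mC). Qed.

Let core_between c u v : C c -> u < v -> (exists2 t, core C c t & u < t < v) \/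
  exists p q, [/\ gap (core C c) p q, p <= u & v <= q].
Proof.
move=> Cc uv; have [h|nh] := pselect (exists2 t, core C c t & u < t < v); [by left|right].
have nK t : u < t < v -> ~ core C c t by move=> ut Kt; apply: nh; exists t.
have m : u < (u + v) / 2 < v by lra.
have [/(nK _ m)//|[[p q] /= pq mpq]] :=
  in_gap (@core_closed R C c) (core_K0 Cc) (core_K1 Cc) ((u + v) / 2).
have [Kp Kq _ _] := pq; exists p, q; split => //; rewrite leNgt; apply/negP => h.
- by apply: nK Kp; lra.
- by apply: nK Kq; lra.
Qed.

Let O_open c z : O c z -> exists2 d, 0 < d & forall w, near2 d z w -> O c w.
Proof.
move=> [Cc z1 z2 [t Kt /andP[t1 t2]]].
exists (Num.min (Num.min (z.1 - c.1) (c.2 - z.2)) (Num.min (t - z.1) (z.2 - t))).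
  by rewrite !lt_min; lra.
move=> w [+ +]; rewrite !lt_min !ltr_norml => h1 h2; split => //; try lra.
by exists t => //; lra.
Qed.

Let O_disj c c' z : O c z -> O c' z -> c = c'.
Proof.
move=> [Cc z1 z2 [t Kt tz]] [Cc' z1' z2' [t' Kt' tz']]; apply: contrapT => cc'.
have n1 := lC.2 _ _ Cc Cc'; have n2 := lC.2 _ _ Cc' Cc.
have [[h1 h2]|[h1 h2]] : encloses c c'.1 c'.2 \/ encloses c' c.1 c.2.
  rewrite /encloses; case: (lerP c.1 c'.1) => h1; case: (lerP c'.2 c.2) => h2;
    try by [left|right; lra].
  - move: h1; rewrite le_eqVlt => /orP[/eqP h1|h1]; first by right; lra.
    by case: n1; split => //; lra.
  - move: h2; rewrite le_eqVlt => /orP[/eqP h2|h2]; first by right; lra.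
    by case: n2; split => //; lra.
- by apply: (Kt c') => //; [split => //; exact/nesym|lra].
- by apply: (Kt' c) => //; lra.
Qed.

(** Take the smallest chord around the two times. If they are strictly inside it and no core time is
    strictly between them, they lie in a closed gap of its core. The gap is a chord, so by
    minimality it is the whole chord; but then a proper subchord still encloses the two times, a
    contradiction. *)
Let L_cover z : (forall c, ~ O c z) -> Lu z \/ Lv z.
Proof.
move=> Lz; case: (lerP z.2 z.1) => z12; first by left; exact: Or31.
case: (lerP z.1 0) => z1; first by left; exact: Or32.
case: (lerP 1 z.2) => z2; first by right; split; [exact: ltW|left].
have [c [Cc [cz1 cz2] cmin]] := minimal_chord g01 (good_closed (P := P) ca) lC mC (ltW z1)
  z12 (ltW z2).
have Cc' : C (c.1, c.2) by rewrite -surjective_pairing.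
move: cz1; rewrite le_eqVlt => /orP[/eqP cz1|cz1].
  by left; apply: Or33; exists c.2; rewrite -?cz1.
move: cz2; rewrite le_eqVlt => /orP[/eqP cz2|cz2].
  by right; split; [exact: ltW|right; exists c.1; [exact: ltW|rewrite cz2]].
have [Kt|[p [q [pq pz zq]]]] := core_between Cc z12; first by case: (Lz c).
have [pc1 cq2] := cmin _ (gap_chord pq) (conj pz zq); rewrite /= in pc1 cq2.
have [||c' [Cc'' [ec1 ec2] nc] [h1 h2]] := core_gap_proper lC pq (u := z.1) (v := z.2)
  _ (ltW z12) _; [lra|lra|].
have [ec1' ec2'] := cmin _ Cc'' (conj (ltW h1) (ltW h2)).
by case: nc; rewrite [c']surjective_pairing [c]surjective_pairing; congr (_, _); lra.
Qed.

Lemma chords_null : htp setT a (cst (a 0)).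
Proof.
have [D D0 DP] := chord_filling pdm tg uv0 ca lC mC.
have /choice [G GP] c : exists G : R * R -> X, continuous G /\ (~ C c -> G = cst (a 0)) /\ (C c ->
  [/\ forall u, core C c u -> c.1 <= u <= c.2 -> G (u, u) = a u,
      forall p q u v, gap (core C c) p q -> p <= u -> u <= v -> v <= q -> G (u, v) = a p,
      forall u v, u <= c.1 -> G (u, v) = a c.1,
      forall u v, c.2 <= v -> G (u, v) = a c.1 &
      forall e, 0 < e -> (forall t, core C c t -> c.1 <= t <= c.2 -> mdist (a c.1) (a t) < D e) ->
        forall z w, mdist (G z) (G w) < e]).
  have [Cc|nC] := pselect (C c); last by exists (cst (a 0)); split => // z; exact: cvg_cst.
  by have [G [cG h]] := DP c Cc; exists G.
pose F (z : R * R) := match pselect (exists c, O c z) with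
  | left h => G (sval (cid h)) z
  | right _ => if `[< Lu z >] then a z.1 else a z.2 end.
have FG c z : O c z -> F z = G c z.
  move=> Oz; rewrite /F; case: pselect => [h|nh]; last by case: nh; exists c.
  by rewrite (O_disj (svalP (cid h)) Oz).
have FL z : (forall c, ~ O c z) -> F z = if `[< Lu z >] then a z.1 else a z.2.
  by move=> Lz; rewrite /F; case: pselect => [[c Oz]|//]; case: (Lz c).
have FU z : (forall c, ~ O c z) -> Lu z -> F z = a z.1.
  by move=> /FL -> lu; case: asboolP.
have FV z : (forall c, ~ O c z) -> Lv z -> F z = a z.2.
  by move=> /FL -> lv; case: asboolP => // lu; exact: luv.
have cF : continuous F.
  apply: (@continuous_pasting R X _ O G F) => //.
  - by move=> c; have [] := GP c.
  (* On the frontier of [O c], either [u = v] is a core time, or [u] or [v] is the corresponding end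
     of [c] or of a gap of its core; the properties in [chord_filling] match these cases. *)
  - move=> c [u v] Lz ad.
    have Cc : C c by have [w []] := ad 1 ltr01.
    have [_ [_ /(_ Cc) [G1 G2 G3 G4 _]]] := GP c.
    have cu : c.1 <= u.
      rewrite leNgt; apply/negP => h; have [|w [_ w1 w2 [t _ tw]] []] := ad (c.1 - u); first lra.
      by rewrite /= !ltr_norml; lra.
    have vc : v <= c.2.
      rewrite leNgt; apply/negP => h; have [|w [_ w1 w2 [t _ tw]] []] := ad (v - c.2); first lra.
      by rewrite /= !ltr_norml; lra.
    have uv : u <= v.
      rewrite leNgt; apply/negP => h; have [|w [_ w1 w2 [t _ tw]] []] := ad ((u - v) / 2);
        first lra.
      by rewrite /= !ltr_norml; lra.
    have ngap p q : gap (core C c) p q -> p < u -> v < q -> False.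
      move=> [_ _ _ n] pu vq.
      have [|w [_ w1 w2 [t Kt tw]] []] := ad (Num.min (u - p) (q - v)); first by rewrite lt_min;
        lra.
      by rewrite /= !lt_min !ltr_norml => h1 h2; apply: (n t) => //; lra.
    have Cc' : C (c.1, c.2) by rewrite -surjective_pairing.
    move: uv; rewrite le_eqVlt => /orP[/eqP uv|uv].
      rewrite -uv in Lz vc ngap *; rewrite (FU _ Lz); last by apply: Or31.
      rewrite G1//; last by rewrite cu.
      have [//|[[p q] /= pq /andP[pu uq]]] :=
        in_gap (@core_closed R C c) (core_K0 Cc) (core_K1 Cc) u.
      by case: (ngap _ _ pq).
    move: cu; rewrite le_eqVlt => /orP[/eqP cu|cu].
      rewrite G3 ?cu// (FU _ Lz) -?cu//; apply: Or33; exists c.2 => //.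
    move: vc; rewrite le_eqVlt => /orP[/eqP vc|vc].
      have lv : Lv (u, v) by split; [exact: ltW|right; exists c.1; [exact: ltW|rewrite /= vc]].
      by rewrite (FV _ Lz lv) G4 /= vc// (C_eq Cc').
    have [Kt|[p [q [pq pu vq]]]] := core_between Cc uv; first by case: (Lz c).
    have Cpq := gap_chord pq.
    rewrite (G2 p q)//; last exact: ltW.
    move: (pu); rewrite le_eqVlt => /orP[/eqP pu'|pu'].
      by rewrite (FU _ Lz) ?pu'//; apply: Or33; exists q; rewrite -?pu'.
    move: (vq); rewrite le_eqVlt => /orP[/eqP vq'|vq']; last by case: (ngap p q).
    rewrite (FV _ Lz) /=; first by rewrite vq' (C_eq Cpq).
    by split; [exact: ltW|right; exists p; rewrite ?vq'].
  - move=> z e Lz e0.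
    have [d1 d10 dP1] := (contP a).1 ca z.1 e e0; have [d2 d20 dP2] := (contP a).1 ca z.2 e e0.
    have [d3 d30 dP3] : exists2 d, 0 < d & (~ Lu z -> forall w, near2 d z w -> ~ Lu w).
      have [lu|/Lu_closed [d d0 dP]] := pselect (Lu z); [by exists 1|by exists d].
    have [d4 d40 dP4] : exists2 d, 0 < d & (~ Lv z -> forall w, near2 d z w -> ~ Lv w).
      have [lu|/Lv_closed [d d0 dP]] := pselect (Lv z); [by exists 1|by exists d].
    exists (Num.min (Num.min d1 d2) (Num.min d3 d4)); first by rewrite !lt_min d10 d20 d30.
    move=> w Lw [+ +]; rewrite !lt_min => /andP[/andP[h1 h2] /andP[h3 h4]] /andP[/andP[k1 k2]
      /andP[k3 k4]].
    have [lu|lv] := L_cover Lw.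
      rewrite (FU w)// (FU z Lz); last by apply: contrapT => n; exact: dP3 n w (conj h3 k3) lu.
      by have := dP1 _ h1; rewrite ballEmdist.
    rewrite (FV w)// (FV z Lz); last by apply: contrapT => n; exact: dP4 n w (conj h4 k4) lv.
    by have := dP2 _ k2; rewrite ballEmdist.
  (* A large filling requires a core time [t] with [a t] far from the common value at the ends of
     [c], so [t] is at least [d] away from both ends. Grid points on either side of [t] form a pair
     in [O c]. *)
  - move=> e e0; have [d d0 dP] := unif_cont01 ca (D0 e e0).
    have [gr grP] := grid d0.
    exists [seq (x, y) | x <- gr, y <- gr] => c z w zw.
    have [_ [nC GC]] := GP c.
    have Cc : C c by apply: contrapT => /nC GE; move: zw; rewrite GE mdistxx leNgt e0.
    have [_ _ _ _ G5] := GC Cc.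
    have [t [Kt /andP[t1 t2] ht]] : exists t, [/\ core C c t,
      c.1 <= t <= c.2 & D e <= mdist (a c.1) (a t)].
      apply: contrapT => h; move: zw; rewrite leNgt G5// => t Kt ct.
      by rewrite ltNge; apply/negP => ht; apply: h; exists t.
    have [c0 c12 c1 _] := lC.1 _ Cc.
    have hd1 : d <= t - c.1.
      rewrite leNgt; apply/negP => h; have := dP c.1 t; rewrite ballEmdist /=.
      by rewrite [mdist _ _ < _]ltNge ht => hh; suff : false by []; apply: hh;
        [lra|rewrite ltr_norml; lra].
    have hd2 : d <= c.2 - t.
      rewrite leNgt; apply/negP => h; have := dP c.2 t; rewrite ballEmdist /=.
      rewrite -(chord_eq pdm tg lC Cc) [mdist _ _ < _]ltNge ht => hh.
      by suff : false by []; apply: hh; [lra|rewrite ltr_norml; lra].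
    have [|x xg /andP[x1 x2]] := grP c.1 t c0 _ hd1; first lra.
    have [|y yg /andP[y1 y2]] := grP t c.2 _ c1 hd2; first lra.
    exists (x, y); first exact: allpairs_f.
    by split => //; exists t => //; rewrite x2.
(* At time [s] the triangle is traversed along the line [v - u = s], whose ends are on the two sides
   where [F] is [a 0]. *)
exists (fun z => F ((1 - clamp_real z.1) * clamp_real z.2, (1 - clamp_real z.1)
  * clamp_real z.2 + clamp_real z.1)).
have nO1 u v : u <= 0 \/ v <= u \/ 1 <= v -> forall c, ~ O c (u, v).
  move=> uv c [/lC.1 [c0 c12 c1 _] /= z1 z2 [t _ tz]]; case: uv => [|[|]]; lra.
have F1 (u v : R) : 1 <= v -> u <= v -> F (u, v) = a 0.
  move=> v1 uv; rewrite FV; first by rewrite a1// a01.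
  - by apply: nO1; right; right.
  - by split => //; left.
have F0 v : F (0, v) = a 0.
  by rewrite FU//; [apply: nO1; left|apply: Or32].
split.
- by cts.
- by [].
- move=> t t01; rewrite clampr0 subr0 mul1r addr0 clampr_id// FU//.
    by apply: nO1; right; left.
  by apply: Or31.
- by move=> t t01; rewrite clampr1 subrr mul0r add0r F0.
- move=> s s01; have /andP[s0 s1] := s01;
    rewrite clampr0 clampr1 mulr0 add0r F0 mulr1 (clampr_id s01) subrK F1 ?a01//; lra.
Qed.

End assembly.

(** * The kernel of the canonical homomorphism *)

Section kernel.
Context (R : realType) (X : metricType R) (P : set (set X)) (x0 : X).
Hypotheses (pdm : path_diameter_metric X) (tg : disjointly_tree_graded P)
  (uv0 : uniformly_1_UV0 (Pc P)).
Local Notation I := (unit_interval R).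

Lemma htp_path_homotopic (Y : topologicalType) (y z : Y) (p q : {path I from y to z}) :
  path_homotopic p q <-> htp setT (fun t : R => p (clamp t)) (fun t : R => q (clamp t)).
Proof.
split=> [[H [cH H0 H1 Hy Hz]]|[H [cH _ H0 H1 Hs]]].
  have cc := @continuous_clamp R.
  exists (fun w => H (clamp w.1, clamp w.2)); split => //.
  - by cts.
  - by move=> s _; rewrite !clamp0 !clamp1 path_zero path_one; split; [exact: Hy|exact: Hz].
have ci := @continuous_ival R.
exists (fun w => H (ival w.1, ival w.2)); split => /=.
- by cts.
- by move=> t; rewrite ival_zero H0 ?ivalP// clampK.
- by move=> t; rewrite ival_one H1 ?ivalP// clampK.
- by move=> s; have [] := Hs _ (ivalP s); rewrite ival_zero clamp0 path_zero.
- by move=> s; have [_] := Hs _ (ivalP s); rewrite ival_one clamp1 path_one.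
Qed.

Lemma Phi_kernel (g : pi1 R x0) : Phi P x0 g = 1%g -> g = 1%g.
Proof.
elim/pi1_ind: g => p Phi1.
pose a (t : R) := p (clamp t).
have ca : continuous a by apply: continuous_path_clamp; exact: cont_id.
have a0 t : t <= 0 -> a t = a 0 by move=> t0; rewrite /a !path_clamp_le0.
have a1 t : 1 <= t -> a t = a 1 by move=> t1; rewrite /a !path_clamp_ge1.
have g01 : good P a 0 1.
  move=> F d fF d0; pose F' : Fin P := SigSub (mem_set fF).
  have : pi1_Gamma F' (pi1_class p) = 1%g := congr1 (fun u : pi1_limit P x0 => thread u F') Phi1.
  rewrite /pi1_Gamma pi1_mapE pi1_class1 => /pi1_classP /htp_path_homotopic h.
  (* A null-homotopy in [X_F] makes the constant path available for every size [d]. *)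
  exists (cst (Gamma P F x0)); split; first exact: cont_cst.
    by apply: (htp_eq h) => // t t01; rewrite /sub /proj /a /= add0r subr0 mulr1.
  by move=> x y _ _; rewrite rhoxx.
have [C [lC mC]] := @maximal_laminar R (good P a).
have null := chords_null pdm tg uv0 ca a0 a1 g01 lC mC.
rewrite pi1_class1; apply/pi1_classP/htp_path_homotopic; apply: (htp_eq null) => // t _.
by rewrite /a path_clamp_le0.
Qed.

End kernel.

Theorem corollary1p2 (R : realType) (X : metricType R) (P : set (set X)) (x0 : X)
  (d_path_diameter : path_diameter_metric X)
  (X_tree_graded : disjointly_tree_graded P)
  (Pc_1UV0 : uniformly_1_UV0 (Pc P)) :
  injective (Phi P x0).
Proof.
move=> g h gh; apply/divg1_eq; apply: (Phi_kernel d_path_diameter X_tree_graded Pc_1UV0).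
by rewrite gmulfM gmulfV /= gh mulgV.
Qed.
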